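(* For each $s>-1$, the space $\widetilde{\mathcal{R}}(\mathbb{C}_+):=\big\{a_0+\sum_{k=1}^n a_k(\lambda_k+z)^{-1}: n\in\mathbb{N},\ a_k\in\mathbb{C},\ \lambda_k\in\mathbb{C}_+\big\}$ is dense in $\mathcal{D}_s$.
   Context: For $s>-1$, $\mathcal{D}_s$ is the Banach space of holomorphic $f$ on $\mathbb{C}_+$ with $\|f\|_{\mathcal{D}_{s,0}}=\int_0^\infty\alpha^s\int_{-\infty}^\infty\frac{|f'(\alpha+i\beta)|}{(\alpha^2+\beta^2)^{(s+1)/2}}d\beta\,d\alpha<\infty$, normed by $\|f\|_{\mathcal{D}_s}=|f(\infty)|+\|f\|_{\mathcal{D}_{s,0}}$, where $f(\infty)=\lim_{|z|\to\infty,|\arg z|<\psi}f(z)$ (exists for all $\psi\in(0,\pi/2)$). *)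

(* Defs.v *)
From HB Require Import structures.
From mathcomp Require Import all_boot all_order all_algebra.
From mathcomp Require Import all_classical all_reals all_analysis.
From mathcomp Require Import complex.
Set Implicit Arguments. Unset Strict Implicit. Unset Printing Implicit Defensive.
Import Order.TTheory GRing.Theory Num.Theory.
Import numFieldNormedType.Exports.
Local Open Scope classical_set_scope.
Local Open Scope ring_scope.
Local Open Scope complex_scope.

(* Complex numbers C = R[i] over an arbitrary realType R;
   R[i] is a numFieldType, hence a normed module over itself,
   so 'D_1 f z is the complex derivative. *)

Section Ds.
Variable R : realType.
Local Notation C := (R[i])^o.

Definition Cplus : set C := [set z | 0 < complex.Re z].

Definition holomorphic_on (D : set C) (f : C -> C) :=
  forall z, D z -> derivable f z 1.

Definition Ds0norm (s : R) (f : C -> C) : \bar R :=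
  (\int[@lebesgue_measure R]_(a in [set x : R | (0 < x)%R])
     ((a `^ s)%:E *
      \int[@lebesgue_measure R]_(b in [set: R])
        ((ComplexField.Normc.normc ('D_1 f (a +i* b)) /
          ((a ^+ 2 + b ^+ 2) `^ ((s + 1) / 2)))%R)%:E))%E.

Definition Ds (s : R) (f : C -> C) : Prop :=
  holomorphic_on Cplus f /\ (Ds0norm s f < +oo)%E.

(* the sector filter |z| -> oo, |arg z| < psi  (|arg z| < psi  <=>  Re z > |z| cos psi) *)
Definition sector_infty (psi : R) : set_system C :=
  [set P | exists M : R, forall z : C,
     M < ComplexField.Normc.normc z -> ComplexField.Normc.normc z * cos psi < complex.Re z -> P z].

Definition f_infty (f : C -> C) : C := lim (f @ sector_infty (pi / 4)).

Definition Dsnorm (s : R) (f : C -> C) : \bar R :=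
  ((ComplexField.Normc.normc (f_infty f))%:E + Ds0norm s f)%E.

Definition Rtilde (r : C -> C) : Prop :=
  exists (n : nat) (a0 : C) (a lam : nat -> C),
    (forall k, (k < n)%N -> 0 < complex.Re (lam k)) /\
    r = (fun z => a0 + \sum_(k < n) a k / (lam k + z)).

End Ds.

(* Main.v *)
Require Import Defs.
From HB Require Import structures.
From mathcomp Require Import all_boot all_order all_algebra.
From mathcomp Require Import all_classical all_reals all_analysis.
From mathcomp Require Import measurable_realfun complex ring lra.
Import Order.TTheory GRing.Theory Num.Theory.
Import numFieldNormedType.Exports.
Local Open Scope classical_set_scope.
Local Open Scope ring_scope.
Local Open Scope complex_scope.
Set Implicit Arguments. Unset Strict Implicit. Unset Printing Implicit Defensive.


(* Write [g = f'], and let [e_t = 1 + i t] span the half-line of slope [t] in the half-plane.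
   Integrating along these half-lines turns the seminorm of [f] into a weighted integral over [t]
   of the L^1 norms of [g] on the half-lines, so almost every half-line carries an integrable [g].
   Fix such a slope [t0] and average [g] over its half-line against the Mellin kernel
     k_m(zeta, z) = zeta^(m+1) z^m / (zeta + z)^(2m+2).
   Riemann sums show that this average [H_m(z)] is a limit, in the seminorm, of combinations of
   [z^m / (zeta + z)^(2m+2)], which are in turn limits of derivatives of rational functions: expand in
   powers of [(zeta + z)^-1] and replace multiple poles by difference quotients of simple ones.
   Because [g] is holomorphic, Cauchy's theorem allows the ray of integration to be rotated: on almost
   every half-line [H_m] is the average of [g] over that same half-line against a real kernel that
   depends only on the ratio of the two abscissas.  Normalised, these averages contract the L^1 norm
   and converge pointwise to [g], since u / (1 + u)^2 has a strict maximum at [u = 1]; by Scheffe's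
   argument they converge in L^1 of almost every half-line, and by dominated convergence in the
   seminorm.  The constant term then absorbs the value at infinity.  *)

(** The substitution b = a t cancels every power of a in a^s (a^2 + b^2)^(-(s+1)/2) db, so
    half-lines through 0 are the natural fibres and s survives only in the weight on slopes. The
    condition s > -1 enters as the finiteness of the seminorm of (1 + |z|)^(-2), the decay of
    derivatives of rational functions; this function is the majorant for the approximation errors.
    The obstacle is that an L^1 bound on the fibres gives no uniform control of g near 0 or at
    infinity. Hence the kernel is homogeneous of degree -1: with d zeta it is invariant under
    dilations, and by Tonelli the mass of a tail of g on the source half-line bounds the seminorm of
    what that tail produces. When zeta and z lie on one half-line, homogeneity also cancels the
    slope and leaves a real positive kernel. The balanced powers put the peak at equal abscissae,
    and the two spare factors in the denominator give the decay. In the rotation, the closing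
    segments need not be small at every abscissa; suitable abscissae tending to 0 and to infinity
    are found by averaging. *)

Local Notation Re := (@complex.Re _).
Local Notation Im := (@complex.Im _).
Local Notation normc := (@ComplexField.Normc.normc _).

(** * Complex norm and derivatives *)

Section ComplexNorm.
Variable R : realType.
Local Notation C := (R[i])^o.
Implicit Types (z w : C) (x y e : R).

Lemma norm_normc z : `|z| = (normc z)%:C.
Proof. by []. Qed.

Lemma normc_ge0 z : 0 <= normc z.
Proof. by case: z => a b; rewrite sqrtr_ge0. Qed.

Lemma normc_sqr z : normc z ^+ 2 = Re z ^+ 2 + Im z ^+ 2.
Proof. by case: z => a b; rewrite sqr_sqrtr// addr_ge0// sqr_ge0. Qed.

Lemma normcM z w : normc (z * w) = normc z * normc w.
Proof. exact: ComplexField.Normc.normcM. Qed.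

Lemma normcV z : normc (z^-1) = (normc z)^-1.
Proof. exact: ComplexField.Normc.normcV. Qed.

Lemma normc_eq0 z : (normc z == 0) = (z == 0).
Proof.
apply/eqP/eqP => [/ComplexField.Normc.eq0_normc//|->].
exact: ComplexField.Normc.normc0.
Qed.

Lemma normc_gt0 z : (0 < normc z) = (z != 0).
Proof. by rewrite lt_neqAle normc_ge0 andbT eq_sym normc_eq0. Qed.

Lemma normc_real x : normc (x%:C : C) = `|x|.
Proof. by rewrite /= expr0n addr0 sqrtr_sqr. Qed.

Lemma normcX z n : normc (z ^+ n) = normc z ^+ n.
Proof.
elim: n => [|n ih]; first by rewrite !expr0 ComplexField.Normc.normc1.
by rewrite !exprS normcM ih.
Qed.

Lemma normcN z : normc (- z) = normc z.
Proof. by case: z => a b /=; rewrite !sqrrN. Qed.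

Lemma normcD z w : normc (z + w) <= normc z + normc w.
Proof. exact: (le_normcD z w). Qed.

Lemma normcB z w : normc (z - w) <= normc z + normc w.
Proof. by rewrite -(normcN w) normcD. Qed.

Lemma normc_distC z w : normc (z - w) = normc (w - z).
Proof. by rewrite -normcN opprB. Qed.

Lemma complex_ReB z w : Re (z - w) = Re z - Re w.
Proof. by case: z; case: w. Qed.

Lemma abs_Re_le z : `|Re z| <= normc z.
Proof.
rewrite -(ler_pXn2r (n:=2))//= ?nnegrE ?normc_ge0//.
by rewrite normc_sqr real_normK ?num_real// lerDl sqr_ge0.
Qed.

Lemma complex_ImB z w : Im (z - w) = Im z - Im w.
Proof. by case: z; case: w. Qed.

Lemma abs_Im_le z : `|Im z| <= normc z.
Proof.
rewrite -(ler_pXn2r (n:=2))//= ?nnegrE ?normc_ge0//.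
by rewrite normc_sqr real_normK ?num_real// lerDr sqr_ge0.
Qed.

Lemma normc_le_ReIm z : normc z <= `|Re z| + `|Im z|.
Proof.
rewrite -(ler_pXn2r (n:=2))//= ?nnegrE ?normc_ge0 ?addr_ge0//.
rewrite normc_sqr -(real_normK (num_real (Re z))) -(real_normK (num_real (Im z))).
by rewrite sqrrD -addrA lerD2l lerDr mulrn_wge0// mulr_ge0.
Qed.

(** The norm of [C] takes values in [C], so the epsilon of [cvgrPdist_lt] is a complex number, whose
    positivity forces it to be real. Here it is traded for an element of [R]. *)
Lemma ccvgP T (F : set_system T) {FF : Filter F} (f : T -> C) (l : C) :
  f @ F --> l <-> forall e, 0 < e -> \forall t \near F, normc (f t - l) < e.
Proof.
split=> [/cvgrPdist_lt h e e0|h].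
  have : 0 < e%:C :> C by rewrite ltcR.
  move=> /h; apply: filterS => t.
  by rewrite norm_normc ltcR normc_distC.
apply/cvgrPdist_lt => e e0.
have ee : e = (Re e)%:C.
  by move: e0; rewrite ltcE; case: e => a b /= /andP[/eqP ->].
have e'0 : 0 < Re e by move: e0; rewrite {1}ee ltcR.
apply: filterS (h _ e'0) => t.
by rewrite norm_normc {2}ee ltcR normc_distC.
Qed.

Lemma near_normc z e : 0 < e -> \forall w \near nbhs (z : C), normc (w - z) < e.
Proof. by move=> e0; exact: (@ccvgP C (nbhs z) (nbhs_filter z) id z).1 (@cvg_id _ _) e e0. Qed.

Lemma continuous_normc : continuous (normc : C -> R).
Proof.
move=> z; apply/(@cvgrPdist_lt _ _ _ _ (nbhs_filter (z : C))) => e e0.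
near=> w; have h : normc (w - z) < e by (near: w; exact: near_normc).
  apply: le_lt_trans h.
rewrite ler_norml; apply/andP; split.
  by rewrite lerNl opprB lerBlDl -[leLHS](congr1 (fun t => normc t) (subrKC z w)) normcD.
by rewrite lerBlDl normc_distC -[leLHS](congr1 (fun t => normc t) (subrKC w z)) normcD.
Unshelve. all: by end_near. Qed.

Lemma continuous_Re : continuous (Re : C -> R).
Proof.
move=> z; apply/(@cvgrPdist_lt _ _ _ _ (nbhs_filter (z : C))) => e e0.
near=> w; have h : normc (w - z) < e by (near: w; exact: near_normc).
  apply: le_lt_trans h.
by rewrite distrC -complex_ReB abs_Re_le.
Unshelve. all: by end_near. Qed.

Lemma continuous_Im : continuous (Im : C -> R).
Proof.
move=> z; apply/(@cvgrPdist_lt _ _ _ _ (nbhs_filter (z : C))) => e e0.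
near=> w; have h : normc (w - z) < e by (near: w; exact: near_normc).
  apply: le_lt_trans h.
by rewrite distrC -complex_ImB abs_Im_le.
Unshelve. all: by end_near. Qed.

Lemma cvg_Complex T (F : set_system T) {FF : Filter F} (f g : T -> R) (a b : R) :
  f @ F --> a -> g @ F --> b -> (fun t => f t +i* g t : C) @ F --> (a +i* b : C).
Proof.
move=> /cvgrPdist_lt fa /cvgrPdist_lt gb; apply/ccvgP => e e0.
have e20 : 0 < e / 2 by rewrite divr_gt0.
near=> t; apply: (le_lt_trans (normc_le_ReIm _)) => /=.
rewrite [ltRHS](splitr e) ltrD// distrC; near: t.
  exact: fa.
exact: gb.
Unshelve. all: by end_near. Qed.

Lemma continuous_addC (f g : C -> C) (z : C) : {for z, continuous f} -> {for z, continuous g} ->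
  {for z, continuous (fun w => f w + g w)}.
Proof. by move=> h1 h2; exact: (@cvgD _ _ _ (nbhs z) (nbhs_filter z) f g (f z) (g z) h1 h2). Qed.
Lemma continuous_mulC (f g : C -> C) (z : C) : {for z, continuous f} -> {for z, continuous g} ->
  {for z, continuous (fun w => f w * g w)}.
Proof. by move=> h1 h2; exact: (@cvgM _ _ (nbhs z) (nbhs_filter z) f g (f z) (g z) h1 h2). Qed.
Lemma continuous_cstC (k z : C) : {for z, continuous (fun w : C => k)}.
Proof. exact: (@cvg_cst _ _ _ (nbhs z) (nbhs_filter z)). Qed.
Lemma continuous_idC (z : C) : {for z, continuous (fun w : C => w)}.
Proof. exact: (@cvg_id _ (nbhs z)). Qed.

(** This form has no division, covers h = 0, and uses the real-valued modulus; differentiability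
    enters the estimates of Goursat and Cauchy through it. *)
Lemma cderP (f : C -> C) z (D : C) : is_derive z 1 f D <->
  forall e, 0 < e -> exists2 d, 0 < d & forall h : C, normc h < d ->
    normc (f (z + h) - f z - D * h) <= e * normc h.
Proof.
have key (h : C) : h != 0 ->
    (h^-1 *: (f (h *: 1 + z) - f z) - D) = (f (z + h) - f z - D * h) / h.
  move=> h0; rewrite [h *: 1]mulr1 [h + z]addrC /GRing.scale/=.
  by rewrite mulrBl mulfK// mulrC.
split=> [[df dD] e e0|H].
  have /cvgrPdist_lt/(_ (e%:C)) : (fun h => h^-1 *: ((f \o shift z) (h *: 1) - f z)) @ (0 : C)^' --> D by rewrite -dD; exact: df.
  rewrite ltcR => /(_ e0) [] /= d'; rewrite ltcE /= => /andP[/eqP d'i d'0] H.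
  exists (Re d') => // h hd.
  have [->|h0] := eqVneq h 0.
    by rewrite addr0 subrr mulr0 subr0 ComplexField.Normc.normc0 mulr0.
  have := H h; rewrite /ball_/= sub0r normrN => /(_ _ h0).
  rewrite norm_normc; case: d' d'i d'0 hd {H} => a b /= -> a0 hd.
  rewrite ltcR hd => /(_ isT); rewrite norm_normc ltcR normc_distC.
  rewrite (_ : _ - D = (f (z + h) - f z - D * h) / h); last exact: key.
  rewrite normcM normcV.
  by move=> /ltW; rewrite ler_pdivrMr// normc_gt0.
have cv : (fun h => h^-1 *: ((f \o shift z) (h *: 1) - f z)) @ (0 : C)^' --> D.
  apply/ccvgP => e e0; have [d d0 Hd] := H _ (divr_gt0 e0 (ltr0Sn R 1)).
  have d0' : 0 < d%:C :> C by rewrite ltcR.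
  exists d%:C => // h; rewrite /ball_/= sub0r normrN norm_normc ltcR => hd h0.
  rewrite (_ : _ - D = (f (z + h) - f z - D * h) / h); last exact: key.
  rewrite normcM normcV ltr_pdivrMr ?normc_gt0//.
  apply: le_lt_trans (Hd _ hd) _; rewrite ltr_pM2r ?normc_gt0//.
  by rewrite ltr_pdivrMr// ltr_pMr// ltr1n.
by apply: DeriveDef; [apply/cvg_ex; exists D|exact/cvg_lim].
Qed.

Section ComplexDerivatives.
Variables (f g : C -> C) (z D E : C).
Hypothesis df : is_derive z 1 f D.

Lemma cderiv_cst (k : C) : is_derive z 1 (fun=> k) 0.
Proof. exact: is_derive_cst. Qed.

Lemma cderiv_id : is_derive z 1 (fun w => w) 1.
Proof. exact: is_derive_id. Qed.

Lemma cderivD : is_derive z 1 g E -> is_derive z 1 (fun w => f w + g w) (D + E).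
Proof. by move=> dg; exact: is_deriveD. Qed.

Lemma cderivB : is_derive z 1 g E -> is_derive z 1 (fun w => f w - g w) (D - E).
Proof. by move=> dg; exact: is_deriveB. Qed.

Lemma cderivM : is_derive z 1 g E -> is_derive z 1 (fun w => f w * g w) (D * g z + f z * E).
Proof.
move=> dg; have -> : D * g z + f z * E = f z *: E + g z *: D.
  by rewrite /GRing.scale/= addrC [g z * _]mulrC.
exact: (@is_deriveM _ _ f g z 1 D E).
Qed.

Lemma cderivX n : is_derive z 1 (fun w => f w ^+ n) (n%:R * f z ^+ n.-1 * D).
Proof.
rewrite (_ : (fun w => f w ^+ n) = f ^+ n); first exact: is_deriveX.
by apply/funext => w; elim: n => [|n ih]; rewrite ?expr0// !exprS ih.
Qed.

Lemma cderivV : f z != 0 -> is_derive z 1 (fun w => (f w)^-1) (- D / f z ^+ 2).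
Proof.
move=> fz0; have -> : - D / f z ^+ 2 = - (f z) ^- 2 *: D.
  by rewrite /GRing.scale/= mulNr mulNr mulrC.
apply: DeriveDef; first exact: (derivableV fz0 (ex_derive)).
by rewrite (deriveV fz0 (ex_derive)) derive_val.
Qed.
End ComplexDerivatives.

End ComplexNorm.

(** * Complex-valued integrals *)

Section ComplexIntegral.
Context d (T : measurableType d) (R : realType) (mu : {measure set T -> \bar R}).
Local Notation C := (R[i])^o.
Implicit Types (D : set T) (F G : T -> C).

Definition cmeasurable D F :=
  measurable_fun D (fun t => Re (F t)) /\ measurable_fun D (fun t => Im (F t)).

Definition cintegrable D F := mu.-integrable D (EFin \o (fun t => Re (F t))) /\
  mu.-integrable D (EFin \o (fun t => Im (F t))).

Definition cint D F : C :=
  (\int[mu]_(t in D) Re (F t)) +i* (\int[mu]_(t in D) Im (F t)).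

Lemma cmeasurable_normc D F : cmeasurable D F -> measurable_fun D (fun t => normc (F t)).
Proof.
move=> [mr mi]; rewrite (_ : (fun _ => _) = fun t => Num.sqrt (Re (F t) ^+ 2 + Im (F t) ^+ 2)).
  apply: (measurableT_comp (f := @Num.sqrt R)).
    by apply: continuous_measurable_fun; exact: sqrt_continuous.
  by apply: measurable_funD; exact: measurable_funX.
by apply/funext => t; case: (F t).
Qed.

Lemma cintegrable_measurable D F : cintegrable D F -> cmeasurable D F.
Proof. by move=> [/measurable_int/measurable_EFinP ? /measurable_int/measurable_EFinP]. Qed.

Lemma cintegrableP D F : measurable D -> cmeasurable D F ->
  cintegrable D F <-> mu.-integrable D (EFin \o (fun t => normc (F t))).
Proof.
move=> mD mF; have mN := cmeasurable_normc mF.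
split=> [[ir ii]|iN]; last first.
  split; apply: le_integrable iN => //.
  - by apply/measurable_EFinP; exact: mF.1.
  - by move=> t _ /=; rewrite lee_fin [leRHS]ger0_norm ?normc_ge0// abs_Re_le.
  - by apply/measurable_EFinP; exact: mF.2.
  - by move=> t _ /=; rewrite lee_fin [leRHS]ger0_norm ?normc_ge0// abs_Im_le.
have := integrableD mD (integrable_norm ir) (integrable_norm ii).
apply: le_integrable => //; first exact/measurable_EFinP.
move=> t _ /=; rewrite lee_fin ger0_norm ?normc_ge0// ger0_norm ?addr_ge0//.
exact: normc_le_ReIm.
Qed.

Lemma cintegrable_normc D F : measurable D -> cintegrable D F ->
  mu.-integrable D (EFin \o (fun t => normc (F t))).
Proof. by move=> mD iF; apply/cintegrableP => //; exact: cintegrable_measurable. Qed.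

Lemma cintegrableD D F G : measurable D -> cintegrable D F -> cintegrable D G ->
  cintegrable D (fun t => F t + G t).
Proof.
move=> mD [Fr Fi] [Gr Gi]; split; under eq_fun do rewrite /= raddfD.
  exact: (integrableD mD Fr Gr).
exact: (integrableD mD Fi Gi).
Qed.

Lemma cintegrableZ D (c : C) F : measurable D -> cintegrable D F ->
  cintegrable D (fun t => c * F t).
Proof.
move=> mD [Fr Fi]; split.
  rewrite (_ : _ \o _ = (fun t => ((Re c)%:E * (EFin \o (fun t => Re (F t))) t)%E) \+
      (fun t => (- Im c)%:E * (EFin \o (fun t => Im (F t))) t)%E)%E.
    by apply: integrableD => //; exact: integrableZl.
  by apply/funext => t /=; rewrite -!EFinM -EFinD mulNr; case: (F t); case: c.
rewrite (_ : _ \o _ = (fun t => ((Re c)%:E * (EFin \o (fun t => Im (F t))) t)%E) \+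
      (fun t => (Im c)%:E * (EFin \o (fun t => Re (F t))) t)%E)%E.
  by apply: integrableD => //; exact: integrableZl.
by apply/funext => t /=; rewrite -!EFinM -EFinD; case: (F t); case: c.
Qed.

Lemma cintD D F G : measurable D -> cintegrable D F -> cintegrable D G ->
  cint D (fun t => F t + G t) = cint D F + cint D G.
Proof.
move=> mD [Fr Fi] [Gr Gi]; rewrite /cint [RHS]/GRing.add/=; congr (_ +i* _).
  by rewrite -RintegralD//; apply: eq_Rintegral => t _; rewrite raddfD.
by rewrite -RintegralD//; apply: eq_Rintegral => t _; rewrite raddfD.
Qed.

Lemma cintZ D (c : C) F : measurable D -> cintegrable D F ->
  cint D (fun t => c * F t) = c * cint D F.
Proof.
move=> mD [Fr Fi]; case: c => a b.
have iZ r f : mu.-integrable D (EFin \o f) -> mu.-integrable D (EFin \o (fun t => r * f t)).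
  by move=> h; rewrite (_ : _ \o _ = fun t => (r%:E * (EFin \o f) t)%E)//; exact: integrableZl.
rewrite /cint [RHS]/GRing.mul/=; congr (_ +i* _).
  rewrite -!RintegralZl// -RintegralB//; [|exact: iZ|exact: iZ].
  by apply: eq_Rintegral => t _; case: (F t).
rewrite -!RintegralZl// -RintegralD//; [|exact: iZ|exact: iZ].
by apply: eq_Rintegral => t _; case: (F t).
Qed.

Lemma cintN D F : measurable D -> cintegrable D F -> cint D (fun t => - F t) = - cint D F.
Proof.
by move=> mD iF; rewrite -mulN1r -cintZ//; congr cint; apply/funext => t; rewrite mulN1r.
Qed.

Lemma cintB D F G : measurable D -> cintegrable D F -> cintegrable D G ->
  cint D (fun t => F t - G t) = cint D F - cint D G.
Proof.
move=> mD iF iG; rewrite -cintN// -cintD//.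
by rewrite (_ : (fun t => - _) = fun t => (-1) * G t);
  [exact: cintegrableZ|apply/funext => t; rewrite mulN1r].
Qed.

Lemma eq_cint D F G : {in D, F =1 G} -> cint D F = cint D G.
Proof. by move=> FG; congr (_ +i* _); apply: eq_Rintegral => t tD; rewrite FG. Qed.

(* Rotating [cint D F] onto the positive real axis reduces to the real inequality. *)
Lemma normc_cint_le D F : measurable D -> cintegrable D F ->
  normc (cint D F) <= \int[mu]_(t in D) normc (F t).
Proof.
move=> mD iF; have [->|I0] := eqVneq (cint D F) 0.
  rewrite ComplexField.Normc.normc0 Rintegral_ge0// => t _; exact: normc_ge0.
pose u : C := (cint D F)^-1 * (normc (cint D F))%:C.
have u1 : normc u = 1.
  by rewrite normcM normcV normc_real ger0_norm ?normc_ge0// mulVf// normc_eq0.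
have -> : normc (cint D F) = Re (cint D (fun t => u * F t)).
  by rewrite cintZ// /u mulrAC mulVf// mul1r.
apply: le_Rintegral => //; [|exact: cintegrable_normc|].
  exact: (cintegrableZ u mD iF).1.
by move=> t _; rewrite -[normc _]mul1r -u1 -normcM (le_trans _ (abs_Re_le _))// ler_norm.
Qed.

End ComplexIntegral.

(** * Integrals and derivatives of curves with a real parameter *)

Section CurveCalculus.
Variable R : realType.
Local Notation C := (R[i])^o.
Local Notation mu := (@lebesgue_measure R).
Implicit Types (F G P : R -> C) (a b c x y : R).

(** Two-sided continuity is asked even at the end points: the curves extend beyond the segment, and
    one-sided limits are avoided. *)
Definition ccont a b F := forall x, a <= x <= b -> {for x, continuous F}.

Lemma ccont_sub a b a' b' F : a <= a' -> b' <= b -> ccont a b F -> ccont a' b' F.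
Proof.
by move=> aa bb h x /andP[ax xb]; apply: h; rewrite (le_trans aa)// (le_trans xb).
Qed.

Lemma ccont_cintegrable a b F : ccont a b F -> cintegrable mu `[a, b] F.
Proof.
move=> cF; split; apply: continuous_compact_integrable; try exact: segment_compact;
  apply: continuous_in_subspaceT => x; rewrite inE/= in_itv/= => /cF Fx.
  by apply: (continuous_comp Fx); exact: continuous_Re.
by apply: (continuous_comp Fx); exact: continuous_Im.
Qed.

Lemma cint_itv_bound a b F M : a <= b -> ccont a b F ->
  (forall x, a <= x <= b -> normc (F x) <= M) -> normc (cint mu `[a, b] F) <= M * (b - a).
Proof.
move=> ab cF FM; have iF := ccont_cintegrable cF.
apply: le_trans (normc_cint_le _ iF) _ => //.
have mab : fine (mu `[a, b]) = b - a.
  rewrite lebesgue_measure_itv/= lte_fin; case: ltP => // ba.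
  by rewrite (@le_anti _ _ a b) ?ab// subrr.
rewrite -[in leRHS]mab -Rintegral_cst//; apply: le_Rintegral => //.
- exact: cintegrable_normc.
- apply: continuous_compact_integrable; first exact: segment_compact.
  by apply: continuous_in_subspaceT => x _; exact: cvg_cst.
Qed.

Lemma cint_itv_split a c b F : a <= c <= b -> ccont a b F ->
  cint mu `[a, b] F = cint mu `[a, c] F + cint mu `[c, b] F.
Proof.
move=> /andP[ac cb] cF; have [Fr Fi] := ccont_cintegrable cF.
have key (g : R -> R) : mu.-integrable `[a, b] (EFin \o g) ->
    \int[mu]_(x in `[a, b]) g x =
    \int[mu]_(x in `[a, c]) g x + \int[mu]_(x in `[c, b]) g x.
  move=> ig; rewrite -[X in _ + X]Rintegral_itv_obnd_cbnd; last first.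
    by apply: integrableS ig => // x/=; rewrite !in_itv/= => /andP[/ltW/(le_trans ac) -> ->].
  rewrite -(@Rintegral_itvB _ _ (BLeft a) (BRight b) c) ?bnd_simp//.
  by rewrite addrC subrK.
by rewrite /cint [RHS]/GRing.add/=; congr (_ +i* _); exact: key.
Qed.

(** [C] is a normed space over itself, not over [R], so a curve with a real parameter is
    differentiated componentwise. *)
Definition rderiv P x (D : C) :=
  is_derive x (1 : R) (fun t => Re (P t)) (Re D) /\ is_derive x (1 : R) (fun t => Im (P t)) (Im D).

Lemma rderiv_cst (k : C) x : rderiv (fun=> k) x 0.
Proof. by split; exact: is_derive_cst. Qed.

Lemma rderiv_real x : rderiv (fun t => t%:C) x 1.
Proof. by split; [exact: is_derive_id|exact: is_derive_cst]. Qed.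

Lemma rderivD P G x (D E : C) : rderiv P x D -> rderiv G x E ->
  rderiv (fun t => P t + G t) x (D + E).
Proof.
move=> [Pr Pi] [Gr Gi]; split; rewrite raddfD/=.
  by under eq_fun do rewrite raddfD/=; exact: is_deriveD.
by under eq_fun do rewrite raddfD/=; exact: is_deriveD.
Qed.

Lemma complex_ReM (z w : C) : Re (z * w) = Re z * Re w - Im z * Im w.
Proof. by case: z; case: w. Qed.

Lemma complex_ImM (z w : C) : Im (z * w) = Re z * Im w + Im z * Re w.
Proof. by case: z; case: w. Qed.

Lemma rderivM P G x (D E : C) : rderiv P x D -> rderiv G x E ->
  rderiv (fun t => P t * G t) x (D * G x + P x * E).
Proof.
move=> [Pr Pi] [Gr Gi]; split.
  under eq_fun do rewrite complex_ReM; rewrite raddfD/= !complex_ReM.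
  by apply: is_derive_eq; rewrite /GRing.scale/=; ring.
under eq_fun do rewrite complex_ImM; rewrite raddfD/= !complex_ImM.
by apply: is_derive_eq; rewrite /GRing.scale/=; ring.
Qed.

Lemma cint_FTC a b P G : a <= b -> (forall x, a <= x <= b -> rderiv P x (G x)) ->
  ccont a b G -> cint mu `[a, b] G = P b - P a.
Proof.
rewrite le_eqVlt => /predU1P[-> _ _|ab dP cG].
  by rewrite subrr set_itv1 /cint !Rintegral_set1.
have key (p g : R -> R) : (forall x, a <= x <= b -> is_derive x (1 : R) p (g x)) ->
    (forall x, a <= x <= b -> {for x, continuous g}) ->
    \int[mu]_(x in `[a, b]) g x = p b - p a.
  move=> dp cg; rewrite /Rintegral (@continuous_FTC2 _ g p)//.
  - by apply: continuous_in_subspaceT => x; rewrite inE/= in_itv/= => /cg.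
  - have cp x : a <= x <= b -> {for x, continuous p}.
      by move=> /dp dpx; apply/differentiable_continuous/derivable1_diffP; exact: ex_derive.
    split=> [x||].
    + by rewrite in_itv/= => /andP[/ltW ax /ltW xb]; apply: ex_derive; apply: dp; rewrite ax.
    + by apply: cvg_at_right_filter; apply: cp; rewrite lexx ltW.
    + by apply: cvg_at_left_filter; apply: cp; rewrite lexx ltW.
  - move=> x; rewrite in_itv/= => /andP[/ltW ax /ltW xb].
    have : a <= x <= b by rewrite ax.
    by move=> /dp dpx; rewrite derive1E; exact: derive_val.
have kRe := key (fun t => Re (P t)) (fun t => Re (G t)) (fun x h => (dP x h).1).
have kIm := key (fun t => Im (P t)) (fun t => Im (G t)) (fun x h => (dP x h).2).
rewrite /cint kRe ?kIm; first by case: (P b); case: (P a).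
- by move=> x /cG Gx; apply: (continuous_comp Gx); exact: continuous_Im.
- by move=> x /cG Gx; apply: (continuous_comp Gx); exact: continuous_Re.
Qed.

End CurveCalculus.

Lemma nested_intervals (R : realType) (a b : nat -> R) :
  (forall n, a n <= a n.+1) -> (forall n, b n.+1 <= b n) -> (forall n, a n <= b n) ->
  exists x, forall n, a n <= x <= b n.
Proof.
move=> aS bS ab.
have am m n : (m <= n)%N -> a m <= a n by move=> /subnK <-; elim: (n - m)%N => // k ih; exact: le_trans (aS _).
have bm m n : (m <= n)%N -> b n <= b m by move=> /subnK <-; elim: (n - m)%N => // k ih; exact: le_trans (bS _) _.
have amb m n : a m <= b n.
  by apply: le_trans (am _ _ (leq_maxl m n)) _; apply: le_trans (ab _) (bm _ _ (leq_maxr m n)).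
have ub n : ubound (range a) (b n) by move=> _ [m _ <-].
exists (sup (range a)) => n; apply/andP; split.
  by apply: ub_le_sup; [exists (b 0%N)|exists n].
by apply: ge_sup => //; exists (a 0%N); exists 0%N.
Qed.

(** * Cauchy's theorem on images of rectangles *)

Section Goursat.
Variable R : realType.
Local Notation C := (R[i])^o.
Local Notation mu := (@lebesgue_measure R).
Variables (z0 : C) (e e' : R -> C).
Hypothesis de : forall y, rderiv e y (e' y).
Hypothesis ce : forall y : R, {for y, continuous e}.
Hypothesis ce' : forall y : R, {for y, continuous e'}.
Implicit Types (h : C -> C) (a b c d x y : R).

(** Two coordinate systems are covered: polar ones around [z0], with [e] the unit circle, and
    (abscissa, slope), with [z0] = 0 and e(y) = 1 + i y. *)
Let Phi x y : C := z0 + x%:C * e y.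

Definition side_x h y a b := cint mu `[a, b] (fun x => h (Phi x y) * e y).
Definition side_y h x c d := cint mu `[c, d] (fun y => h (Phi x y) * (x%:C * e' y)).

(* The integral of [h] along the image under [(x, y) |-> z0 + x e(y)] of the boundary of a rectangle *)
Definition bd h a b c d :=
  side_x h c a b + side_y h b c d - side_x h d a b - side_y h a c d.

Definition cont_box h a b c d :=
  forall x y, a <= x <= b -> c <= y <= d -> {for Phi x y, continuous h}.

Lemma cont_real x : {for x, continuous (fun t : R => t%:C : C)}.
Proof. by apply: cvg_Complex; [exact: cvg_id|exact: cvg_cst]. Qed.

Lemma cont_Phi_x x y : {for x, continuous (fun t : R => Phi t y)}.
Proof.
apply: cvgD; first exact: cvg_cst.
by apply: cvgM; [exact: cont_real|exact: cvg_cst].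
Qed.

Lemma cont_Phi_y x y : {for y, continuous (fun t : R => Phi x t)}.
Proof.
apply: cvgD; first exact: cvg_cst.
by apply: cvgM; [exact: cvg_cst|exact: ce].
Qed.

Lemma ccont_side_x h a b c d y : cont_box h a b c d -> c <= y <= d ->
  ccont a b (fun x => h (Phi x y) * e y).
Proof.
move=> hc ycd x xab; apply: cvgM; last exact: cvg_cst.
by apply: (continuous_comp (@cont_Phi_x x y)); exact: hc.
Qed.

Lemma ccont_side_y h a b c d x : cont_box h a b c d -> a <= x <= b ->
  ccont c d (fun y => h (Phi x y) * (x%:C * e' y)).
Proof.
move=> hc xab y ycd; apply: cvgM; last by apply: cvgM; [exact: cvg_cst|exact: ce'].
by apply: (continuous_comp (@cont_Phi_y x y)); exact: hc.
Qed.

Lemma bd_split_x h a m b c d : a <= m <= b -> c <= d -> cont_box h a b c d ->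
  bd h a b c d = bd h a m c d + bd h m b c d.
Proof.
move=> amb cd hc; rewrite /bd.
have -> : side_x h c a b = side_x h c a m + side_x h c m b.
  by rewrite /side_x; apply: (cint_itv_split amb (ccont_side_x hc _)); rewrite lexx cd.
have -> : side_x h d a b = side_x h d a m + side_x h d m b.
  by rewrite /side_x; apply: (cint_itv_split amb (ccont_side_x hc _)); rewrite lexx cd.
ring.
Qed.

Lemma bd_split_y h a b c m d : a <= b -> c <= m <= d -> cont_box h a b c d ->
  bd h a b c d = bd h a b c m + bd h a b m d.
Proof.
move=> ab cmd hc; rewrite /bd.
have -> : side_y h a c d = side_y h a c m + side_y h a m d.
  by rewrite /side_y; apply: (cint_itv_split cmd (ccont_side_y hc _)); rewrite lexx ab.
have -> : side_y h b c d = side_y h b c m + side_y h b m d.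
  by rewrite /side_y; apply: (cint_itv_split cmd (ccont_side_y hc _)); rewrite lexx ab.
ring.
Qed.

Lemma bdD h1 h2 a b c d : a <= b -> c <= d -> cont_box h1 a b c d -> cont_box h2 a b c d ->
  bd (fun z => h1 z + h2 z) a b c d = bd h1 a b c d + bd h2 a b c d.
Proof.
move=> ab cd c1 c2; rewrite /bd.
have sx y : c <= y <= d -> side_x (fun z => h1 z + h2 z) y a b = side_x h1 y a b + side_x h2 y a b.
  move=> ycd; rewrite /side_x -cintD//.
  - by apply: eq_cint => x _; rewrite mulrDl.
  - exact: ccont_cintegrable (ccont_side_x c1 ycd).
  - exact: ccont_cintegrable (ccont_side_x c2 ycd).
have sy x : a <= x <= b -> side_y (fun z => h1 z + h2 z) x c d = side_y h1 x c d + side_y h2 x c d.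
  move=> xab; rewrite /side_y -cintD//.
  - by apply: eq_cint => y _; rewrite mulrDl.
  - exact: ccont_cintegrable (ccont_side_y c1 xab).
  - exact: ccont_cintegrable (ccont_side_y c2 xab).
rewrite !sx ?sy ?lexx ?ab ?cd//; ring.
Qed.

(** A + B z has the primitive A z + B z^2 / 2, so the integral over each side is a difference of
    values at corners and the four differences cancel. *)
Lemma bd_affine (A B : C) a b c d : a <= b -> c <= d ->
  bd (fun z => A + B * z) a b c d = 0.
Proof.
move=> ab cd; pose P (z : C) : C := A * z + B * (z * z) * 2^-1.
have hc : cont_box (fun z => A + B * z) a b c d.
  move=> x y _ _; apply: continuous_addC; first exact: continuous_cstC.
  by apply: continuous_mulC; [exact: continuous_cstC|exact: continuous_idC].
have dP (p : R -> C) x (D : C) : rderiv p x D -> rderiv (fun t => P (p t)) x ((A + B * p x) * D).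
  move=> dp; rewrite /P.
  have := rderivD (rderivM (rderiv_cst A x) dp) (rderivM (rderivM (rderiv_cst B x) (rderivM dp dp)) (rderiv_cst 2^-1 x)).
  by congr rderiv; field.
have sx y : c <= y <= d -> side_x (fun z => A + B * z) y a b = P (Phi b y) - P (Phi a y).
  move=> ycd; refine (cint_FTC (P := fun x => P (Phi x y)) ab _ (ccont_side_x hc ycd)).
  move=> t _; apply: dP; have := rderivD (rderiv_cst z0 t) (rderivM (rderiv_real t) (rderiv_cst (e y) t)).
  by congr rderiv; rewrite add0r mulr0 addr0 mul1r.
have sy x : a <= x <= b -> side_y (fun z => A + B * z) x c d = P (Phi x d) - P (Phi x c).
  move=> xab; refine (cint_FTC (P := fun y => P (Phi x y)) cd _ (ccont_side_y hc xab)).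
  move=> t _; apply: dP; have := rderivD (rderiv_cst z0 t) (rderivM (rderiv_cst x%:C t) (de t)).
  by congr rderiv; rewrite add0r mul0r add0r.
rewrite /bd !sx ?sy ?lexx ?ab ?cd//; ring.
Qed.

(** The images of the sides have length at most E (b - a) and X E (d - c); the factor 2 counts
    opposite sides. *)
Lemma bd_bound h a b c d E X M : a <= b -> c <= d -> cont_box h a b c d ->
  (forall y, c <= y <= d -> normc (e y) <= E) -> (forall y, c <= y <= d -> normc (e' y) <= E) ->
  (forall x, a <= x <= b -> `|x| <= X) ->
  (forall x y, a <= x <= b -> c <= y <= d -> normc (h (Phi x y)) <= M) ->
  normc (bd h a b c d) <= 2 * M * (E * (b - a) + X * E * (d - c)).
Proof.
move=> ab cd hc eE e'E xX hM.
have sx y : c <= y <= d -> normc (side_x h y a b) <= M * E * (b - a).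
  move=> ycd; apply: (cint_itv_bound ab (ccont_side_x hc ycd)).
  by move=> x xab; rewrite normcM ler_pM ?normc_ge0 ?hM ?eE.
have sy x : a <= x <= b -> normc (side_y h x c d) <= M * (X * E) * (d - c).
  move=> xab; apply: (cint_itv_bound cd (ccont_side_y hc xab)).
  move=> y ycd; rewrite !normcM normc_real.
  by rewrite ler_pM ?mulr_ge0 ?normc_ge0 ?hM// ler_pM ?normc_ge0 ?xX ?e'E.
have [h1 h2 h3 h4] : [/\ normc (side_x h c a b) <= M * E * (b - a), normc (side_x h d a b) <= M * E * (b - a),
    normc (side_y h a c d) <= M * (X * E) * (d - c) & normc (side_y h b c d) <= M * (X * E) * (d - c)].
  by split; [apply: sx|apply: sx|apply: sy|apply: sy]; rewrite lexx ?ab ?cd.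
rewrite /bd; apply: le_trans (normcB _ _) _.
move: (normcB (side_x h c a b + side_y h b c d) (side_x h d a b)).
move: (normcD (side_x h c a b) (side_y h b c d)) h1 h2 h3 h4.
move: (normc _) (normc _) (normc _) (normc _) (normc _) (normc _) => n1 n2 n3 n4 n5 n6.
lra.
Qed.

Let rect : Type := ((R * R) * (R * R))%type.
Let half (p : bool) (i : R * R) : R * R :=
  let m := (i.1 + i.2) / 2 in if p then (i.1, m) else (m, i.2).
Let quarter (p : bool * bool) (q : rect) : rect := (half p.1 q.1, half p.2 q.2).
Let bdr h (q : rect) := bd h q.1.1 q.1.2 q.2.1 q.2.2.
(** A quarter carrying at least a quarter of the boundary integral. By [next_le], the default branch
    contradicts the triangle inequality whenever [h] is continuous on the image. *)
Let next h (q : rect) : rect :=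
  if [pick p : bool * bool | normc (bdr h q) <= 4 * normc (bdr h (quarter p q))] is Some p
  then quarter p q else quarter (true, true) q.

Let nextE h q : exists p, next h q = quarter p q.
Proof. by rewrite /next; case: pickP => [p _|_]; eexists; reflexivity. Qed.

Let quarter_absurd (q q1 q2 q3 q4 : C) : q = q1 + q2 + (q3 + q4) ->
  4 * normc q1 < normc q -> 4 * normc q2 < normc q -> 4 * normc q3 < normc q ->
  4 * normc q4 < normc q -> forall P : Prop, P.
Proof.
move=> -> h1 h2 h3 h4; exfalso.
have := normcD (q1 + q2) (q3 + q4); have := normcD q1 q2; have := normcD q3 q4.
move: (normc _) (normc _) (normc _) h1 h2 h3 h4 => u v w; lra.
Qed.

Let next_le h q : q.1.1 <= q.1.2 -> q.2.1 <= q.2.2 -> cont_box h q.1.1 q.1.2 q.2.1 q.2.2 ->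
  normc (bdr h q) <= 4 * normc (bdr h (next h q)).
Proof.
move=> ab cd hc; rewrite /next; case: pickP => [p //|nle].
have lt p : 4 * normc (bdr h (quarter p q)) < normc (bdr h q) by rewrite ltNge nle.
case: q => [[a b] [c d]] /= in ab cd hc nle lt *.
have mx : a <= (a + b) / 2 <= b by rewrite midf_le// midf_le.
have my : c <= (c + d) / 2 <= d by rewrite midf_le// midf_le.
have e1 : bdr h ((a, b), (c, d)) = bdr h (quarter (true, true) ((a, b), (c, d)))
  + bdr h (quarter (true, false) ((a, b), (c, d))) + (bdr h (quarter (false, true) ((a, b), (c, d)))
  + bdr h (quarter (false, false) ((a, b), (c, d)))).
  rewrite /bdr/= (@bd_split_x h a ((a + b) / 2))//; congr (_ + _).
    apply: bd_split_y => //; first by case/andP: mx.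
    by move=> x y /andP[ax xm]; apply: hc; rewrite ax (le_trans xm)//; case/andP: mx.
  apply: bd_split_y => //; first by case/andP: mx.
  by move=> x y /andP[xm xb]; apply: hc; rewrite xb andbT (le_trans _ xm)//; case/andP: mx.
exact: (@quarter_absurd _ _ _ _ _ e1 (lt (true, true)) (lt (true, false)) (lt (false, true)) (lt (false, false))).
Qed.

Let halfP p i : i.1 <= i.2 -> [/\ i.1 <= (half p i).1, (half p i).2 <= i.2 &
  (half p i).2 - (half p i).1 = (i.2 - i.1) / 2].
Proof. by case: i => u v /= uv; rewrite /half; case: p => /=; split; lra. Qed.

(** The bisection runs in the parameter rectangle. The curved images enter only through a length
    bound ([bd_bound]) and a distance bound ([diam]), both of order 2^-n. *)
Theorem goursat h a b c d E : a <= b -> c <= d ->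
  (forall y, c <= y <= d -> normc (e y) <= E) -> (forall y, c <= y <= d -> normc (e' y) <= E) ->
  (forall x y, a <= x <= b -> c <= y <= d -> derivable h (Phi x y) 1) ->
  bd h a b c d = 0.
Proof.
move=> ab cd eE e'E dh.
have hc0 : cont_box h a b c d.
  by move=> x y xab ycd; apply/differentiable_continuous/derivable1_diffP; exact: dh.
pose Q n := iter n (next h) ((a, b), (c, d)).
have Q1 n : [/\ (Q n).1.1 <= (Q n).1.2, (Q n).1.1 <= (Q n.+1).1.1 , (Q n.+1).1.2 <= (Q n).1.2 &
    (Q n).1.2 - (Q n).1.1 = (b - a) / 2 ^+ n].
  elim: n => [|n [i1 i2 i3 i4]].
    rewrite /Q/= divr1; have [p ->] := nextE h ((a, b), (c, d)).
    by have [] := @halfP p.1 (a, b) ab; rewrite /=.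
  have [p Ep] := nextE h (Q n); have [p' Ep'] := nextE h (Q n.+1).
  have [] := @halfP p.1 (Q n).1 i1; rewrite -[half _ _]/(quarter p (Q n)).1 -Ep -[next h (Q n)]/(Q n.+1).
  move=> j1 j2 j3.
  have i5 : (Q n.+1).1.2 - (Q n.+1).1.1 = (b - a) / 2 ^+ n.+1.
    by rewrite j3 i4 exprSr invfM mulrA.
  have i6 : (Q n.+1).1.1 <= (Q n.+1).1.2.
    by rewrite -subr_ge0 i5 divr_ge0 ?exprn_ge0// subr_ge0.
  have [] := @halfP p'.1 (Q n.+1).1 i6.
  by rewrite -[half _ _]/(quarter p' (Q n.+1)).1 -Ep' -[next h (Q n.+1)]/(Q n.+2).
have Q2 n : [/\ (Q n).2.1 <= (Q n).2.2, (Q n).2.1 <= (Q n.+1).2.1 , (Q n.+1).2.2 <= (Q n).2.2 &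
    (Q n).2.2 - (Q n).2.1 = (d - c) / 2 ^+ n].
  elim: n => [|n [i1 i2 i3 i4]].
    rewrite /Q/= divr1; have [p ->] := nextE h ((a, b), (c, d)).
    by have [] := @halfP p.2 (c, d) cd; rewrite /=.
  have [p Ep] := nextE h (Q n); have [p' Ep'] := nextE h (Q n.+1).
  have [] := @halfP p.2 (Q n).2 i1; rewrite -[half _ _]/(quarter p (Q n)).2 -Ep -[next h (Q n)]/(Q n.+1).
  move=> j1 j2 j3.
  have i5 : (Q n.+1).2.2 - (Q n.+1).2.1 = (d - c) / 2 ^+ n.+1.
    by rewrite j3 i4 exprSr invfM mulrA.
  have i6 : (Q n.+1).2.1 <= (Q n.+1).2.2.
    by rewrite -subr_ge0 i5 divr_ge0 ?exprn_ge0// subr_ge0.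
  have [] := @halfP p'.2 (Q n.+1).2 i6.
  by rewrite -[half _ _]/(quarter p' (Q n.+1)).2 -Ep' -[next h (Q n.+1)]/(Q n.+2).
have Q1in n : a <= (Q n).1.1 /\ (Q n).1.2 <= b.
  elim: n => [|n [h1 h2]]; first by rewrite /Q/=.
  by have [_ h3 h4 _] := Q1 n; rewrite (le_trans h1)// (le_trans h4).
have Q2in n : c <= (Q n).2.1 /\ (Q n).2.2 <= d.
  elim: n => [|n [h1 h2]]; first by rewrite /Q/=.
  by have [_ h3 h4 _] := Q2 n; rewrite (le_trans h1)// (le_trans h4).
have Q1sub n x : (Q n).1.1 <= x <= (Q n).1.2 -> a <= x <= b.
  by have [h1 h2] := Q1in n; move=> /andP[h3 h4]; rewrite (le_trans h1)// (le_trans h4).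
have Q2sub n x : (Q n).2.1 <= x <= (Q n).2.2 -> c <= x <= d.
  by have [h1 h2] := Q2in n; move=> /andP[h3 h4]; rewrite (le_trans h1)// (le_trans h4).
have hcn n : cont_box h (Q n).1.1 (Q n).1.2 (Q n).2.1 (Q n).2.2.
  by move=> x y /Q1sub xab /Q2sub ycd; exact: hc0.
have Qle n : normc (bd h a b c d) <= 4 ^+ n * normc (bdr h (Q n)).
  elim: n => [|n ih]; first by rewrite mul1r.
  apply: (le_trans ih); rewrite exprSr -mulrA; apply: ler_wpM2l; first exact: exprn_ge0.
  by have [] := (Q1 n, Q2 n) => -[? _ _ _] [? _ _ _]; apply: next_le.
have [x0 x0Q] : exists x, forall n, (Q n).1.1 <= x <= (Q n).1.2.
  by apply: nested_intervals => n; have [] := Q1 n.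
have [y0 y0Q] : exists y, forall n, (Q n).2.1 <= y <= (Q n).2.2.
  by apply: nested_intervals => n; have [] := Q2 n.
pose z := Phi x0 y0; pose D := 'D_1 h z.
have /cderP Hd : is_derive z 1 h D.
  by split => //; apply: dh; [exact: (Q1sub 0%N)|exact: (Q2sub 0%N)].
(* [S] serves twice: S / 2^n bounds the distance to [z] within the n-th image, and 2 S / 2^n bounds
   the length of its boundary. *)
pose X := `|a| + `|b|; pose S := E * (b - a) + X * E * (d - c).
have E0 : 0 <= E by apply: le_trans (eE c _); rewrite ?normc_ge0// lexx cd.
have S0 : 0 <= S by rewrite addr_ge0 ?mulr_ge0 ?subr_ge0 ?addr_ge0.
have xX x : a <= x <= b -> `|x| <= X.
  move=> /andP[ax xb]; rewrite /X ler_norml.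
  by have := ler_norm (- a); have := ler_norm b; have := normr_ge0 a; have := normr_ge0 b; rewrite normrN => *; lra.
have elip y y' : c <= y -> y' <= d -> y <= y' -> normc (e y' - e y) <= E * (y' - y).
  move=> cy yd yy.
  have <- := cint_FTC yy (fun x _ => de x) (fun x _ => @ce' x).
  apply: (cint_itv_bound yy (fun x _ => @ce' x)) => t /andP[yt ty].
  by apply: e'E; rewrite (le_trans cy)//= (le_trans ty).
have elip' y y' : c <= y <= d -> c <= y' <= d -> normc (e y' - e y) <= E * `|y' - y|.
  move=> /andP[? ?] /andP[? ?]; case: (leP y y') => yy'.
    by rewrite ger0_norm ?subr_ge0//; exact: elip.
  by rewrite normc_distC distrC ger0_norm ?subr_ge0 ?(ltW yy')//; apply: elip => //; exact: ltW.
have diam n x y : (Q n).1.1 <= x <= (Q n).1.2 -> (Q n).2.1 <= y <= (Q n).2.2 ->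
    normc (Phi x y - z) <= S / 2 ^+ n.
  move=> hx hy.
  have -> : Phi x y - z = (x - x0)%:C * e y + x0%:C * (e y - e y0).
    by rewrite /z /Phi rmorphB/=; ring.
  apply: le_trans (normcD _ _) _; rewrite !normcM !normc_real.
  have hx0 := x0Q n; have hy0 := y0Q n.
  have l1 : `|x - x0| <= (b - a) / 2 ^+ n.
    have [_ _ _ <-] := Q1 n; rewrite ler_norml.
    by move: hx hx0 => /andP[? ?] /andP[? ?]; lra.
  have l2 : `|y - y0| <= (d - c) / 2 ^+ n.
    have [_ _ _ <-] := Q2 n; rewrite ler_norml.
    by move: hy hy0 => /andP[? ?] /andP[? ?]; lra.
  rewrite /S mulrDl lerD//.
    by rewrite -mulrA [leRHS]mulrC ler_pM ?normc_ge0// eE// (Q2sub n).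
  rewrite -2!mulrA ler_pM ?normc_ge0 ?xX ?(Q1sub n)//.
  apply: le_trans (elip' _ _ _ _) _; rewrite ?(Q2sub n)//.
  by rewrite -mulrA ler_wpM2l.
apply/eqP; rewrite -normc_eq0 eq_le normc_ge0 andbT; apply/ler_addgt0Pr => eta eta0; rewrite add0r.
(* The final bound is 4^n * 2 ee (S / 2^n)^2 = 2 S^2 ee, at most [eta]; the added 1 covers S = 0. *)
pose ee := eta / (2 * S ^+ 2 + 1).
have S1 : 0 < 2 * S ^+ 2 + 1 by rewrite ltr_wpDl// mulr_ge0// sqr_ge0.
have ee0 : 0 < ee by exact: divr_gt0.
have [dl dl0 Hdl] := Hd ee ee0.
have [n hn] : exists n, S / 2 ^+ n < dl.
  exists (Num.bound (S / dl)); rewrite ltr_pdivrMr ?exprn_gt0// mulrC -ltr_pdivrMr//.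
  apply: lt_trans (archi_boundP _) _; first by rewrite divr_ge0// ltW.
  by rewrite -natrX ltr_nat ltn_expl.
have [[ab' _ _ Eab] [cd' _ _ Ecd]] := (Q1 n, Q2 n).
(* [A + D * w] is the first-order expansion of [h] at [z]. Its boundary integral vanishes by
   [bd_affine], so only the remainder [rem] counts. *)
pose A := h z - D * z; pose rem (w : C) : C := h w - (A + D * w).
have cA : cont_box (fun w => A + D * w) (Q n).1.1 (Q n).1.2 (Q n).2.1 (Q n).2.2.
  move=> x y _ _; apply: continuous_addC; first exact: continuous_cstC.
  by apply: continuous_mulC; [exact: continuous_cstC|exact: continuous_idC].
have cr : cont_box rem (Q n).1.1 (Q n).1.2 (Q n).2.1 (Q n).2.2.
  move=> x y hx hy; have -> : rem = fun w => h w + (-1) * (A + D * w).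
    by apply/funext => w; rewrite mulN1r.
  apply: continuous_addC; first exact: hcn hx hy.
  by apply: continuous_mulC; [exact: continuous_cstC|exact: cA hx hy].
have hE : h = fun w => (A + D * w) + rem w by apply/funext => w; rewrite /rem addrC subrK.
apply: le_trans (Qle n) _.
have -> : bdr h (Q n) = bdr rem (Q n).
  by rewrite /bdr [in LHS]hE bdD// bd_affine// add0r.
have : normc (bdr rem (Q n)) <= 2 * (ee * (S / 2 ^+ n)) * (S / 2 ^+ n).
  apply: le_trans (bd_bound ab' cd' cr (fun y hy => eE y (Q2sub n y hy))
    (fun y hy => e'E y (Q2sub n y hy)) (fun x hx => xX x (Q1sub n x hx)) (M := ee * (S / 2 ^+ n)) _) _.
    move=> x y hx hy; have hd := diam n x y hx hy.
    have := Hdl _ (le_lt_trans hd hn).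
    rewrite (_ : z + _ = Phi x y); last by rewrite addrC subrK.
    rewrite (_ : h (Phi x y) - h z - D * (Phi x y - z) = rem (Phi x y)); last first.
      by rewrite /rem /A; ring.
    by move=> /le_trans; apply; rewrite ler_wpM2l// ltW.
  rewrite Eab Ecd (_ : E * _ + _ = S / 2 ^+ n) //; by rewrite /S; ring.
have p0 : 0 < (2:R) ^+ n by exact: exprn_gt0.
move=> H; apply: le_trans (ler_wpM2l _ H) _; first exact: exprn_ge0.
rewrite (_ : (4:R) = 2 * 2); last by rewrite -natrM.
rewrite exprMn; move: (2 ^+ n) p0 => p p0.
have -> : p * p * (2 * (ee * (S / p)) * (S / p)) = 2 * S ^+ 2 * ee by field; rewrite gt_eqF.
rewrite /ee mulrCA ger_pMr// ler_pdivrMr// mul1r lerDl ler01//.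
Qed.

End Goursat.

(** * Regularity of holomorphic functions *)

Section Circle.
Variable R : realType.
Local Notation C := (R[i])^o.

Definition ecirc (t : R) : C := cos t +i* sin t.
Definition ecirc' (t : R) : C := (- sin t) +i* cos t.

Lemma rderiv_ecirc t : rderiv ecirc t (ecirc' t).
Proof. by split; [exact: is_derive_cos|exact: is_derive_sin]. Qed.

Lemma continuous_ecirc (t : R) : {for t, continuous ecirc}.
Proof. by apply: cvg_Complex; [exact: continuous_cos|exact: continuous_sin]. Qed.

Lemma continuous_ecirc' (t : R) : {for t, continuous ecirc'}.
Proof. by apply: cvg_Complex; [apply: cvgN; exact: continuous_sin|exact: continuous_cos]. Qed.

Lemma normc_ecirc t : normc (ecirc t) = 1.
Proof. by rewrite /= cos2Dsin2 sqrtr1. Qed.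

Lemma normc_ecirc' t : normc (ecirc' t) = 1.
Proof. by rewrite /= sqrrN addrC cos2Dsin2 sqrtr1. Qed.

Lemma ecirc_neq0 t : ecirc t != 0.
Proof. by rewrite -normc_gt0 normc_ecirc. Qed.

Lemma ecirc'E t : ecirc' t = 'i%C * ecirc t.
Proof. by apply/eqP; rewrite eq_complex /= !mul0r !mul1r sub0r add0r !eqxx. Qed.

Lemma ecirc_2pi : ecirc (2 * pi) = ecirc 0.
Proof. by rewrite /ecirc mulr_natl cos2pi sin2pi cos0 sin0. Qed.
End Circle.

(** * Mean value and Taylor estimates on a ball *)

Section Cauchy.
Variable R : realType.
Local Notation C := (R[i])^o.
Local Notation mu := (@lebesgue_measure R).
Implicit Types (f : C -> C) (z w : C) (r rho M L : R).

Lemma rderivP (P : R -> C) (x : R) (D : C) :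
  (forall e, 0 < e -> exists2 d, 0 < d & forall k : R, `|k| < d ->
    normc (P (x + k) - P x - k%:C * D) <= e * `|k|) -> rderiv P x D.
Proof.
move=> H.
have key (g : R -> R) (a : R) : (forall e, 0 < e -> exists2 d, 0 < d & forall k : R, `|k| < d ->
    `|g (x + k) - g x - k * a| <= e * `|k|) -> is_derive x (1 : R) g a.
  move=> {}H.
  have cv : (fun h => h^-1 *: ((g \o shift x) (h *: 1) - g x)) @ (0 : R)^' --> a.
    apply/cvgrPdist_lt => e e0; have [d d0 Hd] := H _ (divr_gt0 e0 (ltr0Sn R 1)).
    exists d => // h; rewrite /ball_/= sub0r normrN => hd h0.
    rewrite distrC (_ : _ - a = h^-1 * (g (x + h) - g x - h * a)); last first.
      by rewrite [h *: 1]mulr1 [h + x]addrC /GRing.scale/= [RHS]mulrBr mulKf.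
    rewrite normrM normfV mulrC ltr_pdivrMr ?normr_gt0//.
    apply: le_lt_trans (Hd _ hd) _; rewrite ltr_pM2r ?normr_gt0//.
    by rewrite ltr_pdivrMr// ltr_pMr// ltr1n.
  by apply: DeriveDef; [apply/cvg_ex; exists a|exact/cvg_lim].
split; apply: key => e /H[d d0 Hd]; exists d => // k /Hd; apply: le_trans.
  by apply: le_trans (abs_Re_le _); rewrite !complex_ReB complex_ReM/= mul0r subr0.
by apply: le_trans (abs_Im_le _); rewrite !complex_ImB complex_ImM/= mul0r addr0.
Qed.

Lemma rderiv_line f z (v : C) (s : R) D : is_derive (z + s%:C * v) 1 f D ->
  rderiv (fun t => f (z + t%:C * v)) s (D * v).
Proof.
move=> /cderP H; apply: rderivP => e e0.
have v1 : 0 < normc v + 1 by rewrite ltr_wpDl// normc_ge0.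
have [d d0 Hd] := H _ (divr_gt0 e0 v1).
exists (d / (normc v + 1)); first exact: divr_gt0.
move=> k; rewrite ltr_pdivlMr// => kd.
have kv : normc (k%:C * v) < d.
  rewrite normcM normc_real; apply: le_lt_trans kd.
  by rewrite ler_wpM2l// lerDl.
have -> : z + (s + k)%:C * v = z + s%:C * v + k%:C * v by rewrite rmorphD/=; ring.
rewrite (_ : k%:C * (D * v) = D * (k%:C * v)); last by ring.
apply: le_trans (Hd _ kv) _; rewrite normcM normc_real -mulrA ler_pM2l//.
rewrite mulrCA ler_piMr// mulrC ler_pdivrMr// mul1r lerDl//.
Qed.

Definition holo_ball f z rho := forall w, normc (w - z) < rho -> derivable f w 1.

(** The real mean value theorem is applied to Re (u f) along the segment from w to w', where the
    unimodular [u] turns the increment of [f] into its modulus. *)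
Lemma lipschitz_ball f z rho M : holo_ball f z rho ->
  (forall w, normc (w - z) < rho -> normc ('D_1 f w) <= M) ->
  forall w w', normc (w - z) < rho -> normc (w' - z) < rho ->
    normc (f w' - f w) <= M * normc (w' - w).
Proof.
move=> hf fM w w' hw hw'.
have M0 : 0 <= M by apply: le_trans (fM w hw); exact: normc_ge0.
have [->|I0] := eqVneq (f w' - f w) 0.
  by rewrite ComplexField.Normc.normc0 mulr_ge0// normc_ge0.
pose v : C := w' - w.
pose u : C := (f w' - f w)^-1 * (normc (f w' - f w))%:C.
have u1 : normc u = 1.
  by rewrite normcM normcV normc_real ger0_norm ?normc_ge0// mulVf// normc_eq0.
have seg (s : R) : 0 <= s <= 1 -> normc (w + s%:C * v - z) < rho.
  move=> /andP[s0 s1].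
  have -> : w + s%:C * v - z = (1 - s)%:C * (w - z) + s%:C * (w' - z).
    by rewrite /v rmorphB/=; ring.
  apply: le_lt_trans (normcD _ _) _; rewrite !normcM !normc_real !ger0_norm ?subr_ge0//.
  have [->|sn0] := eqVneq s 0; first by rewrite subr0 mul1r mul0r addr0.
  have sp : 0 < s by rewrite lt_neqAle eq_sym sn0.
  rewrite (_ : rho = (1 - s) * rho + s * rho); last by ring.
  by rewrite ler_ltD ?ler_wpM2l ?subr_ge0// ?ltW// ltr_pM2l.
pose g (s : R) := Re (u * f (w + s%:C * v)).
have dg (s : R) : 0 <= s <= 1 -> is_derive s (1 : R) g (Re (u * ('D_1 f (w + s%:C * v) * v))).
  move=> /seg hs; have : is_derive (w + s%:C * v) 1 f ('D_1 f (w + s%:C * v)).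
    by split => //; exact: hf.
  move=> /rderiv_line h; have [] := rderivM (rderiv_cst u s) h.
  by rewrite mul0r add0r.
have [||s /[!in_itv]/= /andP[s0 s1]] := MVT (f := g) (df := fun s => Re (u * ('D_1 f (w + s%:C * v) * v))) (@ltr01 R).
- by move=> s; rewrite in_itv/= => /andP[/ltW ? /ltW ?]; apply: dg; apply/andP.
- apply: continuous_in_subspaceT => s; rewrite inE/= in_itv/= => /dg dgs.
  by apply/differentiable_continuous/derivable1_diffP; exact: ex_derive.
have -> : g 1 - g 0 = normc (f w' - f w).
  have e1 : w + 1%:C * v = w' by rewrite /v rmorph1 mul1r addrC subrK.
  have e0 : w + 0%:C * v = w by rewrite rmorph0 mul0r addr0.
  rewrite /g -complex_ReB -mulrBr e1 e0.
  by rewrite /u mulrAC mulVf// mul1r.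
move=> ->; rewrite subr0 mulr1; apply: le_trans (ler_norm _) _.
apply: le_trans (abs_Re_le _) _; rewrite normcM u1 mul1r normcM ler_wpM2r ?normc_ge0//.
by apply: fM; apply: seg; rewrite !ltW.
Qed.

(** Subtract the linear part at [w]: what remains has derivative at most 2 L |h| on a ball around
    [w] that contains w + h, and [lipschitz_ball] applies there. *)
Lemma taylor1_ball f z rho L w h : holo_ball f z rho ->
  (forall u v, normc (u - z) < rho -> normc (v - z) < rho ->
     normc ('D_1 f u - 'D_1 f v) <= L * normc (u - v)) -> 0 <= L ->
  normc (w - z) < rho / 2 -> normc h < rho / 2 ->
  normc (f (w + h) - f w - 'D_1 f w * h) <= 2 * L * normc h * normc h.
Proof.
move=> hf fL L0 wz hh.
have [->|h0] := eqVneq h 0.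
  by rewrite addr0 mulr0 subrr subr0 ComplexField.Normc.normc0 !mulr0.
have hp : 0 < normc h by rewrite normc_gt0.
have wr : normc (w - z) < rho by lra.
pose D := 'D_1 f w; pose k (u : C) : C := f u - D * u.
have sub (u : C) : normc (u - w) < rho / 2 -> normc (u - z) < rho.
  move=> uw; have -> : u - z = (u - w) + (w - z) by ring.
  apply: le_lt_trans (normcD _ _) _; lra.
have dk (u : C) : normc (u - w) < rho / 2 -> is_derive u 1 k ('D_1 f u - D).
  move=> /sub uz; have df : is_derive u 1 f ('D_1 f u) by split => //; exact: hf.
  have -> : 'D_1 f u - D = 'D_1 f u - (D *: 1 : C) by rewrite [_ *: _]mulr1.
  exact: is_deriveB.
(* The radius 2 |h| keeps w + h strictly inside the ball; the minimum with rho / 2 keeps the ball in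
   the domain of [f]. *)
have m2 : Num.min (2 * normc h) (rho / 2) <= 2 * normc h by rewrite ge_min lexx.
have mr : Num.min (2 * normc h) (rho / 2) <= rho / 2 by rewrite ge_min lexx orbT.
have := @lipschitz_ball k w (Num.min (2 * normc h) (rho / 2)) (2 * L * normc h) _ _ w (w + h) _ _.
rewrite subrr ComplexField.Normc.normc0 [w + h - w]addrC addKr.
rewrite (_ : k (w + h) - k w = f (w + h) - f w - 'D_1 f w * h); last by rewrite /k /D; ring.
apply.
- by move=> u /lt_le_trans/(_ mr)/dk dku; exact: ex_derive.
- move=> u hu; have hu1 := lt_le_trans hu mr; have hu2 := lt_le_trans hu m2.
  have dku := dk _ hu1; rewrite derive_val.
  apply: le_trans (fL _ _ (sub _ hu1) wr) _; rewrite [leRHS]mulrAC [leRHS]mulrC ler_wpM2l// ltW//.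
- by rewrite lt_min mulr_gt0//=; lra.
- by rewrite lt_min hh ltr_pMl// ltr1n.
Qed.

End Cauchy.

(** * Cauchy's formula for the derivative, and holomorphy of the derivative *)

Section CauchyDerivative.
Variable R : realType.
Local Notation C := (R[i])^o.
Local Notation mu := (@lebesgue_measure R).
Implicit Types (f : C -> C) (z w : C) (r rho M L : R).

Lemma pi2_ge0 : 0 <= 2 * pi :> R.
Proof. by rewrite mulr_ge0// pi_ge0. Qed.

Lemma pi2_gt0 : 0 < 2 * pi :> R.
Proof. by rewrite mulr_gt0// pi_gt0. Qed.

Lemma cint_itv_cst (a b : R) (D : C) : a <= b -> cint mu `[a, b] (fun=> D) = (b - a)%:C * D.
Proof.
move=> ab; rewrite (cint_FTC (P := fun t => t%:C * D) ab).
- by rewrite rmorphB/= mulrBl.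
- move=> t _; have := rderivM (rderiv_real t) (rderiv_cst D t).
  by rewrite mulr0 addr0 mul1r.
- by move=> t _; exact: cvg_cst.
Qed.

Lemma continuous_circle f z r : (forall t, {for z + r%:C * ecirc t, continuous f}) ->
  forall t : R, {for t, continuous (fun t => f (z + r%:C * ecirc t))}.
Proof.
move=> cf t; apply: continuous_comp; last exact: cf.
apply: cvgD; first exact: cvg_cst.
by apply: cvgM; [exact: cvg_cst|exact: continuous_ecirc].
Qed.

Lemma circle_neq0 r t : 0 < r -> r%:C * ecirc t != 0 :> C.
Proof. by move=> r0; rewrite mulf_neq0 ?ecirc_neq0// eq_complex /= eqxx andbT gt_eqF. Qed.

Lemma normc_circle r t : 0 < r -> normc (r%:C * ecirc t) = r.
Proof. by move=> r0; rewrite normcM normc_ecirc mulr1 normc_real gtr0_norm. Qed.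

Lemma continuous_circle_quot (g : R -> C) r : 0 < r -> (forall t : R, {for t, continuous g}) ->
  forall t : R, {for t, continuous (fun t => g t / (r%:C * ecirc t))}.
Proof.
move=> r0 cg t; apply: cvgM; first exact: cg.
apply: cvgV; first exact: circle_neq0.
by apply: cvgM; [exact: cvg_cst|exact: continuous_ecirc].
Qed.

Let quot f z r t : C := (f (z + r%:C * ecirc t) - f z) / (r%:C * ecirc t).

Lemma continuous_derivable f w : derivable f w 1 -> {for w, continuous f}.
Proof. by move=> df; apply/differentiable_continuous/derivable1_diffP. Qed.

Let continuous_quot f z r : 0 < r -> (forall w, normc (w - z) <= r -> derivable f w 1) ->
  forall t : R, {for t, continuous (quot f z r)}.
Proof.
move=> r0 hf; apply: (continuous_circle_quot r0) => t.
apply: cvgB; last exact: cvg_cst.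
apply: continuous_circle => {}t; apply: continuous_derivable; apply: hf.
by rewrite [z + _]addrC addrK normc_circle.
Qed.

(* Integrating (f(w) - f(z))/(w - z)^2 around a polar rectangle centred at [z]
   shows that the mean of the difference quotients over circles does not depend on the radius. *)
Let quot_radius f z r d : 0 < d <= r -> (forall w, normc (w - z) <= r -> derivable f w 1) ->
  cint mu `[0, 2 * pi] (quot f z r) = cint mu `[0, 2 * pi] (quot f z d).
Proof.
move=> /andP[d0 dr] hf; have r0 := lt_le_trans d0 dr.
pose g (w : C) : C := (f w - f z) * ((w - z) ^+ 2)^-1.
have dg (x t : R) : d <= x <= r -> 0 <= t <= 2 * pi -> derivable g (z + x%:C * ecirc t) 1.
  move=> /andP[dx xr] _; have x0 := lt_le_trans d0 dx.
  have /derivableP df : derivable f (z + x%:C * ecirc t) 1.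
    by apply: hf; rewrite [z + _]addrC addrK normc_circle.
  have w0 : (z + x%:C * ecirc t - z) ^+ 2 != 0.
    by rewrite [z + _]addrC addrK expf_neq0// circle_neq0.
  have dw := cderivX (cderivB (cderiv_id (z + x%:C * ecirc t)) (cderiv_cst _ z)) 2.
  exact: (@ex_derive _ _ _ _ _ _ _ (cderivM (cderivB df (cderiv_cst _ (f z))) (cderivV dw w0))).
have sy x : 0 < x -> side_y z (@ecirc R) (@ecirc' R) g x 0 (2 * pi) =
    cint mu `[0, 2 * pi] (fun t => 'i%C * quot f z x t).
  move=> x0; apply: eq_cint => t _; rewrite /g /quot [z + _]addrC addrK ecirc'E.
  have := circle_neq0 t x0; move: (f _ - f z) => u; move: (ecirc t) => v.
  by rewrite mulf_eq0 negb_or => /andP[? ?]; field; apply/andP.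
have := @goursat _ z (@ecirc R) (@ecirc' R) (@rderiv_ecirc R) (@continuous_ecirc R)
  (@continuous_ecirc' R) g d r 0 (2 * pi) 1 dr pi2_ge0 _ _ dg.
have sx : side_x z (@ecirc R) g (2 * pi) d r = side_x z (@ecirc R) g 0 d r.
  by rewrite /side_x ecirc_2pi.
rewrite /bd !sy// sx; move: (side_x _ _ _ _ _ _) => A.
rewrite [A + _]addrC addrK.
have iq x : 0 < x <= r -> cintegrable mu `[0, 2 * pi] (quot f z x).
  move=> /andP[x0 xr]; apply: ccont_cintegrable => t _; apply: (continuous_quot x0) => w wx.
  by apply: hf; exact: le_trans wx xr.
have [ir id] : cintegrable mu `[0, 2 * pi] (quot f z r) /\ cintegrable mu `[0, 2 * pi] (quot f z d).
  by split; apply: iq; rewrite ?d0 ?r0 ?lexx.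
rewrite (cintZ _ _ ir)// (cintZ _ _ id)//.
move=> /(_ _ _)/eqP; rewrite subr_eq0 => H; apply: (mulfI (x := 'i%C)).
  by rewrite eq_complex /= oner_eq0 andbF.
apply/eqP; apply: H => t _; first by rewrite normc_ecirc.
by rewrite normc_ecirc'.
Qed.

(** By [quot_radius] the radius may be shrunk, and the quotients then tend to f'(z) uniformly in t.
    Subtracting f(z) makes this limit a restatement of differentiability at [z]. *)
Lemma cauchy_derivative f z r : 0 < r -> (forall w, normc (w - z) <= r -> derivable f w 1) ->
  (2 * pi)%:C * 'D_1 f z =
  cint mu `[0, 2 * pi] (fun t => (f (z + r%:C * ecirc t) - f z) / (r%:C * ecirc t)).
Proof.
move=> r0 hf; apply/eqP; rewrite -subr_eq0 -normc_eq0 eq_le normc_ge0 andbT.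
apply/ler_addgt0Pr => e e0; rewrite add0r.
have /cderP H : is_derive z 1 f ('D_1 f z).
  by apply/derivableP/hf; rewrite subrr ComplexField.Normc.normc0 ltW.
have [d d0 Hd] := H _ (divr_gt0 e0 pi2_gt0).
pose x := Num.min (d / 2) r.
have x0 : 0 < x by rewrite lt_min r0 divr_gt0.
have xr : x <= r by rewrite ge_min lexx orbT.
have xd : x < d by rewrite gt_min ltr_pdivrMr// ltr_pMr// ltr1n.
rewrite (@quot_radius _ _ _ x) ?x0//.
have cq : ccont 0 (2 * pi) (quot f z x).
  by move=> t _; apply: (continuous_quot x0) => w wx; apply: hf; exact: le_trans wx xr.
have c0 : ccont 0 (2 * pi) (fun=> 'D_1 f z : C) by move=> t _; exact: cvg_cst.
have := cint_itv_cst ('D_1 f z) pi2_ge0; rewrite subr0 => <-.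
rewrite -(cintB _ (ccont_cintegrable c0) (ccont_cintegrable cq))//.
have := @cint_itv_bound _ _ _ (fun t => 'D_1 f z - quot f z x t) (e / (2 * pi)) pi2_ge0.
rewrite subr0 divfK ?gt_eqF ?pi2_gt0//; apply.
  by move=> t tp; apply: cvgB; [exact: cvg_cst|exact: cq].
move=> t _; rewrite normc_distC.
have -> : quot f z x t - 'D_1 f z = (f (z + x%:C * ecirc t) - f z - 'D_1 f z * (x%:C * ecirc t))
    / (x%:C * ecirc t).
  by rewrite [RHS]mulrBl mulfK// circle_neq0.
rewrite normcM normcV normc_circle// ler_pdivrMr//.
by have := Hd (x%:C * ecirc t); rewrite normc_circle// => /(_ xd).
Qed.

(** Cauchy's estimate with circles of radius rho / 4, which stay in the ball; 8 M / rho is 2 M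
    divided by that radius. *)
Lemma deriv_bound f z rho M : 0 < rho -> holo_ball f z rho ->
  (forall w, normc (w - z) < rho -> normc (f w) <= M) ->
  forall w, normc (w - z) < rho / 2 -> normc ('D_1 f w) <= 8 * M / rho.
Proof.
move=> rho0 hf fM w wz; have r0 : 0 < rho / 4 by exact: divr_gt0.
have sub (u : C) : normc (u - w) <= rho / 4 -> normc (u - z) < rho.
  move=> uw; have -> : u - z = (u - w) + (w - z) by ring.
  apply: le_lt_trans (normcD _ _) _; lra.
have sub' t : normc (w + (rho / 4)%:C * ecirc t - z) < rho.
  by apply: sub; rewrite [w + _]addrC addrK normc_circle.
have := cauchy_derivative r0 (fun u uw => hf u (sub u uw)).
move=> /(congr1 (fun u => normc u)); rewrite normcM normc_real gtr0_norm ?pi2_gt0// => E.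
rewrite -(ler_pM2l pi2_gt0) E [leRHS]mulrC.
have := @cint_itv_bound _ _ _ (quot f w (rho / 4)) (8 * M / rho) pi2_ge0.
rewrite subr0; apply.
  by move=> t _; apply: (continuous_quot r0) => u uw; exact: hf (sub u uw).
move=> t _; rewrite normcM normcV normc_circle// ler_pdivrMr//.
apply: le_trans (normcB _ _) _.
rewrite (_ : 8 * M / rho * (rho / 4) = M + M); last by field; rewrite gt_eqF.
by rewrite lerD// fM//; lra.
Qed.

(** Compare Cauchy's formula at [u] and [v] on circles of the same radius: the numerators differ by
    two increments of [f], each at most M |u - v|. No second derivative is involved yet. *)
Lemma deriv_lipschitz f z rho M : 0 < rho -> holo_ball f z rho ->
  (forall w, normc (w - z) < rho -> normc ('D_1 f w) <= M) ->
  forall u v, normc (u - z) < rho / 2 -> normc (v - z) < rho / 2 ->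
    normc ('D_1 f u - 'D_1 f v) <= 8 * M / rho * normc (u - v).
Proof.
move=> rho0 hf fM u v uz vz; have r0 : 0 < rho / 4 by exact: divr_gt0.
have sub (w t : C) : normc (w - z) < rho / 2 -> normc (t - w) <= rho / 4 -> normc (t - z) < rho.
  move=> wz tw; have -> : t - z = (t - w) + (w - z) by ring.
  apply: le_lt_trans (normcD _ _) _; lra.
have sub' (w : C) t : normc (w - z) < rho / 2 -> normc (w + (rho / 4)%:C * ecirc t - z) < rho.
  by move=> wz; apply: sub wz _; rewrite [w + _]addrC addrK normc_circle.
have Eu := cauchy_derivative r0 (fun w wu => hf w (sub u w uz wu)).
have Ev := cauchy_derivative r0 (fun w wu => hf w (sub v w vz wu)).
have cu : ccont 0 (2 * pi) (quot f u (rho / 4)).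
  by move=> t _; apply: (continuous_quot r0) => w wu; exact: hf (sub u w uz wu).
have cv : ccont 0 (2 * pi) (quot f v (rho / 4)).
  by move=> t _; apply: (continuous_quot r0) => w wu; exact: hf (sub v w vz wu).
have : (2 * pi)%:C * ('D_1 f u - 'D_1 f v) =
    cint mu `[0, 2 * pi] (fun t => quot f u (rho / 4) t - quot f v (rho / 4) t).
  rewrite (cintB _ (ccont_cintegrable cu) (ccont_cintegrable cv))//.
  by rewrite mulrBr; congr (_ - _); [exact: Eu|exact: Ev].
move=> /(congr1 (fun u => normc u)); rewrite normcM normc_real gtr0_norm ?pi2_gt0// => E.
rewrite -(ler_pM2l pi2_gt0) E [leRHS]mulrC.
have := @cint_itv_bound _ _ _ (fun t => quot f u (rho / 4) t - quot f v (rho / 4) t)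
   (8 * M / rho * normc (u - v)) pi2_ge0.
rewrite subr0; apply.
  by move=> t tp; apply: cvgB; [exact: cu|exact: cv].
have lip := lipschitz_ball hf fM.
move=> t _; rewrite /quot -mulrBl normcM normcV normc_circle// ler_pdivrMr//.
set c := (rho / 4)%:C * ecirc t.
have -> : f (u + c) - f u - (f (v + c) - f v) = (f (u + c) - f (v + c)) - (f u - f v) by ring.
apply: le_trans (normcB _ _) _.
rewrite (_ : 8 * M / rho * normc (u - v) * (rho / 4) = M * normc (u - v) + M * normc (u - v));
  last by field; rewrite gt_eqF.
apply: lerD; last by apply: lip; lra.
rewrite (_ : u - v = u + c - (v + c)); last by ring.
by apply: lip; exact: sub'.
Qed.

(** The derivative at z and at z + h is written by Cauchy's formula; the increment then becomes a
    mean of second differences of [f], which Taylor's estimate controls at order |h|^2. With this,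
    Goursat's theorem applies to g = f'. *)
Lemma derivable_derive f z rho : 0 < rho -> holo_ball f z rho -> derivable ('D_1 f : C -> C) z 1.
Proof.
move=> rho0 hf.
have cf : {for z, continuous f}.
  by apply/continuous_derivable/hf; rewrite subrr ComplexField.Normc.normc0.
(* Differentiability at [z] bounds |f(w) - f(z)| by (|f'(z)| + 1) |w - z|, hence by 1 on a ball of
   radius at most 1 / (|f'(z)| + 1). *)
have [s s0 [srho sf]] : exists2 s, 0 < s & s <= rho /\
    forall w, normc (w - z) < s -> normc (f w) <= normc (f z) + 1.
  have /cderP/(_ 1 ltr01)[d d0 Hd] : is_derive z 1 f ('D_1 f z).
    by apply/derivableP/hf; rewrite subrr ComplexField.Normc.normc0.
  have N1 : 0 < normc ('D_1 f z) + 1 by rewrite ltr_wpDl// normc_ge0.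
  exists (Num.min (Num.min d rho) (normc ('D_1 f z) + 1)^-1).
    by rewrite !lt_min d0 rho0 invr_gt0.
  split=> [|w]; first by rewrite !ge_min lexx orbT.
  rewrite !lt_min => /andP[/andP[wd _]].
  rewrite -div1r ltr_pdivlMr// => wN.
  have := Hd _ wd; rewrite [z + _]addrC subrK mul1r => H.
  have -> : f w = f z + ((f w - f z - 'D_1 f z * (w - z)) + 'D_1 f z * (w - z)) by ring.
  apply: le_trans (normcD _ _) _; rewrite lerD2l.
  apply: le_trans (normcD _ _) _; rewrite normcM.
  apply: le_trans (lerD H (lexx _)) _; apply: ltW; apply: le_lt_trans wN.
  by rewrite mulrDr mulr1 addrC mulrC.
have hs : holo_ball f z s by move=> w ws; apply: hf; exact: lt_le_trans ws srho.
have s2 : 0 < s / 2 by exact: divr_gt0.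
have hs2 : holo_ball f z (s / 2) by move=> w ws; apply: hs; lra.
have hs4 : holo_ball f z (s / 2 / 2) by move=> w ws; apply: hs; lra.
(* [deriv_bound] bounds f' on the half ball and [deriv_lipschitz] makes it [L]-Lipschitz on the
   quarter ball. *)
set L := 8 * (8 * (normc (f z) + 1) / s) / (s / 2).
have lip := deriv_lipschitz s2 hs2 (deriv_bound s0 hs sf).
have L0 : 0 <= L by rewrite !mulr_ge0 ?addr_ge0 ?normc_ge0 ?invr_ge0 ?ltW.
have tay := taylor1_ball hs4 lip L0.
set sg := s / 2 / 2 in hs4 lip tay.
have sg0 : 0 < sg by exact: divr_gt0.
have sgs : sg <= s by rewrite /sg; lra.
pose r := sg / 4; have r0 : 0 < r by exact: divr_gt0.
have rsg : 2 * r < sg by rewrite /r; lra.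
have cf' w : normc (w - z) < sg -> {for w, continuous ('D_1 f : C -> C)}.
  move=> wz; apply/(@ccvgP _ _ _ (nbhs_filter w)) => e e0.
  near=> v.
  have vw : normc (v - w) < Num.min (e / (L + 1)) (sg - normc (w - z)).
    near: v; apply: near_normc; rewrite lt_min subr_gt0 wz andbT.
    by rewrite divr_gt0// ltr_wpDl.
  move: vw; rewrite lt_min => /andP[vw1 vw2].
  apply: le_lt_trans (lip _ _ _ wz) _.
    rewrite (_ : v - z = (v - w) + (w - z)); last by ring.
    by apply: le_lt_trans (normcD _ _) _; rewrite -ltrBrDr.
  apply: (@le_lt_trans _ _ ((L + 1) * normc (v - w))).
    by rewrite ler_wpM2r ?normc_ge0// lerDl.
  by rewrite mulrC -ltr_pdivlMr// ltr_wpDl.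
(* The mean of [q] over the circle is the candidate for f''(z). *)
pose q t : C := ('D_1 f (z + r%:C * ecirc t) - 'D_1 f z) / (r%:C * ecirc t).
have zt t : normc (z + r%:C * ecirc t - z) = r by rewrite [z + _]addrC addrK normc_circle.
have cq (t : R) : {for t, continuous q}.
  apply: (continuous_circle_quot r0) => {}t; apply: cvgB; last exact: cvg_cst.
  by apply: (@continuous_circle ('D_1 f)) => {}t; apply: cf'; rewrite zt /r; lra.
have p0 : (2 * pi)%:C != 0 :> C by rewrite eq_complex /= eqxx andbT gt_eqF ?pi2_gt0.
suff : is_derive z 1 ('D_1 f : C -> C) (((2 * pi)%:C)^-1 * cint mu `[0, 2 * pi] q).
  by move=> h; exact: ex_derive.
(* The error will be 4 L |h|^2 / r, which is at most e |h| under this choice. *)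
apply/cderP => e e0; exists (Num.min r (e * r / (4 * L + 1))).
  by rewrite lt_min r0/= divr_gt0 ?mulr_gt0// ltr_wpDl// mulr_ge0.
move=> h; rewrite lt_min => /andP[hr he].
have hfr (u w : C) : normc (u - z) <= r -> normc (w - u) <= r -> normc (w - z) < sg.
  move=> uz wu; rewrite (_ : w - z = (w - u) + (u - z)); last by ring.
  by apply: le_lt_trans (normcD _ _) _; lra.
have zh : normc (z + h - z) <= r by rewrite [z + h]addrC addrK ltW.
have zz : normc (z - z) <= r by rewrite subrr ComplexField.Normc.normc0 ltW.
have Eh := cauchy_derivative r0 (fun w wu => hs4 w (hfr (z + h) w zh wu)).
have Ez := cauchy_derivative r0 (fun w wu => hs4 w (hfr z w zz wu)).
have ch : ccont 0 (2 * pi) (quot f (z + h) r).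
  by move=> t _; apply: (continuous_quot r0) => w wu; exact: hs4 (hfr _ w zh wu).
have cz : ccont 0 (2 * pi) (quot f z r).
  by move=> t _; apply: (continuous_quot r0) => w wu; exact: hs4 (hfr _ w zz wu).
have cq' : ccont 0 (2 * pi) q by move=> t _; exact: cq.
have chz : ccont 0 (2 * pi) (fun t => quot f (z + h) r t - quot f z r t).
  by move=> t tp; apply: cvgB; [exact: ch|exact: cz].
have chq : ccont 0 (2 * pi) (fun t => h * q t).
  by move=> t tp; apply: cvgM; [exact: cvg_cst|exact: cq].
have E : (2 * pi)%:C * ('D_1 f (z + h) - 'D_1 f z - (2 * pi)%:C^-1 * cint mu `[0, 2 * pi] q * h) =
    cint mu `[0, 2 * pi] (fun t => quot f (z + h) r t - quot f z r t - h * q t).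
  rewrite (cintB _ (ccont_cintegrable chz) (ccont_cintegrable chq))//.
  rewrite (cintB _ (ccont_cintegrable ch) (ccont_cintegrable cz))//.
  rewrite (cintZ _ _ (ccont_cintegrable cq'))//.
  rewrite !mulrBr; congr (_ - _); last by rewrite -mulrA mulVKf// mulrC.
  by congr (_ - _); [exact: Eh|exact: Ez].
move: E => /(congr1 (fun u => normc u)); rewrite normcM normc_real gtr0_norm ?pi2_gt0// => E.
rewrite -(ler_pM2l pi2_gt0) E [leRHS]mulrC.
have := @cint_itv_bound _ _ _ (fun t => quot f (z + h) r t - quot f z r t - h * q t)
   (e * normc h) pi2_ge0.
rewrite subr0; apply.
  by move=> t tp; apply: cvgB; [exact: chz|exact: chq].
move=> t _; rewrite /quot /q.
have cn := circle_neq0 t r0; have := normc_circle t r0; have := zt t.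
move: (r%:C * ecirc t) cn => c cn ztc cr.
(* The second difference of [f] with steps h and c is symmetric: read with step h, it is a
   difference of two first-order Taylor remainders, at z + c and at z. *)
have -> : (f (z + h + c) - f (z + h)) / c - (f (z + c) - f z) / c - h * (('D_1 f (z + c) - 'D_1 f z) / c)
   = ((f (z + c + h) - f (z + c) - 'D_1 f (z + c) * h) - (f (z + h) - f z - 'D_1 f z * h)) / c.
  rewrite (_ : z + c + h = z + h + c); last by ring.
  move: (f (z + h + c)) (f (z + h)) (f (z + c)) (f z) ('D_1 f (z + c)) ('D_1 f z) => y1 y2 y3 y4 y5 y6.
  by field.
rewrite normcM normcV cr ler_pdivrMr//; apply: le_trans (normcB _ _) _.
have b1 : normc (f (z + c + h) - f (z + c) - 'D_1 f (z + c) * h) <= 2 * L * normc h * normc h.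
  by apply: tay; rewrite /= ?ztc /r; rewrite /r in hr; lra.
have b2 : normc (f (z + h) - f z - 'D_1 f z * h) <= 2 * L * normc h * normc h.
  by apply: tay; rewrite ?subrr ?ComplexField.Normc.normc0; rewrite /r in hr; lra.
apply: le_trans (lerD b1 b2) _.
rewrite ltr_pdivlMr in he; last by rewrite ltr_wpDl// mulr_ge0.
rewrite (_ : _ + _ = 4 * L * normc h * normc h); last by ring.
rewrite -[leRHS]mulrAC ler_wpM2r ?normc_ge0//; apply: le_trans (ltW he).
by rewrite mulrC ler_wpM2l ?normc_ge0// lerDl.
Unshelve. all: by end_near. Qed.

End CauchyDerivative.

(** * The seminorm along half-lines *)

Section HalfPlaneMeasurability.
Variable R : realType.
Local Notation C := (R[i])^o.
Local Notation mu := (@lebesgue_measure R).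
Implicit Types (g h : C -> C) (z : C).

(** The sigma-algebra on [R * R] is the product one; an open set belongs to it as a countable union
    of boxes with rational corners. *)
Lemma measurable_box_open (O : set (R * R)) :
  (forall p, O p -> exists2 e : R, 0 < e & forall q, `|q.1 - p.1| < e -> `|q.2 - p.2| < e -> O q) ->
  measurable O.
Proof.
move=> opO.
pose box (c : (rat * rat) * (rat * rat)) : set (R * R) :=
  [set` `]ratr c.1.1, ratr c.1.2[%R] `*` [set` `]ratr c.2.1, ratr c.2.2[%R].
have -> : O = \bigcup_c (if `[< box c `<=` O >] then box c else set0).
  apply/seteqP; split=> [p Op|p [c _]]; last by case: asboolP => // cO /cO.
  have [e e0 He] := opO _ Op.
  have lo (x : R) : exists q : rat, ratr q \in `]x - e, x[%R by apply: rat_in_itvoo; lra.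
  have hi (x : R) : exists q : rat, ratr q \in `]x, x + e[%R by apply: rat_in_itvoo; lra.
  have [[a /[!in_itv]/= /andP[a1 a2]] [b /[!in_itv]/= /andP[b1 b2]]] := (lo p.1, hi p.1).
  have [[c /[!in_itv]/= /andP[c1 c2]] [d /[!in_itv]/= /andP[d1 d2]]] := (lo p.2, hi p.2).
  exists ((a, b), (c, d)) => //; case: asboolP => [_|[]].
    by split; rewrite /= in_itv/=; apply/andP.
  by move=> q [] /=; rewrite !in_itv/= => /andP[? ?] /andP[? ?]; apply: He; rewrite ltr_norml; apply/andP; split; lra.
apply: countable_bigcupT_measurable => [|c]; first exact: countableP.
by case: asboolP => // _; apply: measurableX; exact: measurable_itv.
Qed.

Lemma measurable_box_continuous (D : set (R * R)) (u : R * R -> R) :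
  (forall p, D p -> exists2 e : R, 0 < e & forall q, `|q.1 - p.1| < e -> `|q.2 - p.2| < e -> D q) ->
  (forall p (e : R), D p -> 0 < e -> exists2 d : R, 0 < d &
    forall q, `|q.1 - p.1| < d -> `|q.2 - p.2| < d -> `|u q - u p| < e) ->
  measurable_fun D u.
Proof.
move=> oD cu; apply: (measurability _ (RGenOInfty.measurableE R)).
move=> _ [_ [x ->] <-]; apply: measurable_box_open => p [Dp].
rewrite /= in_itv/= andbT => xp.
have [e e0 He] := oD _ Dp.
have up : 0 < u p - x by rewrite subr_gt0.
have [d d0 Hd] := cu _ _ Dp up.
exists (Num.min e d) => [|q]; first by rewrite lt_min e0.
rewrite !lt_min => /andP[q1 q2] /andP[q3 q4]; split; first exact: He.
rewrite /= in_itv/= andbT; have := Hd _ q2 q4; rewrite ltr_norml => /andP[h _]; lra.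
Qed.

Lemma continuous_normcP g z : {for z, continuous g} <->
  forall e, 0 < e -> exists2 d : R, 0 < d & forall w, normc (w - z) < d -> normc (g w - g z) < e.
Proof.
split=> [cg e e0|H].
  have := (@ccvgP _ _ _ (nbhs_filter z) g (g z)).1 cg e e0.
  move=> /nbhs_ballP[d' /=]; rewrite ltcE /= => /andP[/eqP d'i d'0] Hd.
  exists (Re d') => // w wd; apply: Hd; rewrite -ball_normE/= norm_normc normc_distC.
  by move: wd; case: d' d'i d'0 => a b /= -> _; rewrite ltcR.
apply/(@ccvgP _ _ _ (nbhs_filter z)) => e /H[d d0 Hd].
near=> w; apply: Hd; near: w; exact: near_normc.
Unshelve. all: by end_near. Qed.

(** Outside the half-plane nothing is known about g; extension by 0 lets Tonelli's theorem be
    applied on all of [R * R]. *)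
Definition hpatch g (p : R * R) : C := if 0 < p.1 then g (p.1 +i* p.2) else 0.
Definition hmeas g := cmeasurable setT (hpatch g).

Lemma continuous_hmeas g : (forall z, 0 < Re z -> {for z, continuous g}) -> hmeas g.
Proof.
move=> cg; pose D := [set p : R * R | 0 < p.1].
have oD p : D p -> exists2 e : R, 0 < e & forall q, `|q.1 - p.1| < e -> `|q.2 - p.2| < e -> D q.
  move=> Dp; exists p.1 => // q; rewrite ltr_norml => /andP[h _] _; rewrite /D/=.
  by move: h; rewrite ltrBrDr addNr.
have mD : measurable D by exact: measurable_box_open oD.
have cont (P : C -> R) : (forall z w, `|P z - P w| <= normc (z - w)) ->
    measurable_fun D (fun p => P (g (p.1 +i* p.2))).
  move=> HP; apply: (measurable_box_continuous oD) => p e Dp e0.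
  have [d d0 Hd] := (continuous_normcP g (p.1 +i* p.2)).1 (cg (p.1 +i* p.2) Dp) e e0.
  exists (d / 2) => [|q q1 q2]; first exact: divr_gt0.
  apply: le_lt_trans (HP _ _) _; apply: Hd.
  apply: le_lt_trans (normc_le_ReIm _) _; rewrite /=; lra.
have HRe (z w : C) : `|Re z - Re w| <= normc (z - w) by rewrite -complex_ReB abs_Re_le.
have HIm (z w : C) : `|Im z - Im w| <= normc (z - w) by rewrite -complex_ImB abs_Im_le.
split.
  rewrite (_ : (fun _ => _) = (fun p => Re (g (p.1 +i* p.2))) \_ D).
    by apply: (measurable_restrictT _ mD).1 (cont _ HRe).
  apply/funext => p; rewrite /hpatch patchE; case: ifPn => p0; first by rewrite mem_set.
  by rewrite memNset//; exact/negP.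
rewrite (_ : (fun _ => _) = (fun p => Im (g (p.1 +i* p.2))) \_ D).
  by apply: (measurable_restrictT _ mD).1 (cont _ HIm).
apply/funext => p; rewrite /hpatch patchE; case: ifPn => p0; first by rewrite mem_set.
  by rewrite memNset//; exact/negP.
Qed.

Lemma cmeasurableD d (T : measurableType d) (F G : T -> C) : cmeasurable setT F ->
  cmeasurable setT G -> cmeasurable setT (fun t => F t + G t).
Proof.
move=> [Fr Fi] [Gr Gi]; split; under eq_fun do rewrite raddfD/=; exact: measurable_funD.
Qed.

Lemma cmeasurableM d (T : measurableType d) (F G : T -> C) : cmeasurable setT F ->
  cmeasurable setT G -> cmeasurable setT (fun t => F t * G t).
Proof.
move=> [Fr Fi] [Gr Gi]; split.
  under eq_fun do rewrite complex_ReM/=.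
  by apply: measurable_funB; exact: measurable_funM.
under eq_fun do rewrite complex_ImM/=.
by apply: measurable_funD; exact: measurable_funM.
Qed.

Lemma cmeasurable_cst d (T : measurableType d) (k : C) : cmeasurable setT (fun t : T => k).
Proof. by split; exact: measurable_cst. Qed.

Lemma hmeas_ext g h : (forall z, 0 < Re z -> g z = h z) -> hmeas h -> hmeas g.
Proof.
move=> gh; rewrite /hmeas (_ : hpatch g = hpatch h)//.
by apply/funext => p; rewrite /hpatch; case: ifPn => // p1; rewrite gh.
Qed.

Lemma hmeasD g h : hmeas g -> hmeas h -> hmeas (fun z => g z + h z).
Proof.
move=> mg mh; have := cmeasurableD mg mh; rewrite /hmeas; congr cmeasurable.
by apply/funext => p; rewrite /hpatch; case: ifP; rewrite ?addr0.
Qed.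

Lemma hmeasZ (k : C) g : hmeas g -> hmeas (fun z => k * g z).
Proof.
move=> mg; have := cmeasurableM (cmeasurable_cst _ k) mg; rewrite /hmeas; congr cmeasurable.
by apply/funext => p; rewrite /hpatch; case: ifP; rewrite ?mulr0.
Qed.

Lemma hmeasB g h : hmeas g -> hmeas h -> hmeas (fun z => g z - h z).
Proof.
move=> mg mh; have := hmeasD mg (hmeasZ (-1) mh); apply: hmeas_ext => z _.
by rewrite mulN1r.
Qed.

Lemma hmeas_lim (g_ : nat -> C -> C) g : (forall n, hmeas (g_ n)) ->
  (forall z, 0 < Re z -> (fun n => g_ n z) @ \oo --> g z) -> hmeas g.
Proof.
move=> mg cg; split.
  apply: (measurable_fun_cvg (h := fun n p => Re (hpatch (g_ n) p))) => [n|p _]; first exact: (mg n).1.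
  rewrite /hpatch; case: ifPn => p0; last exact: cvg_cst.
  by apply: (continuous_cvg _ (@continuous_Re R _)); exact: cg.
apply: (measurable_fun_cvg (h := fun n p => Im (hpatch (g_ n) p))) => [n|p _]; first exact: (mg n).2.
rewrite /hpatch; case: ifPn => p0; last exact: cvg_cst.
by apply: (continuous_cvg _ (@continuous_Im R _)); exact: cg.
Qed.

(* [ray g (a, t)] is |g| at the point of abscissa [a] on the half-line of slope [t]. *)
Definition ray g (p : R * R) : R := normc (hpatch g (p.1, p.1 * p.2)).

Lemma ray_ge0 g p : 0 <= ray g p.
Proof. exact: normc_ge0. Qed.

Lemma cmeasurable_comp d d' (T : measurableType d) (T' : measurableType d') (F : T -> C) (u : T' -> T) :
  cmeasurable setT F -> measurable_fun setT u -> cmeasurable setT (fun t => F (u t)).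
Proof.
move=> [Fr Fi] mu'; split.
  exact: (measurableT_comp Fr mu').
exact: (measurableT_comp Fi mu').
Qed.

Lemma measurable_slope : measurable_fun setT (fun p : R * R => (p.1, p.1 * p.2)).
Proof.
apply: measurable_fun_pair; first exact: measurable_fst.
by apply: measurable_funM; [exact: measurable_fst|exact: measurable_snd].
Qed.

Lemma measurable_ray g : hmeas g -> measurable_fun setT (ray g).
Proof. by move=> mg; apply: cmeasurable_normc; apply: (cmeasurable_comp mg); exact: measurable_slope. Qed.

End HalfPlaneMeasurability.

(** * Two improper integrals *)

Section ImproperIntegrals.
Variable R : realType.
Local Notation mu := (@lebesgue_measure R).
Implicit Types (a b c t x q : R).

Lemma cvg_affine_pinfty c x : 0 < c -> (fun a => x + a * c) a @[a --> +oo] --> +oo.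
Proof.
move=> c0; apply/cvgryPge => M; near=> a.
rewrite -lerBlDl -ler_pdivrMr//; near: a; exact: nbhs_pinfty_ge.
Unshelve. all: by end_near. Qed.

(** The value is independent of [x], by dilation invariance; this makes the tail estimates uniform
    in the position of the source point. *)
Lemma integral_inv_sqr x c : 0 < x -> 0 < c ->
  (\int[mu]_(a in `]0%R, +oo[) (x / (x + a * c) ^+ 2)%:E = (c^-1)%:E)%E.
Proof.
move=> x0 c0; pose F a := - (x / c) * (x + a * c)^-1.
have d0 a : 0 <= a -> 0 < x + a * c by move=> a0; rewrite ltr_pwDl// mulr_ge0// ltW.
have dF a : 0 <= a -> is_derive a (1 : R) F (x / (x + a * c) ^+ 2).
  move=> a0; have ne0 : x + a * c != 0 by rewrite gt_eqF ?d0.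
  have dd : is_derive a (1 : R) (fun a => x + a * c) c.
    by apply: is_derive_eq; rewrite add0r mul1r scaler0 add0r [_ *: _]mulr1.
  have di : is_derive a (1 : R) (fun a => (x + a * c)^-1) (- (x + a * c) ^- 2 *: c).
    by apply: DeriveDef; [exact: derivableV|rewrite deriveV// derive_val].
  apply: is_derive_eq; rewrite /GRing.scale/=.
  by field; rewrite ne0 gt_eqF.
have cf a : 0 <= a -> {for a, continuous (fun a : R => x / (x + a * c) ^+ 2)}.
  move=> a0; apply: cvgM; first exact: cvg_cst.
  apply: cvgV; first by rewrite expf_neq0// gt_eqF// d0.
  apply: (@continuous_comp _ _ _ (fun a : R => x + a * c) (fun u => u ^+ 2)); last exact: exprn_continuous.
  by apply: cvgD; [exact: cvg_cst|apply: cvgM; [exact: cvg_id|exact: cvg_cst]].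
have cw : {within `[0, +oo[, continuous (fun a : R => x / (x + a * c) ^+ 2)}.
  by apply: continuous_in_subspaceT => a; rewrite inE/= in_itv/= andbT => /cf.
rewrite integral_itv_obnd_cbnd; last first.
  apply/measurable_EFinP; apply: open_continuous_measurable_fun; first exact: interval_open.
  by move=> a; rewrite inE/= in_itv/= andbT => /ltW/cf.
rewrite (@ge0_continuous_FTC2y _ _ F 0 0); last 6 first.
- by move=> a a0; rewrite divr_ge0 ?exprn_ge0 ?ltW ?d0.
- exact: cw.
- rewrite /F -[0 in X in _ --> X](mulr0 (- (x / c))); apply: cvgM; first exact: cvg_cst.
  apply/gtr0_cvgV0; last exact: cvg_affine_pinfty.
  by near=> a; apply: d0; near: a; exact: nbhs_pinfty_ge.
- by move=> a /ltW/dF da; exact: ex_derive.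
- apply: cvg_at_right_filter; apply/differentiable_continuous/derivable1_diffP.
  by have da := dF 0 (lexx _); exact: ex_derive.
- by move=> a; rewrite in_itv/= andbT => /ltW/dF da; rewrite derive1E derive_val.
by rewrite /F mul0r addr0 sub0e -EFinN mulNr opprK mulrAC divff ?gt_eqF// mul1r.
Unshelve. all: by end_near. Qed.

Lemma powR_cvg_pinfty q : 0 < q -> (1 + t) `^ (- q) @[t --> +oo] --> 0.
Proof.
move=> q0; apply/cvgrPdist_lt => e e0; near=> t.
have t0 : 0 < 1 + t by near: t; apply: filterS (nbhs_pinfty_gt (num_real 0)) => t t0; rewrite ltr_wpDl.
rewrite sub0r normrN ger0_norm ?powR_ge0//.
have -> : e = (e `^ (- q^-1)) `^ (- q) by rewrite -powRrM mulrNN mulVf ?gt_eqF// powRr1// ltW.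
rewrite (powRN (1 + t)) (powRN (e `^ _)) ltf_pV2 ?posrE ?powR_gt0//.
apply: gt0_ltr_powR => //; rewrite ?nnegrE ?powR_ge0 ?(ltW t0)//.
near: t; apply: filterS (nbhs_pinfty_gt (num_real (e `^ (- q^-1)))) => t te.
by apply: lt_trans te _; rewrite ltrDr.
Unshelve. all: by end_near. Qed.

(** On the positive half-line (1 + t)^2 <= 2 (1 + t^2) gives the majorant 2^q (1 + t)^(-2q), which
    has an explicit primitive and is integrable since 2q > 1. *)
Lemma integral_slope_weight q : 2^-1 < q ->
  (\int[mu]_t ((1 + t ^+ 2) `^ (- q))%:E < +oo)%E.
Proof.
move=> q2.
have q0 : 0 < q by apply: lt_trans q2; rewrite invr_gt0.
have p0 t : 0 < 1 + t ^+ 2 by rewrite ltr_pwDl// sqr_ge0.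
have cw t : {for t, continuous (fun t : R => (1 + t ^+ 2) `^ (- q))}.
  apply: (@continuous_comp _ _ _ (fun t : R => 1 + t ^+ 2) (fun u => u `^ (- q))).
    by apply: cvgD; [exact: cvg_cst|exact: exprn_continuous].
  apply/differentiable_continuous/derivable1_diffP.
  by have := is_derive1_powR (- q) (p0 t) => h; exact: ex_derive.
rewrite ge0_symfun_integralT; [|by move=> t; exact: powR_ge0|exact: cw|by move=> t; rewrite /= sqrrN].
rewrite -set_itvcy.
pose r := 2 * q - 1; have r0 : 0 < r.
  by rewrite subr_gt0 -ltr_pdivrMl// mulr1.
pose G t := 2 `^ q * (1 + t) `^ (- (2 * q)).
pose F t := - (2 `^ q / r) * (1 + t) `^ (- r).
have t1 t : 0 <= t -> 0 < 1 + t by move=> t0; rewrite ltr_pwDl.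
have dF t : 0 <= t -> is_derive t (1 : R) F (G t).
  move=> t0; have h := is_derive1_powR (- r) (t1 t t0).
  have dd : is_derive t (1 : R) (fun t => 1 + t) 1 by apply: is_derive_eq; rewrite add0r mulr1.
  have dc : is_derive t (1 : R) (fun t => (1 + t) `^ (- r)) (- r * (1 + t) `^ (- r - 1) * 1).
    by have := is_derive1_comp (f := fun u => u `^ (- r)) (g := fun t => 1 + t) h dd.
  apply: is_derive_eq; rewrite /GRing.scale/= /G.
  have -> : - r - 1 = - (2 * q) by rewrite /r; ring.
  by move: (2 `^ q) (_ `^ _) => u v; field; rewrite gt_eqF.
have cG t : 0 <= t -> {for t, continuous G}.
  move=> t0; apply: cvgM; first exact: cvg_cst.
  apply: (@continuous_comp _ _ _ (fun t : R => 1 + t) (fun u => u `^ (- (2 * q)))).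
    by apply: cvgD; [exact: cvg_cst|exact: cvg_id].
  apply/differentiable_continuous/derivable1_diffP.
  by have := is_derive1_powR (- (2 * q)) (t1 t t0) => h; exact: ex_derive.
have G0 t : 0 <= G t by rewrite mulr_ge0// powR_ge0.
rewrite lte_mul_pinfty//.
have cwG : {within `[0, +oo[, continuous G}.
  by apply: continuous_in_subspaceT => t; rewrite inE/= in_itv/= andbT => /cG.
have mG : measurable_fun (`[0, +oo[%classic : set R) G.
  exact: subspace_continuous_measurable_fun cwG.
apply: (@le_lt_trans _ _ (\int[mu]_(t in `[0%R, +oo[) (G t)%:E)%E).
  apply: ge0_le_integral => //.
  - by move=> t _; rewrite lee_fin powR_ge0.
  - by apply/measurable_EFinP; apply: measurable_funTS; apply: continuous_measurable_fun; exact: cw.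
  - exact/measurable_EFinP.
  - move=> t; rewrite /= in_itv/= andbT => t0; rewrite lee_fin /G !powRN.
    have -> : (1 + t) `^ (2 * q) = ((1 + t) ^+ 2) `^ q.
      by rewrite powRrM (@powR_mulrn _ _ 2) ?(ltW (t1 _ t0)).
    have B0 : 0 < ((1 + t) ^+ 2) `^ q by rewrite powR_gt0// exprn_gt0// t1.
    have A0 : 0 < (1 + t ^+ 2) `^ q by rewrite powR_gt0// p0.
    rewrite ler_pdivlMr// mulrC ler_pdivrMr// -powRM ?(ltW (p0 _))//.
    apply: ge0_ler_powR; rewrite ?nnegrE ?exprn_ge0 ?mulr_ge0 ?(ltW (p0 _)) ?(ltW (t1 _ t0)) ?(ltW q0)//.
    by have := sqr_ge0 (1 - t); nra.
rewrite (@ge0_continuous_FTC2y _ _ F 0 0); last 6 first.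
- by move=> t _; exact: G0.
- exact: cwG.
- rewrite /F -[0 in X in _ --> X](mulr0 (- (2 `^ q / r))); apply: cvgM; first exact: cvg_cst.
  exact: powR_cvg_pinfty.
- by move=> a /ltW/dF da; exact: ex_derive.
- apply: cvg_at_right_filter; apply/differentiable_continuous/derivable1_diffP.
  by have da := dF 0 (lexx _); exact: ex_derive.
- by move=> a; rewrite in_itv/= andbT => /ltW/dF da; rewrite derive1E derive_val.
by rewrite -EFinB ltry.
Qed.

End ImproperIntegrals.

(** * The weighted norm over half-lines and its majorant *)

Section RayNorm.
Variable R : realType.
Local Notation C := (R[i])^o.
Local Notation mu := (@lebesgue_measure R).
Variable s : R.
Implicit Types (g h : C -> C) (z : C) (t a b c : R).

Definition slope_weight t : R := (1 + t ^+ 2) `^ (- ((s + 1) / 2)).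

Definition ray_int g t : \bar R := (\int[mu]_a (ray g (a, t))%:E)%E.

Definition ray_norm g : \bar R := (\int[mu]_t ((slope_weight t)%:E * ray_int g t))%E.

Lemma slope_weight_ge0 t : 0 <= slope_weight t.
Proof. exact: powR_ge0. Qed.

Lemma measurable_slope_weight : measurable_fun setT slope_weight.
Proof.
apply: (measurableT_comp (f := fun u => u `^ (- ((s + 1) / 2)))); first exact: measurable_powR.
by apply: measurable_funD; [exact: measurable_cst|apply: measurable_funX; exact: measurable_id].
Qed.

Lemma measurable_EFin_ray g : hmeas g -> measurable_fun setT (fun p => (ray g p)%:E).
Proof. by move=> mg; apply/measurable_EFinP; exact: measurable_ray. Qed.

Lemma measurable_ray_slice g t : hmeas g -> measurable_fun setT (fun a => (ray g (a, t))%:E).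
Proof. by move=> /measurable_EFin_ray; exact: measurable_fun_pair1. Qed.

Lemma measurable_ray_int g : hmeas g -> measurable_fun setT (ray_int g).
Proof.
move=> mg; have := @measurable_fun_fubini_tonelli_G _ _ _ _ _ mu _ (measurable_EFin_ray mg).
by apply => p; rewrite lee_fin ray_ge0.
Qed.

Lemma ray_int_ge0 g t : (0 <= ray_int g t)%E.
Proof. by apply: integral_ge0 => a _; rewrite lee_fin ray_ge0. Qed.

Lemma weighted_ge0 g t : (0 <= (slope_weight t)%:E * ray_int g t)%E.
Proof. by rewrite mule_ge0 ?ray_int_ge0// lee_fin slope_weight_ge0. Qed.

Lemma measurable_weighted g : hmeas g ->
  measurable_fun setT (fun t => ((slope_weight t)%:E * ray_int g t)%E).
Proof.
move=> mg; apply: emeasurable_funM; last exact: measurable_ray_int.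
by apply/measurable_EFinP; exact: measurable_slope_weight.
Qed.

Lemma ray_norm_ge0 g : (0 <= ray_norm g)%E.
Proof. by apply: integral_ge0 => t _; exact: weighted_ge0. Qed.

Lemma rayE g a t : ray g (a, t) = if 0 < a then normc (g (a +i* (a * t))) else 0.
Proof. by rewrite /ray /hpatch/=; case: ifP; rewrite ?ComplexField.Normc.normc0. Qed.

Lemma ray_int_le g h t : hmeas g -> hmeas h ->
  (forall a, 0 < a -> normc (g (a +i* (a * t))) <= normc (h (a +i* (a * t)))) ->
  (ray_int g t <= ray_int h t)%E.
Proof.
move=> mg mh gh; apply: ge0_le_integral => //.
- by move=> a _; rewrite lee_fin ray_ge0.
- exact: measurable_ray_slice.
- exact: measurable_ray_slice.
- by move=> a _; rewrite lee_fin !rayE; case: ifP => // /gh.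
Qed.

Lemma ray_norm_le g h : hmeas g -> hmeas h ->
  (forall z, 0 < Re z -> normc (g z) <= normc (h z)) -> (ray_norm g <= ray_norm h)%E.
Proof.
move=> mg mh gh; apply: ge0_le_integral => //.
- by move=> t _; exact: weighted_ge0.
- exact: measurable_weighted.
- exact: measurable_weighted.
- move=> t _; rewrite lee_wpmul2l ?lee_fin ?slope_weight_ge0//.
  by apply: ray_int_le => // a a0; exact: gh.
Qed.

Lemma ray_intD g h t : hmeas g -> hmeas h ->
  (ray_int (fun z => (g z + h z)%R) t <= ray_int g t + ray_int h t)%E.
Proof.
move=> mg mh; rewrite -ge0_integralD//.
- apply: ge0_le_integral => //.
  + by move=> a _; rewrite lee_fin ray_ge0.
  + by apply: measurable_ray_slice; exact: hmeasD.
  + by apply: emeasurable_funD; exact: measurable_ray_slice.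
  + move=> a _; rewrite -EFinD lee_fin !rayE; case: ifP => _; last by rewrite addr0.
    exact: normcD.
- by move=> a _; rewrite lee_fin ray_ge0.
- exact: measurable_ray_slice.
- by move=> a _; rewrite lee_fin ray_ge0.
- exact: measurable_ray_slice.
Qed.

Lemma ray_normD g h : hmeas g -> hmeas h ->
  (ray_norm (fun z => (g z + h z)%R) <= ray_norm g + ray_norm h)%E.
Proof.
move=> mg mh; rewrite -ge0_integralD//.
- apply: ge0_le_integral => //.
  + by move=> t _; exact: weighted_ge0.
  + by apply: measurable_weighted; exact: hmeasD.
  + by apply: emeasurable_funD; exact: measurable_weighted.
  + move=> t _; rewrite -ge0_muleDr ?ray_int_ge0// lee_wpmul2l ?lee_fin ?slope_weight_ge0//.
    exact: ray_intD.
- by move=> t _; exact: weighted_ge0.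
- exact: measurable_weighted.
- by move=> t _; exact: weighted_ge0.
- exact: measurable_weighted.
Qed.

Lemma ray_intZ (k : C) g t : hmeas g ->
  ray_int (fun z => k * g z) t = ((normc k)%:E * ray_int g t)%E.
Proof.
move=> mg; rewrite -ge0_integralZl//.
- apply: eq_integral => a _; rewrite -EFinM !rayE; case: ifP => _; last by rewrite mulr0.
  by rewrite normcM.
- exact: measurable_ray_slice.
- by move=> a _; rewrite lee_fin ray_ge0.
- by rewrite lee_fin normc_ge0.
Qed.

Lemma ray_normZ (k : C) g : hmeas g ->
  ray_norm (fun z => k * g z) = ((normc k)%:E * ray_norm g)%E.
Proof.
move=> mg; rewrite -ge0_integralZl//.
- by apply: eq_integral => t _; rewrite ray_intZ// muleCA.
- exact: measurable_weighted.
- by move=> t _; exact: weighted_ge0.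
- by rewrite lee_fin normc_ge0.
Qed.

Lemma ray_norm_ext g h : (forall z, 0 < Re z -> g z = h z) -> ray_norm g = ray_norm h.
Proof.
move=> gh; apply: eq_integral => t _; congr (_ * _)%E.
by apply: eq_integral => a _; rewrite !rayE; case: ifP => // a0; rewrite gh.
Qed.

(** The reference function for error bounds; it is complex-valued so that [ray_norm] applies to
    it. *)
Definition decay2 z : C := ((1 + normc z)^-1 ^+ 2)%:C.

Lemma hmeas_decay2 : hmeas decay2.
Proof.
apply: continuous_hmeas => z _.
have n0 (w : C) : 1 + normc w != 0 by rewrite gt_eqF// ltr_pwDl// normc_ge0.
apply: (@cvg_Complex _ _ _ (nbhs_filter z) (fun w : C => (1 + normc w)^-1 ^+ 2) (fun=> 0)).
  apply: (@continuous_comp _ _ _ (fun w : C => (1 + normc w)^-1) (fun u : R => u ^+ 2)).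
    apply: (@continuous_comp _ _ _ (fun w : C => 1 + normc w) (fun u : R => u^-1)).
      apply: (@continuous_comp _ _ _ (fun w : C => normc w) (fun u : R => 1 + u)).
        exact: continuous_normc.
      by apply: cvgD; [exact: cvg_cst|exact: cvg_id].
    exact: inv_continuous.
  exact: exprn_continuous.
exact: (@cvg_cst _ _ _ (nbhs z) (nbhs_filter z)).
Qed.

Lemma normc_ray a t : 0 <= a -> normc (a +i* (a * t) : C) = a * Num.sqrt (1 + t ^+ 2).
Proof.
move=> a0; rewrite /= (_ : a ^+ 2 + (a * t) ^+ 2 = a ^+ 2 * (1 + t ^+ 2)); last by ring.
by rewrite sqrtrM ?sqr_ge0// sqrtr_sqr ger0_norm.
Qed.

Lemma sqrt_slope_ge1 t : 1 <= Num.sqrt (1 + t ^+ 2).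
Proof. by rewrite -[leLHS]sqrtr1 ler_wsqrtr// lerDl sqr_ge0. Qed.

Lemma sqrt_slope_gt0 t : 0 < Num.sqrt (1 + t ^+ 2).
Proof. exact: lt_le_trans (sqrt_slope_ge1 t). Qed.

Lemma integral_ray_patch (u : R -> R) (v : R -> R) : (forall a, 0 < a -> u a = v a) ->
  (forall a, a <= 0 -> u a = 0) ->
  (\int[mu]_a (u a)%:E = \int[mu]_(a in `]0%R, +oo[) (v a)%:E)%E.
Proof.
move=> uv u0; rewrite [RHS]integral_mkcond; apply: eq_integral => a _.
rewrite patchE; case: ifPn; rewrite ?inE ?notin_setE/= in_itv/= andbT.
  by move=> /uv ->.
by move=> /negP; rewrite -leNgt => /u0 ->.
Qed.

Lemma ray_int_decay2 t : ray_int decay2 t = ((Num.sqrt (1 + t ^+ 2))^-1)%:E.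
Proof.
rewrite -(@integral_inv_sqr R 1 (Num.sqrt (1 + t ^+ 2)))// ?sqrt_slope_gt0//.
apply: integral_ray_patch => a a0; last by rewrite rayE ltNge a0.
rewrite rayE a0 /decay2 normc_real normc_ray ?ltW// ger0_norm ?sqr_ge0//.
by rewrite div1r exprVn.
Qed.

(** On the half-line of slope t the integral is (1 + t^2)^(-1/2), so the exponent becomes (s + 2) /
    2, which exceeds 1/2 exactly when s > -1. *)
Lemma ray_norm_decay2 : -1 < s -> (ray_norm decay2 < +oo)%E.
Proof.
move=> hs; have h : 2^-1 < (s + 2) / 2 by lra.
apply: le_lt_trans (integral_slope_weight h); rewrite le_eqVlt; apply/orP; left; apply/eqP.
apply: eq_integral => t _; rewrite ray_int_decay2 -EFinM; congr EFin.
have p0 : 0 < 1 + t ^+ 2 by rewrite ltr_pwDl// sqr_ge0.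
rewrite /slope_weight -powR12_sqrt ?(ltW p0)// -powRN -powRD; last by rewrite (gt_eqF p0) implybT.
by congr (_ `^ _); field.
Qed.

End RayNorm.

(** * Identification of the seminorm with the norm over half-lines *)

Section NormAlongRays.
Variable R : realType.
Local Notation C := (R[i])^o.
Local Notation mu := (@lebesgue_measure R).
Implicit Types (f : C -> C) (s a t c : R).

Lemma is_derive_scale a x : is_derive x (1 : R) (fun t => a * t) a.
Proof. by apply: is_derive_eq; rewrite [_%:A]mulr1. Qed.

Lemma integral_scaleT a (G : R -> R) : 0 < a -> continuous G -> (forall x, 0 <= G x) ->
  (\int[mu]_x (G x)%:E = \int[mu]_x (G (a * x) * a)%:E)%E.
Proof.
move=> a0 cG G0; pose F x := a * x.
have dF x : is_derive x (1 : R) F a := is_derive_scale a x.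
have F'E : derive1 F = cst a by apply/funext => x; rewrite derive1E derive_val.
rewrite (@increasing_ge0_integration_by_substitutionT _ F G).
- by apply: eq_integral => x _; rewrite F'E.
- by move=> x y xy; rewrite /F ltr_pM2l.
- by rewrite F'E => x; exact: cvg_cst.
- by rewrite F'E; exact: is_cvg_cst.
- by rewrite F'E; exact: is_cvg_cst.
- by move=> x; have dx := dF x; exact: ex_derive.
- by apply: gt0_cvgMrNy => //; exact: cvg_id.
- by apply: gt0_cvgMry => //; exact: cvg_id.
- exact: cG.
- exact: G0.
Qed.

(** For fixed a substitute b = a t: the factors a^s, a^(-(s+1)) and the Jacobian a multiply to 1 and
    leave [slope_weight]; then exchange the integrals by Tonelli. *)
Lemma Ds0norm_ray s f : (forall z, 0 < Re z -> {for z, continuous ('D_1 f : C -> C)}) ->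
  Ds0norm s f = ray_norm s ('D_1 f).
Proof.
move=> cf; have mf : hmeas ('D_1 f) by exact: continuous_hmeas.
have cf' a (b : R) : 0 < a -> {for b, continuous (fun b => normc ('D_1 f (a +i* b)))}.
  move=> a0; have cp : {for b, continuous (fun b : R => a +i* b : C)}.
    by apply: cvg_Complex; [exact: cvg_cst|exact: cvg_id].
  have cD := @continuous_comp _ _ _ (fun b : R => a +i* b : C) ('D_1 f : C -> C) b cp (cf (a +i* b) a0).
  exact: (@continuous_comp _ _ _ _ (fun z : C => normc z) b cD (@continuous_normc R _)).
pose K p : \bar R := ((slope_weight s p.2)%:E * (ray ('D_1 f) p)%:E)%E.
have mK : measurable_fun setT K.
  apply: emeasurable_funM; last exact: measurable_EFin_ray mf.
  apply/measurable_EFinP.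
  exact: (measurableT_comp (measurable_slope_weight s) (measurable_snd (T1 := R))).
have K0 p : (0 <= K p)%E by rewrite mule_ge0 ?lee_fin ?slope_weight_ge0 ?ray_ge0.
have -> : ray_norm s ('D_1 f) = (\int[mu]_t \int[mu]_a K (a, t))%E.
  apply: eq_integral => t _; rewrite /ray_int -ge0_integralZl//.
  - exact: measurable_ray_slice.
  - by move=> a _; rewrite lee_fin ray_ge0.
  - by rewrite lee_fin slope_weight_ge0.
transitivity (\int[mu]_a \int[mu]_t K (a, t))%E; last exact: (@fubini_tonelli _ _ _ _ _ mu mu K mK K0).
rewrite /Ds0norm integral_mkcond.
apply: eq_integral => a _; rewrite patchE; case: ifPn; rewrite ?inE ?notin_setE/=; last first.
  move=> /negP a0; rewrite integral0_eq// => t _; rewrite /K rayE (negbTE a0) mule0//.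
move=> a0; pose q := (s + 1) / 2.
pose G b := normc ('D_1 f (a +i* b)) / ((a ^+ 2 + b ^+ 2) `^ q).
have p0 (b : R) : 0 < a ^+ 2 + b ^+ 2 by rewrite ltr_pwDl ?exprn_gt0// sqr_ge0.
have cG : continuous G.
  move=> b; apply: cvgM; first exact: cf'.
  apply: cvgV; first by rewrite gt_eqF// powR_gt0.
  apply: (@continuous_comp _ _ _ (fun b : R => a ^+ 2 + b ^+ 2) (fun u => u `^ q)).
    by apply: cvgD; [exact: cvg_cst|exact: exprn_continuous].
  apply/differentiable_continuous/derivable1_diffP.
  by have h := is_derive1_powR q (p0 b); exact: ex_derive.
have G0 b : 0 <= G b by rewrite divr_ge0 ?normc_ge0// powR_ge0.
rewrite (@integral_scaleT a G)// -ge0_integralZl//; last 3 first.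
- apply/measurable_EFinP; apply: measurable_funM; last exact: measurable_cst.
  apply: (measurableT_comp (continuous_measurable_fun cG)).
  by apply: measurable_funM; [exact: measurable_cst|exact: measurable_id].
- by move=> b _; rewrite lee_fin mulr_ge0// ltW.
- by rewrite lee_fin powR_ge0.
apply: eq_integral => t _; rewrite /K -!EFinM rayE a0; congr EFin.
rewrite /G; have -> : a ^+ 2 + (a * t) ^+ 2 = a ^+ 2 * (1 + t ^+ 2) by ring.
have q0 : 0 < 1 + t ^+ 2 by rewrite ltr_pwDl// sqr_ge0.
rewrite powRM ?sqr_ge0 ?(ltW q0)// -(powR_mulrn 2 (ltW a0)) -powRrM.
have -> : 2 * q = s + 1 by rewrite /q; field.
rewrite powRD ?(gt_eqF a0) ?implybT// powRr1 ?(ltW a0)//.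
rewrite /slope_weight powRN -/q.
have h1 := powR_gt0 s a0; have h2 := powR_gt0 q q0.
move: (normc _) (a `^ s) (_ `^ q) h1 h2 => u v w h1 h2.
by field; rewrite !gt_eqF.
Qed.

End NormAlongRays.

(** * Limits of derivatives of rational functions *)

Section RationalApproximation.
Variable R : realType.
Local Notation C := (R[i])^o.
Local Notation mu := (@lebesgue_measure R).
Implicit Types (f g h r : C -> C) (z w zeta : C) (t a b c eps A : R).

Lemma complex_ReD z w : Re (z + w) = Re z + Re w.
Proof. by case: z; case: w. Qed.

Lemma Re_le_normcD zeta z : 0 < Re zeta -> 0 < Re z -> Re zeta <= normc (zeta + z).
Proof.
move=> h1 h2; apply: le_trans (abs_Re_le _); rewrite complex_ReD ger0_norm; last by rewrite addr_ge0 ?ltW.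
by rewrite lerDl ltW.
Qed.

(** No cancellation in zeta + z: |z| <= |zeta + z| + |zeta|, and Re zeta is at most both |zeta| and
    |zeta + z|. The constant is governed by the slope of zeta alone. *)
Lemma halfplane_addP zeta z : 0 < Re zeta -> 0 < Re z ->
  Re zeta * (normc zeta + normc z) <= 3 * normc zeta * normc (zeta + z).
Proof.
move=> h1 h2; have h3 := Re_le_normcD h1 h2.
have h4 : Re zeta <= normc zeta by apply: le_trans (abs_Re_le _); exact: ler_norm.
have h5 : normc z <= normc (zeta + z) + normc zeta.
  by rewrite -[in leLHS](addKr zeta z) addrC; apply: le_trans (normcB _ _) _.
have h6 := normc_ge0 (zeta + z).
move: (normc _) (normc _) (normc _) (Re _) h1 h3 h4 h5 h6 => u v x y; nra.
Qed.

Lemma addz_neq0 zeta z : 0 < Re zeta -> 0 < Re z -> zeta + z != 0.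
Proof. by move=> h1 h2; rewrite -normc_gt0; apply: lt_le_trans (Re_le_normcD h1 h2). Qed.

Lemma inv_decay zeta : 0 < Re zeta ->
  exists2 A, 0 < A & forall z, 0 < Re z -> normc (zeta + z)^-1 <= A / (1 + normc z).
Proof.
move=> h; have n0 : 0 < normc zeta.
  by apply: lt_le_trans h _; apply: le_trans (abs_Re_le _); exact: ler_norm.
pose m := Num.min 1 (normc zeta).
have m0 : 0 < m by rewrite lt_min ltr01 n0.
have m1 : m <= 1 by rewrite ge_min lexx.
have m2 : m <= normc zeta by rewrite ge_min lexx orbT.
exists (3 * normc zeta / (Re zeta * m)); first by rewrite !(divr_gt0, mulr_gt0).
move=> z hz; have := halfplane_addP h hz.
have z0 := normc_ge0 z.
have p0 : 0 < normc (zeta + z) by rewrite normc_gt0 addz_neq0.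
rewrite normcV => H.
have p1 : 0 < 1 + normc z by rewrite ltr_pwDl.
rewrite ler_pdivlMr// mulrC ler_pdivrMr// mulrAC ler_pdivlMr ?mulr_gt0//.
apply: le_trans H; rewrite mulrCA ler_pM2l//.
by rewrite mulrDl mul1r; apply: lerD => //; rewrite ler_piMr.
Qed.

Lemma normc_decay2 z : normc (decay2 z) = (1 + normc z)^-1 ^+ 2.
Proof. by rewrite normc_real ger0_norm ?sqr_ge0. Qed.

(** Two of the m + 2 factors supply the decay; the others are bounded by [A]. *)
Lemma decay2_bound x A z m : 0 <= x -> x <= A / (1 + normc z) -> x ^+ m.+2 <= A ^+ m.+2 * normc (decay2 z).
Proof.
move=> x0 xA; have p1 : 1 <= 1 + normc z by rewrite lerDl normc_ge0.
have p0 : 0 < 1 + normc z by exact: lt_le_trans p1.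
have A0 : 0 <= A by rewrite -(@pmulr_lge0 _ (1 + normc z)^-1) ?invr_gt0//; exact: le_trans xA.
rewrite normc_decay2 -addn2 [x ^+ _]exprD [A ^+ _]exprD -mulrA -exprMn.
apply: ler_pM; rewrite ?exprn_ge0//; last by rewrite lerXn2r// nnegrE// mulr_ge0// invr_ge0 ltW.
rewrite lerXn2r ?nnegrE//; apply: le_trans xA _; rewrite ler_piMr// invf_le1//.
Qed.

Lemma cderiv_val f z (D : C) : is_derive z 1 f D -> 'D_1 f z = D.
Proof. by move=> []. Qed.

Definition halfplane_holo f := forall z, 0 < Re z -> derivable f z 1.

Lemma halfplane_holo_ball f z : halfplane_holo f -> 0 < Re z -> holo_ball f z (Re z).
Proof.
move=> hf z0 w wz; apply: hf.
have := le_lt_trans (abs_Re_le _) wz; rewrite complex_ReB ltr_norml => /andP[h _]; lra.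
Qed.

Lemma halfplane_holo_derive f : halfplane_holo f -> halfplane_holo ('D_1 f).
Proof. by move=> hf z z0; exact: derivable_derive z0 (halfplane_holo_ball hf z0). Qed.

Lemma halfplane_holo_continuous f : halfplane_holo f ->
  forall z, 0 < Re z -> {for z, continuous f}.
Proof. by move=> hf z /hf; exact: continuous_derivable. Qed.

Lemma halfplane_holo_hmeas f : halfplane_holo f -> hmeas f.
Proof. by move=> hf; apply: continuous_hmeas; exact: halfplane_holo_continuous. Qed.

Lemma Rtilde_is_derive n (a0 : C) (a lam : nat -> C) z :
  (forall k, (k < n)%N -> 0 < Re (lam k)) -> 0 < Re z ->
  is_derive z 1 (fun z : C => a0 + \sum_(k < n) a k / (lam k + z)) (\sum_(k < n) - a k / (lam k + z) ^+ 2).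
Proof.
elim: n => [|n ih] hl hz.
  under eq_fun do rewrite big_ord0; rewrite big_ord0; exact: cderiv_cst.
under eq_fun do rewrite big_ord_recr/= addrA.
rewrite big_ord_recr/=; apply: cderivD; first by apply: ih => // k kn; apply: hl; exact: ltnW.
have ne := addz_neq0 (hl n (ltnSn n)) hz.
have := cderivM (cderiv_cst z (a n)) (cderivV (cderivD (cderiv_cst z (lam n)) (cderiv_id z)) ne).
by rewrite mul0r !add0r mulrA mulrN1 => h.
Qed.

Lemma Rtilde_holo r : Rtilde r -> halfplane_holo r.
Proof.
by move=> [n [a0 [a [lam [hl ->]]]]] z hz; have h := Rtilde_is_derive a0 a hl hz; exact: ex_derive.
Qed.

Lemma Rtilde_cst (c : C) : Rtilde (fun=> c).
Proof. by exists 0%N, c, (fun=> 0), (fun=> 0); split => //; apply/funext => z; rewrite big_ord0 addr0. Qed.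

Lemma Rtilde_pole (c zeta : C) : 0 < Re zeta -> Rtilde (fun z => c / (zeta + z)).
Proof.
move=> h; exists 1%N, 0, (fun=> c), (fun=> zeta); split => //.
by apply/funext => z; rewrite big_ord_recl big_ord0 addr0 add0r.
Qed.

Lemma RtildeD r1 r2 : Rtilde r1 -> Rtilde r2 -> Rtilde (fun z => r1 z + r2 z).
Proof.
move=> [n [a0 [a [la [hla ->]]]]] [m [b0 [b [lb [hlb ->]]]]].
exists (n + m)%N, (a0 + b0), (fun k => if (k < n)%N then a k else b (k - n)%N),
  (fun k => if (k < n)%N then la k else lb (k - n)%N); split.
  move=> k knm; case: ltnP => kn; first exact: hla.
  by apply: hlb; rewrite ltn_subLR.
apply/funext => z; rewrite big_split_ord/= addrACA; congr (_ + (_ + _)).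
  by apply: eq_bigr => k _; rewrite ltn_ord.
by apply: eq_bigr => k _; rewrite ltnNge leq_addr/= addKn.
Qed.

Lemma RtildeZ (c : C) r : Rtilde r -> Rtilde (fun z => c * r z).
Proof.
move=> [n [a0 [a [la [hla ->]]]]]; exists n, (c * a0), (fun k => c * a k), la; split => //.
by apply/funext => z; rewrite mulrDr mulr_sumr; congr (_ + _); apply: eq_bigr => k _; rewrite mulrA.
Qed.

Section Approximable.
Variable s : R.
Hypothesis hs : -1 < s.

(** Membership in the closure of the derivatives of [Rtilde]. Measurability is carried along for the
    triangle inequality [ray_normD]. *)
Definition approximable g := hmeas g /\ forall eps, 0 < eps ->
  exists2 r, Rtilde r & (ray_norm s (fun z => (g z - 'D_1 r z)%R) < eps%:E)%E.

Lemma Rtilde_hmeas r : Rtilde r -> hmeas ('D_1 r).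
Proof. by move=> /Rtilde_holo/halfplane_holo_derive/halfplane_holo_hmeas. Qed.

Lemma ray_norm0 g : (forall z, 0 < Re z -> g z = 0) -> ray_norm s g = 0.
Proof.
move=> g0; rewrite (@ray_norm_ext _ s _ (fun z => 0 * decay2 z)); last by move=> z /g0 ->; rewrite mul0r.
by rewrite ray_normZ ?ComplexField.Normc.normc0 ?mul0e//; exact: hmeas_decay2.
Qed.

Lemma approximable_derive g r : Rtilde r -> (forall z, 0 < Re z -> g z = 'D_1 r z) -> approximable g.
Proof.
move=> hr gr; split; first exact: hmeas_ext gr (Rtilde_hmeas hr).
by move=> eps e0; exists r => //; rewrite ray_norm0 ?lte_fin// => z hz; rewrite (gr _ hz) subrr.
Qed.

Lemma approximable_closed g : hmeas g -> (forall eps, 0 < eps ->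
  exists2 h, approximable h & (ray_norm s (fun z => (g z - h z)%R) < eps%:E)%E) -> approximable g.
Proof.
move=> mg H; split; first exact: mg.
move=> eps e0; have e2 : 0 < eps / 2 by exact: divr_gt0.
have [h [mh ah] gh] := H _ e2; have [r hr hhr] := ah _ e2.
exists r => //; apply: le_lt_trans (_ : _ <= ray_norm s (fun z => (g z - h z)%R) + ray_norm s (fun z => (h z - 'D_1 r z)%R))%E _.
  rewrite (@ray_norm_ext _ s _ (fun z => (g z - h z) + (h z - 'D_1 r z))); last first.
    by move=> z _; rewrite addrA subrK.
  exact: ray_normD (hmeasB mg mh) (hmeasB mh (Rtilde_hmeas hr)).
by rewrite (splitr eps) EFinD; exact: lteD gh hhr.
Qed.

Lemma approximableD g h : approximable g -> approximable h -> approximable (fun z => g z + h z).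
Proof.
move=> [mg ag] [mh ah]; split; first exact: hmeasD.
move=> eps e0; have e2 : 0 < eps / 2 by exact: divr_gt0.
have [r1 hr1 h1] := ag _ e2; have [r2 hr2 h2] := ah _ e2.
exists (fun z => r1 z + r2 z); first exact: RtildeD.
rewrite (@ray_norm_ext _ s _ (fun z => (g z - 'D_1 r1 z) + (h z - 'D_1 r2 z))); last first.
  move=> z hz; have /derivableP d1 := Rtilde_holo hr1 hz; have /derivableP d2 := Rtilde_holo hr2 hz.
  have -> : 'D_1 (fun z => r1 z + r2 z) z = 'D_1 r1 z + 'D_1 r2 z := cderiv_val (cderivD d1 d2).
  by move: ('D_1 r1 z) ('D_1 r2 z) => u v; ring.
apply: le_lt_trans (ray_normD _ _ _) _; last by rewrite (splitr eps) EFinD; exact: lteD h1 h2.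
- exact: hmeasB mg (Rtilde_hmeas hr1).
- exact: hmeasB mh (Rtilde_hmeas hr2).
Qed.

Lemma approximableZ (k : C) g : approximable g -> approximable (fun z => k * g z).
Proof.
move=> [mg ag]; split; first exact: hmeasZ.
move=> eps e0; have k1 : 0 < normc k + 1 by rewrite ltr_wpDl// normc_ge0.
have [r hr h] := ag _ (divr_gt0 e0 k1).
exists (fun z => k * r z); first exact: RtildeZ.
rewrite (@ray_norm_ext _ s _ (fun z => k * (g z - 'D_1 r z))); last first.
  move=> z hz; have /derivableP d1 := Rtilde_holo hr hz.
  rewrite (cderiv_val (cderivM (cderiv_cst z k) d1)).
  by move: ('D_1 r z) => u; ring.
rewrite ray_normZ; last exact: hmeasB mg (Rtilde_hmeas hr).
apply: (@le_lt_trans _ _ ((normc k + 1)%:E * ray_norm s (fun z => (g z - 'D_1 r z)%R)))%E.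
  by rewrite lee_wpmul2r ?ray_norm_ge0// lee_fin lerDl.
by rewrite -(divfK (lt0r_neq0 k1) eps) mulrC EFinM lte_pmul2l.
Qed.

Lemma approximable_ext g h : (forall z, 0 < Re z -> g z = h z) -> approximable h -> approximable g.
Proof.
move=> gh [mh ah]; split; first exact: hmeas_ext gh mh.
move=> eps /ah[r hr H]; exists r; first exact: hr.
rewrite (@ray_norm_ext _ s _ (fun z => h z - 'D_1 r z)); first exact: H.
by move=> z hz; rewrite (gh _ hz).
Qed.

Lemma approximable_sum n (g_ : 'I_n -> C -> C) : (forall i, approximable (g_ i)) ->
  approximable (fun z => \sum_(i < n) g_ i z).
Proof.
elim: n g_ => [|n ih] g_ H.
  apply: (@approximable_ext _ (fun=> 0)); first by move=> z _; rewrite big_ord0.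
  apply: (approximable_derive (Rtilde_cst 0)) => z _.
  by rewrite (cderiv_val (cderiv_cst z 0)).
apply: (@approximable_ext _ (fun z => \sum_(i < n) g_ (widen_ord (leqnSn n) i) z + g_ ord_max z)).
  by move=> z _; rewrite big_ord_recr.
by apply: approximableD => //; exact: ih.
Qed.

End Approximable.

End RationalApproximation.

(** * Poles of higher order as limits of simple ones *)

Section PoleApproximation.
Variable R : realType.
Local Notation C := (R[i])^o.
Variable s : R.
Hypothesis hs : -1 < s.
Implicit Types (z w zeta u v : C) (M d eps : R).

Lemma normc_expB u v M n : normc u <= M -> normc v <= M ->
  normc (u ^+ n.+1 - v ^+ n.+1) <= n.+1%:R * M ^+ n * normc (u - v).
Proof.
move=> hu hv; have M0 : 0 <= M by apply: le_trans hu; exact: normc_ge0.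
elim: n => [|n ih]; first by rewrite !expr1 expr0 !mul1r.
have -> : u ^+ n.+2 - v ^+ n.+2 = u * (u ^+ n.+1 - v ^+ n.+1) + v ^+ n.+1 * (u - v).
  by rewrite [u ^+ n.+2]exprS [v ^+ n.+2]exprS; ring.
apply: le_trans (normcD _ _) _; rewrite !normcM normcX.
rewrite (_ : n.+2%:R * M ^+ n.+1 * normc (u - v) = M * (n.+1%:R * M ^+ n * normc (u - v)) +
   M ^+ n.+1 * normc (u - v)); last by rewrite exprS -(natr1 n.+1); ring.
apply: lerD; first by apply: ler_pM; rewrite ?normc_ge0.
by rewrite ler_wpM2r ?normc_ge0// lerXn2r ?nnegrE ?normc_ge0.
Qed.

(** Meant for u = 1 / (zeta + z) and v = 1 / (zeta + d + z), related by the resolvent identity. The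
    bound is quadratic in d and gains a power of u, so it is uniform in z and decays. *)
Lemma pow_resolvent_diff u v (d : C) m : u - v = d * u * v -> normc v <= normc u ->
  normc (u ^+ m - v ^+ m - m%:R * d * u ^+ m.+1) <= (m ^ 2)%:R * normc d ^+ 2 * normc u ^+ m.+2.
Proof.
move=> uv vu; elim: m => [|m ih].
  by rewrite !expr0 subrr !mul0r subr0 ComplexField.Normc.normc0 lexx.
have -> : u ^+ m.+1 - v ^+ m.+1 - m.+1%:R * d * u ^+ m.+2 =
    u * (u ^+ m - v ^+ m - m%:R * d * u ^+ m.+1) - d * u * (u ^+ m.+1 - v ^+ m.+1).
  have uv' : v ^+ m * (u - v) = v ^+ m * (d * u * v) by rewrite uv.
  rewrite [u ^+ m.+2]exprS -[m.+1%:R]natr1 [v ^+ m.+1]exprS [u ^+ m.+1]exprS.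
  apply/eqP; rewrite -subr_eq0; apply/eqP.
  transitivity (v ^+ m * (u - v) - v ^+ m * (d * u * v)); last by rewrite uv' subrr.
  by ring.
apply: le_trans (normcB _ _) _; rewrite !normcM.
have h := normc_expB m (lexx (normc u)) vu.
rewrite uv !normcM in h.
have u0 := normc_ge0 u; have v0 := normc_ge0 v; have d0 := normc_ge0 d.
have h1 : normc u * normc (u ^+ m - v ^+ m - m%:R * d * u ^+ m.+1) <=
   (m ^ 2)%:R * normc d ^+ 2 * normc u ^+ m.+3.
  by rewrite [normc u ^+ m.+3]exprS mulrCA ler_wpM2l.
have h2 : normc d * normc u * normc (u ^+ m.+1 - v ^+ m.+1) <=
   m.+1%:R * normc d ^+ 2 * normc u ^+ m.+3.
  apply: (@le_trans _ _ (normc d * normc u * (m.+1%:R * normc u ^+ m * (normc d * normc u * normc u)))).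
    rewrite ler_wpM2l ?mulr_ge0//; apply: le_trans h _.
    by rewrite ler_wpM2l ?mulr_ge0 ?exprn_ge0// ler_wpM2l// mulr_ge0.
  by rewrite !exprS expr0; rewrite le_eqVlt; apply/orP; left; apply/eqP; ring.
apply: le_trans (lerD h1 h2) _; rewrite -!mulrDl ler_wpM2r ?exprn_ge0// ler_wpM2r ?exprn_ge0//.
(* The induction closes because m^2 + (m + 1) <= (m + 1)^2. *)
by rewrite -natrD ler_nat -!mulnn mulSn mulnS addnC leq_add2l leq_addl.
Qed.

Lemma cderiv_resolvent zeta z : 0 < Re zeta -> 0 < Re z ->
  is_derive z 1 (fun z : C => (zeta + z)^-1) (- (zeta + z)^-1 ^+ 2).
Proof.
move=> h hz; have := cderivV (cderivD (cderiv_cst z zeta) (cderiv_id z)) (addz_neq0 h hz).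
by rewrite add0r mulN1r exprVn.
Qed.

Lemma resolvent_holo zeta : 0 < Re zeta -> halfplane_holo (fun z : C => (zeta + z)^-1).
Proof. by move=> h z hz; have := cderiv_resolvent h hz => d; exact: ex_derive. Qed.

Lemma halfplane_holoX (f : C -> C) n : halfplane_holo f -> halfplane_holo (fun z => f z ^+ n).
Proof. by move=> hf z /hf/derivableP d; have := cderivX d n => h; exact: ex_derive. Qed.

Lemma halfplane_holoM (f g : C -> C) : halfplane_holo f -> halfplane_holo g ->
  halfplane_holo (fun z => f z * g z).
Proof.
move=> hf hg z hz; have /derivableP d1 := hf z hz; have /derivableP d2 := hg z hz.
by have := cderivM d1 d2 => h; exact: ex_derive.
Qed.

Lemma halfplane_holo_cst (k : C) : halfplane_holo (fun=> k).
Proof. by move=> z _; exact: derivable_cst. Qed.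

Lemma halfplane_holo_id : halfplane_holo (fun z : C => z).
Proof. by move=> z _; exact: derivable_id. Qed.

(** The square is the derivative of -1 / (zeta + z). Each higher power is the limit, as d tends to
    0, of difference quotients in zeta of the previous one, so the induction hypothesis is used at
    zeta and at zeta + d. *)
Lemma approximable_resolventX zeta m : 0 < Re zeta ->
  approximable s (fun z => (zeta + z)^-1 ^+ m.+2).
Proof.
elim: m zeta => [|m ih] zeta h.
  apply: (approximable_derive s (Rtilde_pole (-1) h)) => z hz.
  rewrite (cderiv_val (cderivM (cderiv_cst z (-1)) (cderiv_resolvent h hz))).
  by rewrite mul0r add0r mulN1r opprK.
have mg n : hmeas (fun z : C => (zeta + z)^-1 ^+ n).
  exact: halfplane_holo_hmeas (halfplane_holoX (resolvent_holo h)).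
apply: approximable_closed; first exact: mg.
move=> eps e0; have [A A0 HA] := inv_decay h.
have fin := ray_norm_decay2 hs; have nd0 := ray_norm_ge0 s (@decay2 R).
have [N N0 HN] : exists2 N : R, 0 <= N & ray_norm s (@decay2 R) = N%:E.
  exists (fine (ray_norm s (@decay2 R))); first exact: fine_ge0.
  by rewrite fineK// ge0_fin_numE.
(* The difference quotient with step d misses the target by at most K d in seminorm. *)
pose K := m.+2%:R * A ^+ m.+4 * N.
have K0 : 0 <= K by rewrite mulr_ge0// mulr_ge0// exprn_ge0// ltW.
pose d := eps / (K + 1).
have K1 : 0 < K + 1 by rewrite ltr_wpDl.
have d0 : 0 < d by exact: divr_gt0.
have md0 : 0 < m.+2%:R * d by apply: mulr_gt0 => //; rewrite ltr0n.
have hd : 0 < Re (zeta + d%:C) by rewrite complex_ReD/= addr_gt0.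
have md : (m.+2%:R * d%:C : C) != 0.
  by rewrite mulf_neq0 ?pnatr_eq0// eq_complex/= eqxx andbT gt_eqF.
exists (fun z => (m.+2%:R * d%:C)^-1 * ((zeta + z)^-1 ^+ m.+2 + (-1) * (zeta + d%:C + z)^-1 ^+ m.+2)).
  apply: approximableZ; apply: approximableD; first exact: ih.
  by apply: approximableZ; exact: ih.
apply: (@le_lt_trans _ _ (ray_norm s (fun z => (m.+2%:R * d * A ^+ m.+4)%:C * decay2 z))).
  apply: ray_norm_le.
  - apply: hmeasB; first exact: mg.
    apply: hmeasZ; apply: hmeasD; first exact: mg.
    by apply: hmeasZ; exact: halfplane_holo_hmeas (halfplane_holoX (resolvent_holo hd)).
  - by apply: hmeasZ; exact: hmeas_decay2.
  move=> z hz; set u := (zeta + z)^-1; set v := (zeta + d%:C + z)^-1.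
  have n1 := addz_neq0 h hz; have n2 := addz_neq0 hd hz.
  have uv : u - v = d%:C * u * v.
    rewrite /u /v; move: n2; rewrite (addrAC zeta); move: (d%:C) (zeta + z) n1 => D x n1 n2.
    by field; rewrite n1 n2.
  have vu : normc v <= normc u.
    rewrite !normcV lef_pV2 ?posrE ?normc_gt0//.
    rewrite -(ler_pXn2r (n:=2))// ?nnegrE ?normc_ge0// !normc_sqr.
    rewrite (_ : Im (zeta + d%:C + z) = Im (zeta + z)); last first.
      by case: (zeta) => ? ?; case: (z) => ? ? /=; rewrite addr0.
    rewrite lerD2r !complex_ReD/= lerXn2r ?nnegrE ?addr_ge0 ?ltW//.
    by move: (Re zeta) (Re z) d0 => x y; lra.
  have := pow_resolvent_diff m.+2 uv vu.
  have -> : u ^+ m.+3 - (m.+2%:R * d%:C)^-1 * (u ^+ m.+2 + (-1) * v ^+ m.+2) =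
     - ((m.+2%:R * d%:C)^-1 * (u ^+ m.+2 - v ^+ m.+2 - m.+2%:R * d%:C * u ^+ m.+3)).
    by rewrite mulrBr mulKf// opprB mulN1r.
  move=> H; rewrite normcN normcM normcV normcM normc_real (gtr0_norm d0).
  have -> : normc (m.+2%:R : C) = m.+2%:R.
    by rewrite -(rmorph_nat (real_complex R)) normc_real ger0_norm.
  rewrite mulrC ler_pdivrMr//; refine (le_trans H _).
  rewrite normc_real (gtr0_norm d0).
  have := decay2_bound m.+2 (normc_ge0 u) (HA z hz).
  have mp : 0 <= (m.+2 ^ 2)%:R * d ^+ 2 :> R by rewrite mulr_ge0// sqr_ge0.
  move=> /(ler_wpM2l mp) /le_trans; apply.
  rewrite normcM normc_real ger0_norm; last by apply: mulr_ge0; [exact: ltW md0|rewrite exprn_ge0// ltW].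
  rewrite natrX le_eqVlt; apply/orP; left; apply/eqP.
  by move: (A ^+ m.+4) (normc (decay2 z)) (m.+2%:R) => x y n; ring.
rewrite ray_normZ; last exact: hmeas_decay2.
rewrite HN normc_real ger0_norm; last by apply: mulr_ge0; [exact: ltW md0|rewrite exprn_ge0// ltW].
rewrite -EFinM lte_fin (_ : _ * N = K * d); last by rewrite /K; ring.
by rewrite /d mulrCA gtr_pMr// ltr_pdivrMr// mul1r ltrDl.
Qed.

(** Induction on k through z = (zeta + z) - zeta, which trades a power of z for one pole order. *)
Lemma approximable_pole k m zeta : 0 < Re zeta ->
  approximable s (fun z => z ^+ k * (zeta + z)^-1 ^+ (k + m).+2).
Proof.
move=> h; elim: k m => [|k ih] m.
  apply: (approximable_ext _ (approximable_resolventX m h)) => z _.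
  by rewrite expr0 mul1r.
have := approximableD (ih m) (approximableZ (- zeta) (ih m.+1)).
apply: approximable_ext => z hz; have n1 := addz_neq0 h hz.
rewrite addnS addSn [(zeta + z)^-1 ^+ (k + m).+3]exprS [z ^+ k.+1]exprS.
move: (_ ^+ k) (_ ^+ (k + m).+2) => x y; field.
by [].
Qed.

End PoleApproximation.

(** * Averages along a half-line *)

Section KernelEstimates.
Variable R : realType.
Local Notation C := (R[i])^o.
Variables (m : nat) (t0 : R).
Implicit Types (z w zeta u v : C) (x y a b : R).

(** Homogeneous of degree -1 in the pair, so that ker d zeta depends on z / zeta only: a
    multiplicative convolution kernel. *)
Definition ker zeta z : C := zeta ^+ m.+1 * (z ^+ m * (zeta + z)^-1 ^+ (m + m).+2).

Definition slope : C := 1 +i* t0.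
Definition rpt x : C := x%:C * slope.

Lemma slope_ge1 : 1 <= normc slope.
Proof. by apply: le_trans (abs_Re_le _); rewrite /= normr1. Qed.

Lemma slope_gt0 : 0 < normc slope.
Proof. exact: lt_le_trans slope_ge1. Qed.

Lemma normc_rpt x : 0 <= x -> normc (rpt x) = x * normc slope.
Proof. by move=> x0; rewrite normcM normc_real ger0_norm. Qed.

Lemma Re_rpt x : Re (rpt x) = x.
Proof. by rewrite /rpt complex_ReM /= mul0r subr0 mulr1. Qed.

(** By [halfplane_addP], |zeta + z| is comparable with |zeta| + |z| on the fixed half-line. The m
    paired factors |zeta| |z| / (|zeta| + |z|)^2 are at most 1, and one factor with the required
    decay remains. *)
Lemma ker_bound : exists2 B, 0 <= B & forall x z, 0 < x -> 0 < Re z ->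
  normc (ker (rpt x) z) <= B * (x / (x + normc z) ^+ 2).
Proof.
have n0 := slope_gt0; have n1 := slope_ge1.
exists ((3 * normc slope) ^+ (m + m).+2 * normc slope); first by rewrite mulr_ge0 ?exprn_ge0 ?mulr_ge0// ltW.
move=> x z x0 z0; have xr : 0 < Re (rpt x) by rewrite Re_rpt.
have zn := normc_ge0 z.
pose Z := x * normc slope; have Z0 : 0 < Z by exact: mulr_gt0.
have xZ : x <= Z by rewrite ler_peMr// ltW.
have Zz : 0 < Z + normc z by rewrite ltr_pwDl.
have xz : 0 < x + normc z by rewrite ltr_pwDl.
have h1 : normc (rpt x + z)^-1 <= 3 * normc slope / (Z + normc z).
  have := halfplane_addP xr z0; rewrite Re_rpt (normc_rpt (ltW x0)) -/Z.
  have p0 : 0 < normc (rpt x + z) by rewrite normc_gt0 addz_neq0.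
  rewrite normcV => H; rewrite ler_pdivlMr// mulrC ler_pdivrMr//.
  rewrite -(ler_pM2l x0); apply: le_trans H _.
  by rewrite /Z le_eqVlt; apply/orP; left; apply/eqP; ring.
rewrite /ker normcM normcX normcM !normcX (normc_rpt (ltW x0)) -/Z.
have h2 : normc (rpt x + z)^-1 ^+ (m + m).+2 <= (3 * normc slope) ^+ (m + m).+2 * (Z + normc z)^-1 ^+ (m + m).+2.
  rewrite -exprMn lerXn2r// nnegrE ?normc_ge0//.
  by rewrite mulr_ge0 ?invr_ge0 ?mulr_ge0// ltW.
set K := (3 * normc slope) ^+ (m + m).+2 in h2 *.
have K0 : 0 <= K by rewrite exprn_ge0// mulr_ge0// ltW.
apply: (@le_trans _ _ (Z ^+ m.+1 * (normc z ^+ m * (K * (Z + normc z)^-1 ^+ (m + m).+2)))).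
  apply: ler_wpM2l; first by rewrite exprn_ge0// ltW.
  by apply: ler_wpM2l h2; exact: exprn_ge0.
have -> : Z ^+ m.+1 * (normc z ^+ m * (K * (Z + normc z)^-1 ^+ (m + m).+2)) =
    K * ((Z / (Z + normc z)) ^+ m * (normc z / (Z + normc z)) ^+ m * (Z / (Z + normc z) ^+ 2)).
  rewrite -[((Z + normc z) ^+ 2)^-1]exprVn; move: (Z + normc z)^-1 => D.
  by rewrite exprS -addn2 !exprD !exprMn; move: (Z ^+ m) (normc z ^+ m) (D ^+ m) => p q r; ring.
rewrite -[leRHS]mulrA ler_wpM2l//.
have r1 : (Z / (Z + normc z)) ^+ m <= 1.
  rewrite exprn_ile1// ?divr_ge0 ?(ltW Z0) ?(ltW Zz)// ler_pdivrMr// mul1r lerDl//.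
have r2 : (normc z / (Z + normc z)) ^+ m <= 1.
  rewrite exprn_ile1// ?divr_ge0 ?(ltW Zz)// ler_pdivrMr// mul1r lerDr ltW//.
have r0 : 0 <= Z / (Z + normc z) ^+ 2 by rewrite divr_ge0 ?exprn_ge0// ltW.
apply: (@le_trans _ _ (Z / (Z + normc z) ^+ 2)).
  rewrite -[leRHS]mul1r ler_wpM2r// -[leRHS]mul1r.
  apply: ler_pM => //; rewrite exprn_ge0// divr_ge0// ?(ltW Z0) ?(ltW Zz)//.
rewrite {1}/Z [x * _]mulrC -mulrA ler_wpM2l ?(ltW n0)// ler_wpM2l ?(ltW x0)//.
by rewrite lef_pV2 ?posrE ?exprn_gt0// lerXn2r ?nnegrE ?(ltW xz) ?(ltW Zz)// lerD2r.
Qed.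

Lemma prod3B (p q r p' q' r' : C) :
  p * (q * r) - p' * (q' * r') = (p - p') * q * r + p' * (q - q') * r + p' * q' * (r - r').
Proof. ring. Qed.

(** On a compact piece of the source half-line the kernel is Lipschitz in the abscissa with [decay2]
    as modulus in z; this turns convergence of Riemann sums into convergence in seminorm. *)
Lemma ker_lipschitz a b : 0 < a -> a <= b -> exists2 L, 0 <= L &
  forall x y z, a <= x <= b -> a <= y <= b -> 0 < Re z ->
    normc (ker (rpt x) z - ker (rpt y) z) <= L * `|x - y| * normc (decay2 z).
Proof.
move=> a0 ab; have n0 := slope_gt0; have n1 := slope_ge1.
set nn := normc slope in n0 n1 *.
have aa0 : 0 < Num.min 1 a by rewrite lt_min ltr01.
pose A := 3 * nn / Num.min 1 a; pose Z := b * nn.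
have b0 := lt_le_trans a0 ab.
have A0 : 0 <= A by rewrite divr_ge0 ?mulr_ge0// ltW.
have Z0 : 0 <= Z by rewrite mulr_ge0 ?ltW.
have hA x z : a <= x <= b -> 0 < Re z -> normc (rpt x + z)^-1 <= A / (1 + normc z).
  move=> /andP[ax xb] z0; have x0 := lt_le_trans a0 ax.
  have xr : 0 < Re (rpt x) by rewrite Re_rpt.
  have := halfplane_addP xr z0; rewrite Re_rpt (normc_rpt (ltW x0)) -/nn.
  have p0 : 0 < normc (rpt x + z) by rewrite normc_gt0 addz_neq0.
  rewrite -mulrA -mulrA mulrCA ler_pM2l// => H.
  have zn := normc_ge0 z; have p1 : 0 < 1 + normc z by rewrite ltr_pwDl.
  rewrite normcV ler_pdivlMr// mulrC ler_pdivrMr// /A mulrAC ler_pdivlMr// -mulrA.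
  apply: le_trans _ H; rewrite mulrDl mul1r; apply: lerD.
    rewrite ge_min; apply/orP; right; apply: le_trans ax _; rewrite ler_peMr// ltW//.
  by rewrite ler_piMr// ge_min lexx.
(* One summand for each factor of the kernel that is varied in [prod3B], the other two being bounded
   by powers of [Z] and [A]. *)
pose L := m.+1%:R * Z ^+ m * nn * A ^+ m * A ^+ m.+2 + Z ^+ m.+1 * (m%:R * A ^+ m.-1 * (nn * A ^+ 2)) * A ^+ m.+2
   + Z ^+ m.+1 * A ^+ m * (m.+2%:R * A ^+ m.+1 * (nn * A ^+ 2)).
have pA k : 0 <= A ^+ k by exact: exprn_ge0.
have pZ k : 0 <= Z ^+ k by exact: exprn_ge0.
have pn := ltW n0.
exists L.
  by repeat first [exact: pA|exact: pZ|exact: pn|exact: ler0n|apply: addr_ge0|apply: mulr_ge0].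
move=> x y z hx hy z0.
have x0 : 0 < x by case/andP: hx => /(lt_le_trans a0).
have y0 : 0 < y by case/andP: hy => /(lt_le_trans a0).
pose u := (rpt x + z)^-1; pose v := (rpt y + z)^-1.
(* Pairing each z with one factor (w + z)^-1 gives a bounded quotient; the m + 2 factors left over
   carry the decay. *)
have kerE w : ker w z = w ^+ m.+1 * ((z * (w + z)^-1) ^+ m * (w + z)^-1 ^+ m.+2).
  by rewrite /ker exprMn -addn2 -[m.+2]addn2 !exprD; ring.
rewrite !kerE -/u -/v prod3B.
have zn := normc_ge0 z; have p1 : 0 < 1 + normc z by rewrite ltr_pwDl.
have d0 : 0 <= normc (decay2 z) by exact: normc_ge0.
have d1 : normc (decay2 z) = (1 + normc z)^-1 ^+ 2 by exact: normc_decay2.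
have uA := hA x z hx z0; have vA := hA y z hy z0; rewrite -/u -/v in uA vA.
have zA w : normc w <= A / (1 + normc z) -> normc (z * w) <= A.
  rewrite normcM => h; apply: le_trans (ler_wpM2l zn h) _.
  by rewrite mulrCA ler_piMr// ler_pdivrMr// mul1r lerDr.
have A1 : A / (1 + normc z) <= A by rewrite ler_piMr// invf_le1// lerDl.
have hp (w : R) k : a <= w <= b -> normc (rpt w ^+ k) <= Z ^+ k.
  move=> /andP[aw wb]; have w0 : 0 <= w by exact: ltW (lt_le_trans a0 aw).
  by rewrite normcX lerXn2r ?nnegrE ?normc_ge0// (normc_rpt w0) ler_wpM2r// ltW.
have dr : normc (rpt x - rpt y) = nn * `|x - y|.
  by rewrite /rpt -mulrBl -rmorphB normcM normc_real mulrC.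
have duv : normc (u - v) <= nn * A ^+ 2 * `|x - y| * normc (decay2 z).
  have e1 : u - v = (rpt y - rpt x) * (u * v).
    have xr : 0 < Re (rpt x) by rewrite Re_rpt.
    have yr : 0 < Re (rpt y) by rewrite Re_rpt.
    have := addz_neq0 xr z0; have := addz_neq0 yr z0; rewrite /u /v.
    move: (rpt x) (rpt y) => X Y h1 h2; field; by rewrite h1 h2.
  rewrite e1 normcM normc_distC dr normcM d1.
  rewrite (_ : nn * A ^+ 2 * `|x - y| * (1 + normc z)^-1 ^+ 2 = nn * `|x - y| * ((A / (1 + normc z)) * (A / (1 + normc z)))); last by ring.
  by rewrite ler_wpM2l ?mulr_ge0 ?(ltW n0)// ler_pM ?normc_ge0.
have dzuv : normc (z * u - z * v) <= nn * A ^+ 2 * `|x - y|.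
  have zD : normc z * (1 + normc z)^-1 ^+ 2 <= 1.
    by rewrite exprVn ler_pdivrMr ?exprn_gt0// mul1r; nra.
  rewrite -mulrBr normcM; apply: le_trans (ler_wpM2l zn duv) _.
  rewrite d1 mulrCA; apply: ler_piMr zD; apply: mulr_ge0 => //; exact: mulr_ge0.
have q1 (w : C) : normc w <= A / (1 + normc z) -> normc (w ^+ m.+2) <= A ^+ m.+2 * normc (decay2 z).
  by move=> h; rewrite normcX; apply: decay2_bound => //; exact: normc_ge0.
have Q1 (w : C) : normc w <= A / (1 + normc z) -> normc ((z * w) ^+ m) <= A ^+ m.
  by move=> h; rewrite normcX lerXn2r ?nnegrE ?normc_ge0// zA.
have dP : normc (rpt x ^+ m.+1 - rpt y ^+ m.+1) <= m.+1%:R * Z ^+ m * (nn * `|x - y|).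
  rewrite -dr; apply: normc_expB.
    by have := hp x 1%N hx; rewrite !expr1.
  by have := hp y 1%N hy; rewrite !expr1.
have dQ : normc ((z * u) ^+ m - (z * v) ^+ m) <= m%:R * A ^+ m.-1 * (nn * A ^+ 2 * `|x - y|).
  case: (m) => [|k]; first by rewrite !expr0 subrr ComplexField.Normc.normc0 !mul0r.
  apply: le_trans (normc_expB _ (zA _ uA) (zA _ vA)) _.
  by rewrite ler_wpM2l// mulr_ge0// exprn_ge0.
have dW : normc (u ^+ m.+2 - v ^+ m.+2) <= m.+2%:R * A ^+ m.+1 * (nn * A ^+ 2 * `|x - y| * normc (decay2 z)).
  apply: le_trans (normc_expB _ (le_trans uA A1) (le_trans vA A1)) _.
  by rewrite ler_wpM2l// mulr_ge0// exprn_ge0.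
apply: le_trans (normcD _ _) _; apply: le_trans (lerD (normcD _ _) (lexx _)) _.
rewrite ![normc (_ * _ * _)]normcM ![normc ((_ - _) * _)]normcM ![normc (_ * (_ - _))]normcM.
have b1 := ler_pM (mulr_ge0 (normc_ge0 _) (normc_ge0 _)) (normc_ge0 _) (ler_pM (normc_ge0 _) (normc_ge0 _) dP (Q1 u uA)) (q1 u uA).
have b2 := ler_pM (mulr_ge0 (normc_ge0 _) (normc_ge0 _)) (normc_ge0 _) (ler_pM (normc_ge0 _) (normc_ge0 _) (hp y m.+1 hy) dQ) (q1 u uA).
have b3 := ler_pM (mulr_ge0 (normc_ge0 _) (normc_ge0 _)) (normc_ge0 _) (ler_pM (normc_ge0 _) (normc_ge0 _) (hp y m.+1 hy) (Q1 v vA)) dW.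
rewrite [normc (rpt y ^+ m.+1 * (z * v) ^+ m)]normcM.
apply: le_trans (lerD (lerD b1 b2) b3) _.
rewrite /L le_eqVlt; apply/orP; left; apply/eqP.
move: (A ^+ m.+2) (A ^+ m.+1) (A ^+ m) (A ^+ m.-1) (Z ^+ m) (Z ^+ m.+1) (m.+1%:R) (m.+2%:R) (m%:R) (normc (decay2 z)) `|x - y|.
move=> *; ring.
Qed.

End KernelEstimates.

(** * What a small mass on the source half-line contributes to the norm *)

Section TailNorm.
Variable R : realType.
Local Notation C := (R[i])^o.
Local Notation mu := (@lebesgue_measure R).
Implicit Types (g : C -> C) (phi : R -> R) (x r c B e : R).

(** Written with [powR] so that joint measurability follows from [measurable_powR]; [qkerE] gives
    the fraction of [ker_bound]. *)
Definition qker x r : R := x * (x + r) `^ (- 2).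

Lemma qkerE x r : 0 < x + r -> qker x r = x / (x + r) ^+ 2.
Proof. by move=> h; rewrite /qker powRN (@powR_mulrn _ _ 2) ?ltW. Qed.

(** Up to the constant of [ker_bound], the largest value that a mass density [phi] on the source
    half-line can produce at |z| = r. *)
Definition tailV phi r : \bar R := (\int[mu]_x (phi x * qker x r)%:E)%E.

Section Phi.
Variable phi : R -> R.
Hypothesis mphi : measurable_fun setT phi.
Hypothesis phi0 : forall x, 0 <= phi x.
Hypothesis phiN : forall x, x <= 0 -> phi x = 0.

Lemma phi_qker_ge0 x r : 0 <= phi x * qker x r.
Proof.
have [x0|x0] := ltP 0 x; last by rewrite phiN// mul0r.
by rewrite mulr_ge0// mulr_ge0 ?(ltW x0)// powR_ge0.
Qed.

(** From x / (x + r)^2 <= 1 / r. It gives pointwise convergence at fixed z, hence the measurability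
    of the averages. *)
Lemma tailV_le r : 0 < r -> (tailV phi r <= (r^-1)%:E * \int[mu]_x (phi x)%:E)%E.
Proof.
move=> r0; rewrite -ge0_integralZl//; last 3 first.
- exact/measurable_EFinP.
- by move=> x _; rewrite lee_fin.
- by rewrite lee_fin invr_ge0 ltW.
apply: ge0_le_integral => //.
- by move=> x _; rewrite lee_fin phi_qker_ge0.
- apply/measurable_EFinP; apply: measurable_funM => //.
  apply: measurable_funM; first exact: measurable_id.
  apply: (measurableT_comp (measurable_powR (- 2))).
  by apply: measurable_funD; [exact: measurable_id|exact: measurable_cst].
- by apply: emeasurable_funM; [exact: measurable_cst|exact/measurable_EFinP].
- move=> x _; rewrite -EFinM lee_fin mulrC.
  have [x0|x0] := ltP 0 x; last by rewrite phiN// !mulr0.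
  rewrite ler_wpM2r// qkerE ?addr_gt0//.
  rewrite ler_pdivrMr ?exprn_gt0 ?addr_gt0// mulrC ler_pdivlMr//; nra.
Qed.

Lemma measurable_tail_kernel c : measurable_fun setT
  (fun p : R * R => if 0 < p.1 then phi p.2 * qker p.2 (p.1 * c) else 0).
Proof.
apply: measurable_fun_ifT.
- by apply: measurable_fun_ltr; [exact: measurable_cst|exact: measurable_fst].
- apply: measurable_funM.
    exact: (measurableT_comp mphi (measurable_snd (T1 := R))).
  apply: measurable_funM; first exact: measurable_snd.
  apply: (measurableT_comp (measurable_powR (- 2))).
  apply: measurable_funD; first exact: measurable_snd.
  by apply: measurable_funM; [exact: measurable_fst|exact: measurable_cst].
- exact: measurable_cst.
Qed.

Let tk c (p : R * R) : \bar R := (if 0 < p.1 then phi p.2 * qker p.2 (p.1 * c) else 0)%:E.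

Let mtk c : measurable_fun setT (tk c).
Proof. by apply/measurable_EFinP; exact: measurable_tail_kernel. Qed.

Let tk0 c p : (0 <= tk c p)%E.
Proof. by rewrite lee_fin; case: ifP => // _; exact: phi_qker_ge0. Qed.

Let tailVE c a : (\int[mu]_x tk c (a, x) = if (0 < a)%R then tailV phi (a * c)%R else 0)%E.
Proof. by rewrite /tk/=; case: ifP => // _; rewrite integral0. Qed.

Lemma measurable_tailV c : measurable_fun setT (fun a : R => if 0 < a then tailV phi (a * c) else 0%E).
Proof.
have := @measurable_fun_fubini_tonelli_F _ _ _ _ _ mu _ (mtk c) (tk0 c).
by congr measurable_fun; apply/funext => a; rewrite -tailVE.
Qed.

(** Tonelli reduces to a source point x, and [integral_inv_sqr] gives the same value 1 / c for every
    x. *)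
Lemma tailV_ray c : 0 < c -> (\int[mu]_a (if (0 < a)%R then tailV phi (a * c)%R else 0) =
  (c^-1)%:E * \int[mu]_x (phi x)%:E)%E.
Proof.
move=> c0; under eq_integral do rewrite -tailVE.
rewrite (@fubini_tonelli _ _ _ _ _ mu mu (tk c) (mtk c) (tk0 c)).
rewrite -ge0_integralZl//; last 3 first.
- exact/measurable_EFinP.
- by move=> x _; rewrite lee_fin.
- by rewrite lee_fin invr_ge0 ltW.
apply: eq_integral => x _; rewrite /tk/=.
have [x0|x0] := ltP 0 x; last first.
  rewrite phiN// mule0 integral0_eq// => a _.
  by case: ifP => // _; rewrite mul0r.
transitivity (\int[mu]_a ((phi x)%:E * (if (0 < a)%R then qker x (a * c) else 0%R)%:E))%E.
  by apply: eq_integral => a _; case: ifP => _; rewrite -EFinM ?mulr0.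
rewrite ge0_integralZl//.
- rewrite muleC -(integral_inv_sqr x0 c0); congr (_ * _)%E.
  apply: integral_ray_patch => a a0; last by rewrite ltNge a0.
  by rewrite a0 qkerE// addr_gt0// mulr_gt0.
- apply/measurable_EFinP; apply: measurable_fun_ifT.
  + by apply: measurable_fun_ltr; [exact: measurable_cst|exact: measurable_id].
  + apply: measurable_funM; first exact: measurable_cst.
    apply: (measurableT_comp (measurable_powR (- 2))).
    apply: measurable_funD; first exact: measurable_cst.
    by apply: measurable_funM; [exact: measurable_id|exact: measurable_cst].
  + exact: measurable_cst.
- move=> a _; rewrite lee_fin; case: ifP => // _.
  by rewrite mulr_ge0 ?(ltW x0)// powR_ge0.
- by rewrite lee_fin.
Qed.

(** With c = sqrt(1 + t^2), both [decay2] and the tail of unit mass integrate to 1 / c on the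
    half-line of slope t, so the seminorm sees a tail of mass [I] as [I] times [decay2]. *)
Lemma ray_norm_tail s g B e I : hmeas g -> 0 <= B -> 0 <= e -> 0 <= I ->
  (\int[mu]_x (phi x)%:E <= I%:E)%E ->
  (forall z, 0 < Re z ->
    ((normc (g z))%:E <= B%:E * tailV phi (normc z) + (e * normc (decay2 z))%:E)%E) ->
  (ray_norm s g <= (B * I + e)%:E * ray_norm s (@decay2 R))%E.
Proof.
move=> mg B0 e0 I0 phiI H; rewrite -ge0_integralZl//; last 3 first.
- by apply: measurable_weighted; exact: hmeas_decay2.
- by move=> t _; exact: weighted_ge0.
- by rewrite lee_fin addr_ge0// mulr_ge0.
apply: ge0_le_integral => //.
- by move=> t _; exact: weighted_ge0.
- exact: measurable_weighted.
- apply: emeasurable_funM; first exact: measurable_cst.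
  by apply: measurable_weighted; exact: hmeas_decay2.
move=> t _; rewrite muleCA lee_wpmul2l ?lee_fin ?slope_weight_ge0//.
set c := Num.sqrt (1 + t ^+ 2); have c0 : 0 < c by exact: sqrt_slope_gt0.
have -> : ((B * I + e)%:E * ray_int (@decay2 R) t = B%:E * ((c^-1)%:E * I%:E) + e%:E * ray_int (@decay2 R) t)%E.
  by rewrite ray_int_decay2 -/c -!EFinM -EFinD; congr EFin; ring.
apply: (@le_trans _ _ (B%:E * (\int[mu]_a (if (0 < a)%R then tailV phi (a * c)%R else 0)) +
    e%:E * ray_int (@decay2 R) t)%E); last first.
  rewrite leeD2r// lee_wpmul2l ?lee_fin// tailV_ray// lee_wpmul2l// lee_fin invr_ge0 ltW//.
have V0 a : (0 <= if (0 < a)%R then tailV phi (a * c)%R else 0)%E.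
  by case: ifP => // _; apply: integral_ge0 => x _; rewrite lee_fin phi_qker_ge0.
have mV := measurable_tailV c.
have md := measurable_ray_slice t (@hmeas_decay2 R).
rewrite -ge0_integralZl// -[X in (_ <= _ + X)%E]ge0_integralZl//; last first.
  by move=> a _; rewrite lee_fin ray_ge0.
rewrite -ge0_integralD//; last 4 first.
- by move=> a _; rewrite mule_ge0.
- by apply: emeasurable_funM => //; exact: measurable_cst.
- by move=> a _; rewrite mule_ge0// lee_fin ray_ge0.
- by apply: emeasurable_funM => //; exact: measurable_cst.
apply: ge0_le_integral => //.
- by move=> a _; rewrite lee_fin ray_ge0.
- exact: measurable_ray_slice.
- by apply: emeasurable_funD; apply: emeasurable_funM => //; exact: measurable_cst.
move=> a _; rewrite !rayE; case: ifPn => a0; last by rewrite !mule0 adde0.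
apply: le_trans (H (a +i* (a * t)) a0) _.
by rewrite (normc_ray t (ltW a0)) -/c -EFinM.
Qed.

End Phi.

End TailNorm.

Lemma near_le_natS (R : realType) (y : R) : 0 <= y -> \forall n \near \oo, y <= n.+1%:R.
Proof.
move=> y0; exists (Num.bound y) => // k /= hk.
apply: le_trans (ltW (archi_boundP y0)) _; rewrite ler_nat; exact: leq_trans hk _.
Qed.

(** * The average over a fixed half-line is approximable *)

Section RayOperator.
Variable R : realType.
Local Notation C := (R[i])^o.
Local Notation mu := (@lebesgue_measure R).
Local Notation Rpos := (`]0%R, +oo[%classic : set R).
Variables (s : R) (m : nat) (t0 : R) (F : R -> C).
Hypothesis hs : -1 < s.
Hypothesis cF : forall x : R, 0 < x -> {for x, continuous F}.
Hypothesis iF : cintegrable mu Rpos F.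
Implicit Types (z w zeta u v : C) (x y a b e : R).

Local Notation p := (rpt t0).
Let G z x : C := F x * ker m (p x) z.

Definition ray_op z : C := cint mu Rpos (G z).

Lemma ker_holo_l z : 0 < Re z -> halfplane_holo (fun zeta => ker m zeta z).
Proof.
move=> hz; apply: halfplane_holoM; first exact: halfplane_holoX (@halfplane_holo_id R).
apply: halfplane_holoM; first exact: halfplane_holo_cst.
have rE : (fun zeta : C => (zeta + z)^-1) = (fun w : C => (z + w)^-1).
  by apply/funext => w; rewrite addrC.
have hr : halfplane_holo (fun zeta : C => (zeta + z)^-1) by rewrite rE; exact: resolvent_holo.
exact: halfplane_holoX hr.
Qed.

Lemma continuous_rpt x : {for x, continuous p}.
Proof. by apply: cvgM; [exact: cont_real|exact: cvg_cst]. Qed.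

Lemma continuous_G z x : 0 < Re z -> 0 < x -> {for x, continuous (G z)}.
Proof.
move=> hz x0; apply: cvgM; first exact: cF.
have xr : 0 < Re (p x) by rewrite Re_rpt.
exact: continuous_comp (@continuous_rpt x) (halfplane_holo_continuous (ker_holo_l hz) xr).
Qed.

Lemma cmeasurable_open (H : R -> C) : (forall x : R, 0 < x -> {for x, continuous H}) ->
  cmeasurable Rpos H.
Proof.
move=> cH; split; apply: open_continuous_measurable_fun; try exact: interval_open;
  move=> x; rewrite inE/= in_itv/= andbT => /cH Hx.
  exact: continuous_comp Hx (@continuous_Re R _).
exact: continuous_comp Hx (@continuous_Im R _).
Qed.

Lemma integrable_G z : 0 < Re z -> cintegrable mu Rpos (G z).
Proof.
move=> hz; have [B B0 HB] := ker_bound m t0.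
have nz : 0 < normc z by rewrite normc_gt0; apply: contraTneq hz => ->; rewrite ltxx.
have mG : cmeasurable Rpos (G z) by apply: cmeasurable_open => x; exact: continuous_G.
apply/cintegrableP => //.
have iN : mu.-integrable Rpos (EFin \o (fun x => normc (F x))) by exact: cintegrable_normc.
have iZ : mu.-integrable Rpos (fun x => ((B / normc z)%:E * (EFin \o (fun x => normc (F x))) x)%E).
  exact: integrableZl.
apply: le_integrable iZ => //; first exact/measurable_EFinP/cmeasurable_normc.
move=> x /=; rewrite in_itv/= andbT => x0; rewrite lee_fin.
rewrite ger0_norm ?normc_ge0// ger0_norm; last by rewrite mulr_ge0 ?normc_ge0 ?divr_ge0 ?normc_ge0.
rewrite /G normcM mulrC ler_wpM2r ?normc_ge0//; apply: le_trans (HB x z x0 hz) _.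
rewrite ler_wpM2l// ler_pdivrMr ?exprn_gt0 ?addr_gt0// mulrC ler_pdivlMr//; nra.
Qed.

(** Only the kernel is discretised: the weights are exact integrals of [F], so the error on each
    cell is sup |F| times the variation of the kernel, and [ker_lipschitz] bounds the total by M L h
    (b - a) [decay2]. *)
Lemma riemann_approximable a b e : 0 < a -> a <= b -> 0 < e ->
  exists2 S, approximable s S & forall z, 0 < Re z ->
    normc (cint mu `[a, b] (G z) - S z) <= e * normc (decay2 z).
Proof.
move=> a0 ab e0; have [L L0 HL] := ker_lipschitz m t0 a0 ab.
have ci : {within `[a, b], continuous (fun x => normc (F x))}.
  apply: continuous_in_subspaceT => x; rewrite inE/= in_itv/= => /andP[/(lt_le_trans a0) x0 _].
  exact: continuous_comp (cF x0) (@continuous_normc R _).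
have [xm _ HM] := EVT_max ab ci; pose M := normc (F xm).
have M0 : 0 <= M by exact: normc_ge0.
have FM x : a <= x <= b -> normc (F x) <= M by move=> xab; apply: HM; rewrite in_itv.
have [n hn] : exists n : nat, M * L * (b - a) * (b - a) / n.+1%:R <= e.
  exists (Num.bound (M * L * (b - a) * (b - a) / e)).
  have K0 : 0 <= M * L * (b - a) * (b - a) by rewrite !mulr_ge0// subr_ge0.
  rewrite ler_pdivrMr// [leRHS]mulrC -ler_pdivrMr//.
  apply: le_trans (ltW (archi_boundP (divr_ge0 K0 (ltW e0)))) _.
  by rewrite ler_nat.
pose h := (b - a) / n.+1%:R; pose x_ (k : nat) := a + k%:R * h.
have h0 : 0 <= h by rewrite divr_ge0// subr_ge0.
have xS k : x_ k.+1 = x_ k + h by rewrite /x_ -natr1; ring.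
have x0 : x_ 0%N = a by rewrite /x_ mul0r addr0.
have xn : x_ n.+1 = b by rewrite /x_ /h mulrCA divff ?pnatr_eq0// mulr1 addrC subrK.
have xa k : a <= x_ k by rewrite lerDl mulr_ge0.
have xle k : x_ k <= x_ k.+1 by rewrite xS lerDl.
have xb k : (k <= n.+1)%N -> x_ k <= b.
  by move=> kn; rewrite -xn /x_ lerD2l ler_wpM2r// ler_nat.
pose c k := cint mu `[x_ k, x_ k.+1] F.
exists (fun z => \sum_(k < n.+1) c k * ker m (p (x_ k)) z).
  apply: approximable_sum => k; apply: approximableZ; apply: approximableZ.
  by apply: approximable_pole => //; rewrite Re_rpt (lt_le_trans a0).
move=> z hz; set d2 := normc (decay2 z).
have d0 : 0 <= d2 by exact: normc_ge0.
have cG : ccont a b (G z) by move=> x /andP[/(lt_le_trans a0) xp _]; exact: continuous_G.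
have cFab : ccont a b F by move=> x /andP[/(lt_le_trans a0) xp _]; exact: cF.
(* Induction over the cells; the bound is linear in the length already covered. *)
have key k : (k <= n.+1)%N -> normc (cint mu `[a, x_ k] (G z) -
    \sum_(j < k) c j * ker m (p (x_ j)) z) <= M * L * h * d2 * (x_ k - a).
  elim: k => [|k ih] kn.
    rewrite big_ord0 x0 subrr mulr0 subr0 set_itv1 /cint !Rintegral_set1.
    by rewrite (_ : 0 +i* 0 = 0)// ComplexField.Normc.normc0.
  have kb := xb _ kn; have kb' := xb _ (ltnW kn).
  have cG' : ccont a (x_ k.+1) (G z) by exact: ccont_sub cG.
  have cGk : ccont (x_ k) (x_ k.+1) (G z) by exact: ccont_sub cG.
  have cFk : ccont (x_ k) (x_ k.+1) F by exact: ccont_sub cFab.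
  have cFk' : ccont (x_ k) (x_ k.+1) (fun x => ker m (p (x_ k)) z * F x).
    by move=> x hx; apply: cvgM; [exact: cvg_cst|exact: cFk].
  have hk : a <= x_ k <= x_ k.+1 by rewrite xa xle.
  rewrite (cint_itv_split hk cG').
  rewrite big_ord_recr/= opprD addrACA; apply: le_trans (normcD _ _) _.
  rewrite (_ : x_ k.+1 - a = (x_ k - a) + (x_ k.+1 - x_ k)); last by ring.
  rewrite mulrDr; apply: lerD; first exact: ih (ltnW kn).
  have -> : c k * ker m (p (x_ k)) z = cint mu `[x_ k, x_ k.+1] (fun x => ker m (p (x_ k)) z * F x).
    by rewrite (cintZ _ _ (ccont_cintegrable cFk))// mulrC.
  rewrite -(cintB _ (ccont_cintegrable cGk) (ccont_cintegrable cFk'))//.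
  have cd : ccont (x_ k) (x_ k.+1) (fun x => G z x - ker m (p (x_ k)) z * F x).
    by move=> x hx; apply: cvgB; [exact: cGk|exact: cFk'].
  apply: (cint_itv_bound (xle k) cd).
  move=> x hx; have /andP[h1 h2] := hx.
  have xab : a <= x <= b by rewrite (le_trans (xa k) h1) (le_trans h2 kb).
  have xkab : a <= x_ k <= b by rewrite xa.
  rewrite /G mulrC -mulrBl normcM mulrC.
  rewrite (_ : M * L * h * d2 = M * (L * h * d2)); last by ring.
  apply: ler_pM; rewrite ?normc_ge0//; first exact: FM.
  apply: le_trans (HL x (x_ k) z xab xkab hz) _.
  rewrite ler_wpM2r// ler_wpM2l// ger0_norm ?subr_ge0//.
  by rewrite lerBlDl; rewrite xS in h2.
have := key n.+1 (leqnn _); rewrite xn => K; apply: le_trans K _.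
rewrite mulrAC ler_wpM2r//; apply: le_trans hn.
by rewrite /h le_eqVlt; apply/orP; left; apply/eqP; ring.
Qed.

(** Compact pieces exhausting the half-line; [phi n] is |F| off the n-th piece, and its mass tends
    to 0 by dominated convergence. *)
Let Fab (n : nat) : set R := `[n.+1%:R^-1, n.+1%:R]%classic.
Let Dn (n : nat) : set R := Rpos `\` Fab n.
Let phi (n : nat) : R -> R := (fun x => normc (F x)) \_ (Dn n).

Let mDn n : measurable (Dn n).
Proof. by apply: measurableD; exact: measurable_itv. Qed.

Let Dn_sub n : Dn n `<=` Rpos.
Proof. by move=> x []. Qed.

Let mF : measurable_fun Rpos (fun x => normc (F x)).
Proof. exact: cmeasurable_normc (cmeasurable_open cF). Qed.

Let mphi n : measurable_fun setT (phi n).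
Proof.
have h : measurable_fun (Dn n) (fun x => normc (F x)).
  refine (measurable_funS _ _ mF); [exact: measurable_itv|exact: Dn_sub].
exact: (measurable_restrictT _ (mDn n)).1 h.
Qed.

Let phi0 n x : 0 <= phi n x.
Proof. by rewrite /phi patchE; case: ifP => // _; exact: normc_ge0. Qed.

Let phiN n x : x <= 0 -> phi n x = 0.
Proof.
move=> x0; rewrite /phi patchE; case: ifPn => //; rewrite inE => -[]/=.
by rewrite in_itv/= andbT ltNge x0.
Qed.

Let phi_cvg : (fun n => \int[mu]_x (phi n x)%:E)%E @ \oo --> 0%E.
Proof.
pose g : R -> \bar R := (fun x => (normc (F x))%:E) \_ Rpos.
have ig : mu.-integrable setT g.
  rewrite -integrable_mkcond//.
  exact: cintegrable_normc.
have := @dominated_convergence _ _ _ mu setT measurableT (fun n x => (phi n x)%:E) (cst 0%E) g.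
case.
- by move=> n; apply/measurable_EFinP; exact: mphi.
- exact: measurable_cst.
- apply: aeW => x _; apply: cvg_near_cst.
  have [x0|x0] := leP x 0; first by near=> n; rewrite phiN.
  near=> n; rewrite /phi patchE ifF//; apply/negbTE; rewrite notin_setE => -[_]; apply.
  rewrite /Fab/= in_itv/=; apply/andP; split.
    rewrite -[leRHS]invrK lef_pV2 ?posrE ?invr_gt0//.
    by near: n; apply: near_le_natS; rewrite invr_ge0 ltW.
  by near: n; apply: near_le_natS; rewrite ltW.
- exact: ig.
- apply: aeW => x n _; rewrite gee0_abs ?lee_fin//.
  rewrite /g patchE /phi patchE; case: ifPn; case: ifPn => //.
  + by move=> h1; rewrite inE => /Dn_sub h2; move: h1; rewrite notin_setE.
  + by move=> _ _; rewrite lee_fin normc_ge0.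
by move=> _ _; rewrite integral0.
Unshelve. all: by end_near. Qed.


Lemma cint_setU (A B : set R) (H : R -> C) : measurable A -> measurable B ->
  cintegrable mu (A `|` B) H -> [disjoint A & B] ->
  cint mu (A `|` B) H = cint mu A H + cint mu B H.
Proof.
move=> mA mB [Hr Hi] AB; rewrite /cint [RHS]/GRing.add/=.
by congr (_ +i* _); exact: Rintegral_setU.
Qed.

Let ray_op_tail n z B : 0 < Re z -> 0 <= B ->
  (forall x z, 0 < x -> 0 < Re z -> normc (ker m (p x) z) <= B * (x / (x + normc z) ^+ 2)) ->
  ((normc (ray_op z - cint mu (Fab n) (G z)))%:E <= B%:E * tailV (phi n) (normc z))%E.
Proof.
move=> hz B0 HB; have iG := integrable_G hz.
have FabR : Fab n `<=` Rpos.
  move=> x; rewrite /Fab/= !in_itv/= andbT => /andP[h _]; apply: lt_le_trans h.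
  by rewrite invr_gt0.
have mFab : measurable (Fab n) by exact: measurable_itv.
have -> : ray_op z - cint mu (Fab n) (G z) = cint mu (Dn n) (G z).
  have hU : Fab n `|` Dn n = Rpos by exact: setDUK.
  have h := @cint_setU (Fab n) (Dn n) (G z) mFab (mDn n).
  rewrite hU in h; rewrite /ray_op h//; first by rewrite addrAC subrr add0r.
  by apply/disj_setPS => x [/= h1 [_ h2]].
have iD : cintegrable mu (Dn n) (G z).
  have [Gr Gi] := iG; split.
    by apply: (@integrableS _ _ _ mu Rpos (Dn n) _ _ _ (@Dn_sub n) Gr); [exact: measurable_itv|exact: mDn].
  by apply: (@integrableS _ _ _ mu Rpos (Dn n) _ _ _ (@Dn_sub n) Gi); [exact: measurable_itv|exact: mDn].
have iN : mu.-integrable (Dn n) (EFin \o (fun x => normc (G z x))).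
  by apply: cintegrable_normc iD; exact: mDn.
apply: (@le_trans _ _ (\int[mu]_(x in Dn n) (normc (G z x))%:E)%E).
  have fN : (\int[mu]_(x in Dn n) (normc (G z x))%:E)%E \is a fin_num.
    by apply: (@integrable_fin_num _ _ _ mu (Dn n)) iN; exact: mDn.
  rewrite -(fineK fN) lee_fin; apply: normc_cint_le iD; exact: mDn.
rewrite /tailV -ge0_integralZl//; last 2 first.
- apply/measurable_EFinP; apply: measurable_funM; first exact: mphi.
  apply: measurable_funM; first exact: measurable_id.
  apply: (measurableT_comp (measurable_powR (- 2))).
  by apply: measurable_funD; [exact: measurable_id|exact: measurable_cst].
- by move=> x _; rewrite lee_fin; apply: phi_qker_ge0; [exact: phi0|exact: phiN].
rewrite [leLHS]integral_mkcond; apply: ge0_le_integral => //.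
- by move=> x _; rewrite patchE; case: ifP => // _; rewrite lee_fin normc_ge0.
- have mG : measurable_fun Rpos (fun x => normc (G z x)).
    by apply: cmeasurable_normc; apply: cmeasurable_open => x; exact: continuous_G.
  have h : measurable_fun (Dn n) (fun x => normc (G z x)).
    refine (measurable_funS _ _ mG); [exact: measurable_itv|exact: Dn_sub].
  have h' : measurable_fun (Dn n) (fun x => (normc (G z x))%:E) by exact/measurable_EFinP.
  exact: (measurable_restrictT _ (mDn n)).1 h'.
- apply: emeasurable_funM; first exact: measurable_cst.
  apply/measurable_EFinP; apply: measurable_funM; first exact: mphi.
  apply: measurable_funM; first exact: measurable_id.
  apply: (measurableT_comp (measurable_powR (- 2))).
  by apply: measurable_funD; [exact: measurable_id|exact: measurable_cst].
- move=> x _; rewrite patchE; case: ifPn => [|_]; last first.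
    by rewrite mule_ge0// lee_fin; apply: phi_qker_ge0; [exact: phi0|exact: phiN].
  move=> xD; rewrite -EFinM lee_fin /phi patchE xD /G normcM mulrCA.
  have x0 : 0 < x by move: xD; rewrite inE => /Dn_sub/=; rewrite in_itv/= andbT.
  rewrite ler_wpM2l ?normc_ge0// qkerE ?ltr_pwDl ?normc_ge0//.
  exact: HB.
Qed.

(** The tail of [F] is controlled by its mass and the compact piece by a Riemann sum. [B] is chosen
    before [e], so the total error tends to 0 with [e], pointwise and in seminorm. *)
Lemma ray_op_approx : exists2 B, 0 <= B & forall e, 0 < e -> exists phi' : R -> R,
  [/\ measurable_fun setT phi', (forall x, 0 <= phi' x), (forall x, x <= 0 -> phi' x = 0),
    (\int[mu]_x (phi' x)%:E <= e%:E)%E &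
    exists2 S, approximable s S & forall z, 0 < Re z ->
     ((normc (ray_op z - S z)%R)%:E <= B%:E * tailV phi' (normc z) + (e * normc (decay2 z))%:E)%E].
Proof.
have [B B0 HB] := ker_bound m t0; exists B => // e e0.
have [n Hn] : exists n, (\int[mu]_x (phi n x)%:E <= e%:E)%E.
  have [fin /cvgrPdist_lt/(_ e e0) cv] := (fine_cvgP _ _).1 phi_cvg.
  have [n _ Hn] := filterI fin cv; exists n; have [f1 f2] := Hn n (leqnn n).
  rewrite -[leLHS]fineK// lee_fin; apply: ltW; apply: le_lt_trans f2.
  by rewrite sub0r normrN ler_norm.
exists (phi n); split; [exact: mphi|exact: phi0|exact: phiN|exact: Hn|].
have a0 : 0 < n.+1%:R^-1 :> R by rewrite invr_gt0.
have ab : n.+1%:R^-1 <= n.+1%:R :> R.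
  by apply: (@le_trans _ _ 1); rewrite ?invf_le1 ?ler1n.
have [S aS HS] := riemann_approximable a0 ab e0.
exists S => // z hz.
have -> : ray_op z - S z = (ray_op z - cint mu (Fab n) (G z)) + (cint mu (Fab n) (G z) - S z).
  by rewrite addrA subrK.
apply: (@le_trans _ _ ((normc (ray_op z - cint mu (Fab n) (G z)))%:E + (normc (cint mu (Fab n) (G z) - S z))%:E)%E).
  by rewrite -EFinD lee_fin normcD.
by apply: leeD; [exact: ray_op_tail|rewrite lee_fin; exact: HS].
Qed.

(** Measurability in the parameter z is obtained without a joint argument: the average is a
    pointwise limit of approximable functions, with error O(1 / (n + 1)) at each z. *)
Lemma hmeas_ray_op : hmeas ray_op.
Proof.
have [B B0 H] := ray_op_approx.
have e0 n : 0 < n.+1%:R^-1 :> R by rewrite invr_gt0.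
have H' n : exists S, approximable s S /\ forall z, 0 < Re z ->
    normc (ray_op z - S z) <= (B / normc z + normc (decay2 z)) * n.+1%:R^-1.
  have [phi' [mp p0 pN pI [S aS HS]]] := H _ (e0 n); exists S; split => // z hz.
  have nz : 0 < normc z by rewrite normc_gt0; apply: contraTneq hz => ->; rewrite ltxx.
  rewrite -lee_fin; apply: le_trans (HS z hz) _.
  rewrite mulrDl EFinD; apply: leeD; last by rewrite lee_fin mulrC.
  apply: (@le_trans _ _ (B%:E * ((normc z)^-1%:E * (n.+1%:R^-1)%:E))%E).
    rewrite lee_wpmul2l ?lee_fin//; apply: le_trans (tailV_le mp p0 pN nz) _.
    by rewrite lee_wpmul2l// lee_fin invr_ge0 ltW.
  by rewrite -!EFinM lee_fin mulrA.
pose S n := sval (cid (H' n)).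
have HS n : approximable s (S n) /\ forall z, 0 < Re z ->
    normc (ray_op z - S n z) <= (B / normc z + normc (decay2 z)) * n.+1%:R^-1.
  by rewrite /S; case: cid.
apply: (@hmeas_lim _ S) => [n|z hz]; first by have [[]] := HS n.
apply/ccvgP => e ee; pose K := B / normc z + normc (decay2 z).
have K0 : 0 <= K by rewrite addr_ge0 ?divr_ge0 ?normc_ge0.
have h0 : 0 <= (K + 1) / e by rewrite divr_ge0 ?(ltW ee)// addr_ge0.
near=> n; rewrite normc_distC; apply: le_lt_trans ((HS n).2 z hz) _; rewrite -/K.
rewrite ltr_pdivrMr//.
have : (K + 1) / e <= n.+1%:R by near: n; exact: near_le_natS.
rewrite ler_pdivrMr// => h; rewrite mulrC; apply: lt_le_trans h; by rewrite ltrDl.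
Unshelve. all: by end_near. Qed.

Lemma approximable_ray_op : approximable s ray_op.
Proof.
have [B B0 H] := ray_op_approx; apply: approximable_closed; first exact: hmeas_ray_op.
move=> eps eps0.
have fin := ray_norm_decay2 hs; have nd0 := ray_norm_ge0 s (@decay2 R).
have [N N0 HN] : exists2 N : R, 0 <= N & ray_norm s (@decay2 R) = N%:E.
  exists (fine (ray_norm s (@decay2 R))); first exact: fine_ge0.
  by rewrite fineK// ge0_fin_numE.
have BN0 : 0 <= (B + 1) * N by rewrite mulr_ge0// addr_ge0.
have K1 : 0 < (B + 1) * N + 1 by rewrite ltr_wpDl.
have e0 : 0 < eps / ((B + 1) * N + 1) by exact: divr_gt0.
have [phi' [mp p0 pN pI [S aS HS]]] := H _ e0; exists S => //.
have mg : hmeas (fun z => ray_op z - S z) by apply: hmeasB hmeas_ray_op _; case: aS.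
apply: le_lt_trans (ray_norm_tail mp p0 pN s mg B0 (ltW e0) (ltW e0) pI HS) _.
rewrite HN -EFinM lte_fin.
set d := eps / _; rewrite (_ : _ * N = ((B + 1) * N) * d); last by ring.
by rewrite /d mulrCA gtr_pMr// ltr_pdivrMr// mul1r ltrDl.
Qed.

End RayOperator.

(** * Rotation of the half-line *)

Section Rotation.
Variable R : realType.
Local Notation C := (R[i])^o.
Local Notation mu := (@lebesgue_measure R).
Local Notation Rpos := (`]0%R, +oo[%classic : set R).
Implicit Types (z w zeta u v : C) (x y a b c d e t : R).

(** The sets are not nested, only eventually contain each point: the end points produced by
    [good_slice] have no monotonicity. *)
Lemma cint_exhaust (H : R -> C) (A : nat -> set R) : cintegrable mu Rpos H ->
  (forall n, measurable (A n)) -> (forall n, A n `<=` Rpos) ->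
  (forall x, 0 < x -> \forall n \near \oo, A n x) ->
  (fun n => cint mu (A n) H) @ \oo --> cint mu Rpos H.
Proof.
move=> [Hr Hi] mA AR nA.
have key (h : R -> R) : mu.-integrable Rpos (EFin \o h) ->
    (fun n => \int[mu]_(x in A n) h x) @ \oo --> \int[mu]_(x in Rpos) h x.
  move=> ih; have mh : measurable_fun Rpos h by apply/measurable_EFinP; case/integrableP: ih.
  have mR : measurable Rpos by exact: measurable_itv.
  pose hn n x : \bar R := ((EFin \o h) \_ (A n)) x.
  have mhn n : measurable_fun Rpos (hn n).
    have mAh : measurable_fun (A n) (EFin \o h).
      by apply/measurable_EFinP; exact: measurable_funS mR (AR n) mh.
    exact: measurable_funTS ((measurable_restrictT _ (mA n)).1 mAh).
  have mE : measurable_fun Rpos (EFin \o h) by exact/measurable_EFinP.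
  have cvp : \forall x \ae mu, Rpos x -> hn ^~ x @ \oo --> (EFin \o h) x.
    apply: aeW => x; rewrite /= in_itv/= andbT => x0; apply: cvg_near_cst.
    near=> n; rewrite /hn patchE ifT// inE; near: n; exact: nA.
  have dom : \forall x \ae mu, forall n, Rpos x -> (`|hn n x| <= (abse \o (EFin \o h)) x)%E.
    apply: aeW => x n _; rewrite /hn patchE; case: ifP => //= _.
    by rewrite normr0 lee_fin normr_ge0.
  have [_ _] := @dominated_convergence _ _ _ mu Rpos mR hn (EFin \o h) (abse \o (EFin \o h)) mhn mE cvp (integrable_abse ih) dom.
  have <- : (fun n => (\int[mu]_(x in A n) (EFin \o h) x)%E) = (fun n => \int[mu]_(x in Rpos) hn n x)%E.
    apply/funext => n; rewrite /hn -integral_mkcondr; congr (integral _ _ _).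
    by apply/esym/setIidPr; exact: AR.
  have fR : (\int[mu]_(x in Rpos) (EFin \o h) x)%E \is a fin_num by exact: integrable_fin_num.
  by rewrite -(fineK fR) => /fine_cvg.
by apply: cvg_Complex; exact: key.
Unshelve. all: by end_near. Qed.

Variables (s : R) (m : nat) (g : C -> C).
Hypothesis hg : halfplane_holo g.
Hypothesis hN : (ray_norm s g < +oo)%E.

(** The factor [slope t] is d zeta / dx, so that [ray_op] applied to [rayF] is a contour integral of
    g ker. *)
Definition rayF t x : C := g (rpt t x) * slope t.

Lemma rptE t x : rpt t x = x +i* (x * t).
Proof. by rewrite /rpt /slope; apply/eqP; rewrite eq_complex/= !mul0r mulr1 subr0 addr0 !eqxx. Qed.

Let mg : hmeas g. Proof. exact: halfplane_holo_hmeas hg. Qed.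

Lemma continuous_ray t x : 0 < x -> {for x, continuous (fun x : R => g (rpt t x))}.
Proof.
move=> x0; have xr : 0 < Re (rpt t x) by rewrite Re_rpt.
exact: continuous_comp (@continuous_rpt R t x) (halfplane_holo_continuous hg xr).
Qed.

Lemma continuous_rayF t x : 0 < x -> {for x, continuous (rayF t)}.
Proof. by move=> x0; apply: cvgM; [exact: continuous_ray|exact: cvg_cst]. Qed.

Lemma rayF_integrable t : (ray_int g t < +oo)%E -> cintegrable mu Rpos (rayF t).
Proof.
move=> gt; have mF : cmeasurable Rpos (rayF t) by apply: cmeasurable_open => x; exact: continuous_rayF.
apply/cintegrableP => //.
apply/integrableP; split; first by apply/measurable_EFinP; exact: (cmeasurable_normc mF).
have -> : (\int[mu]_(x in Rpos) `|(EFin \o (fun t0 => normc (rayF t t0))) x| = ray_int (fun z => (slope t * g z)%R) t)%E.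
  apply/esym; rewrite /ray_int; under eq_integral do rewrite rayE.
  transitivity (\int[mu]_(x in Rpos) (normc (rayF t x))%:E)%E.
    apply: integral_ray_patch => x x0; last by rewrite ltNge x0.
    by rewrite x0 /rayF rptE mulrC.
  by apply: eq_integral => x _; rewrite gee0_abs// lee_fin normc_ge0.
by rewrite ray_intZ// lte_mul_pinfty// ?lee_fin ?normc_ge0.
Qed.

Lemma slab_finite c d : (\int[mu]_(t in `[c, d]) ray_int g t < +oo)%E.
Proof.
pose q := `|(s + 1) / 2|; pose X := `|c| + `|d|.
pose w := (1 + X ^+ 2) `^ (- q).
have X0 : 0 <= X by rewrite addr_ge0.
have p1 : 1 <= 1 + X ^+ 2 by rewrite lerDl sqr_ge0.
have w0 : 0 < w by rewrite powR_gt0// (lt_le_trans _ p1).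
have hw t : c <= t <= d -> w <= slope_weight s t.
  move=> /andP[ct td]; have tX : t ^+ 2 <= X ^+ 2.
    rewrite -[t ^+ 2]real_normK ?num_real// lerXn2r ?nnegrE// /X ler_norml.
    have := ler_norm (- c); have := ler_norm d; rewrite normrN.
    have := normr_ge0 c; have := normr_ge0 d; lra.
  have q0 : 0 <= q by exact: normr_ge0.
  have t1 : 1 <= 1 + t ^+ 2 by rewrite lerDl sqr_ge0.
  apply: (@le_trans _ _ ((1 + t ^+ 2) `^ (- q))).
    rewrite /w !powRN lef_pV2 ?posrE ?powR_gt0 ?(lt_le_trans _ p1) ?(lt_le_trans _ t1)//.
    by apply: ge0_ler_powR => //; rewrite ?nnegrE ?lerD2l//; [exact: le_trans t1|exact: le_trans p1].
  by apply: ler_powR => //; rewrite lerN2 ler_norm.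
have mi : measurable_fun setT (ray_int g) by exact: measurable_ray_int.
have mcd : measurable (`[c, d]%classic : set R) by exact: measurable_itv.
have H : (w%:E * \int[mu]_(t in `[c, d]) ray_int g t <= ray_norm s g)%E.
  have mi' : measurable_fun (`[c, d]%classic : set R) (ray_int g) by exact: measurable_funTS.
  have E : (\int[mu]_(t in `[c, d]) (w%:E * ray_int g t) = w%:E * \int[mu]_(t in `[c, d]) ray_int g t)%E.
    apply: ge0_integralZl; [exact: mcd|exact: mi'|by move=> t _; exact: ray_int_ge0|].
    by rewrite lee_fin ltW.
  rewrite -E.
  apply: (@le_trans _ _ (\int[mu]_(t in `[c, d]) ((slope_weight s t)%:E * ray_int g t))%E).
    apply: ge0_le_integral => //.
    - by move=> t _; rewrite mule_ge0 ?ray_int_ge0// lee_fin ltW.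
    - by apply: emeasurable_funM; [exact: measurable_cst|exact: measurable_funTS].
    - by apply: measurable_funTS; exact: measurable_weighted.
    - by move=> t; rewrite /= in_itv/= => /hw h; rewrite lee_wpmul2r ?ray_int_ge0// lee_fin.
  apply: ge0_subset_integral => //.
  - exact: measurable_weighted.
  - by move=> t _; exact: weighted_ge0.
rewrite ltey; apply/eqP => I; have := le_lt_trans H hN.
by rewrite I gt0_muley ?lte_fin// ltxx.
Qed.

End Rotation.

Section Slopes.
Variable R : realType.
Local Notation C := (R[i])^o.
Implicit Types (z w zeta u v : C) (x y a b c d e t : R).

Lemma slope_bound c d t : c <= t <= d -> normc (slope t) <= 1 + `|c| + `|d|.
Proof.
move=> /andP[ct td]; apply: le_trans (normc_le_ReIm _) _; rewrite /= normr1 -addrA lerD2l ler_norml.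
have := ler_norm (- c); have := ler_norm d; rewrite normrN.
have := normr_ge0 c; have := normr_ge0 d; lra.
Qed.

(** Here z is fixed and the slope of zeta moves in a bounded interval; |zeta + z| is bounded below
    by its real part x + Re z. *)
Lemma ker_bound_slab m c d z : 0 < Re z -> exists2 K, 0 <= K & forall x t, 0 < x -> c <= t <= d ->
  normc (ker m (rpt t x) z) <= K * (x / (x + Re z) ^+ 2).
Proof.
set a := Re z => a0; pose S := 1 + `|c| + `|d|.
have S0 : 0 <= S by rewrite !addr_ge0.
exists (S ^+ m.+1 * (normc z / a) ^+ m).
  by rewrite mulr_ge0 ?exprn_ge0// divr_ge0 ?normc_ge0// ltW.
move=> x t x0 /andP[ct td].
have xa : 0 < x + a by rewrite addr_gt0.
have hS : normc (slope t) <= S by apply: slope_bound; rewrite ct.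
have h1 : normc (rpt t x + z)^-1 <= (x + a)^-1.
  rewrite normcV lef_pV2 ?posrE//; last by rewrite normc_gt0 addz_neq0 ?Re_rpt.
  by apply: le_trans (le_trans (ler_norm _) (abs_Re_le _)); rewrite complex_ReD Re_rpt.
rewrite /ker normcM normcX normcM !normcX (normc_rpt t (ltW x0)).
apply: (@le_trans _ _ ((x * S) ^+ m.+1 * (normc z ^+ m * (x + a)^-1 ^+ (m + m).+2))).
  apply: ler_pM; [by rewrite exprn_ge0// mulr_ge0 ?normc_ge0 ?(ltW x0)| | |].
  - by apply: mulr_ge0; apply: exprn_ge0; exact: normc_ge0.
  - apply: lerXn2r; rewrite ?nnegrE; [by rewrite mulr_ge0 ?normc_ge0 ?(ltW x0)| |].
      by rewrite mulr_ge0 ?(ltW x0) ?(ltW S0).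
    by apply: ler_wpM2l => //; exact: ltW.
  apply: ler_wpM2l; first by apply: exprn_ge0; exact: normc_ge0.
  by apply: lerXn2r; rewrite ?nnegrE ?normc_ge0 ?invr_ge0 ?(ltW xa).
have -> : (x * S) ^+ m.+1 * (normc z ^+ m * (x + a)^-1 ^+ (m + m).+2) =
    S ^+ m.+1 * (x / (x + a)) ^+ m * (normc z / (x + a)) ^+ m * (x / (x + a) ^+ 2).
  rewrite -[((x + a) ^+ 2)^-1]exprVn; move: (x + a)^-1 (normc z) => D n.
  rewrite -addn2 !exprD !exprMn ![_ ^+ m.+1]exprS.
  by move: (x ^+ m) (n ^+ m) (D ^+ m) (S ^+ m) => p q r v; ring.
have r1 : (x / (x + a)) ^+ m <= 1.
  by rewrite exprn_ile1 ?divr_ge0 ?(ltW x0) ?(ltW xa)// ler_pdivrMr// mul1r lerDl ltW.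
have r2 : (normc z / (x + a)) ^+ m <= (normc z / a) ^+ m.
  rewrite lerXn2r ?nnegrE ?divr_ge0 ?normc_ge0 ?(ltW xa) ?(ltW a0)//.
  by rewrite ler_wpM2l ?normc_ge0// lef_pV2 ?posrE// lerDr ltW.
rewrite ler_wpM2r ?divr_ge0 ?exprn_ge0 ?(ltW x0) ?(ltW xa)//.
apply: ler_pM => //.
- by rewrite mulr_ge0 ?exprn_ge0 ?divr_ge0 ?(ltW x0) ?(ltW xa).
- by rewrite exprn_ge0// divr_ge0 ?normc_ge0 ?(ltW xa).
- by rewrite ler_piMr// exprn_ge0.
Qed.

Lemma rderiv_slope (y : R) : rderiv (@slope R) y 'i%C.
Proof.
have := rderivD (rderiv_cst 1 y) (rderivM (rderiv_real y) (rderiv_cst 'i%C y)).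
rewrite add0r mulr0 addr0 mul1r; congr rderiv.
by apply/funext => t; apply/eqP; rewrite eq_complex/= !mulr0 !mul0r mulr1 subr0 !addr0 add0r !eqxx.
Qed.

Lemma continuous_slope (y : R) : {for y, continuous (@slope R)}.
Proof. by apply: cvg_Complex; [exact: cvg_cst|exact: cvg_id]. Qed.

End Slopes.

(** * Abscissae at which the closing segments are short of mass *)

Section RotateRay.
Variable R : realType.
Local Notation C := (R[i])^o.
Local Notation mu := (@lebesgue_measure R).
Local Notation Rpos := (`]0%R, +oo[%classic : set R).
Implicit Types (z w zeta u v : C) (x y a b e t : R).
Variables (s : R) (m : nat) (g : C -> C).
Hypothesis hg : halfplane_holo g.
Hypothesis hN : (ray_norm s g < +oo)%E.

Let mg : hmeas g. Proof. exact: halfplane_holo_hmeas hg. Qed.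

Section Slab.
Variables c d : R.
Hypothesis cd : c <= d.

Let f (p : R * R) : \bar R := (ray g p * \1_(`[c, d]%classic : set R) p.2)%:E.

Let mf : measurable_fun setT f.
Proof.
apply/measurable_EFinP; apply: measurable_funM; first exact: measurable_ray.
have m1 : measurable_fun setT (\1_(`[c, d]%classic : set R) : R -> R).
  by apply: measurable_indic; exact: measurable_itv.
exact: (measurableT_comp m1 (measurable_snd (T1 := R))).
Qed.

Let f0 p : (0 <= f p)%E.
Proof. by rewrite lee_fin mulr_ge0 ?ray_ge0// indicE. Qed.

Definition slice x : \bar R := (\int[mu]_t f (x, t))%E.

Lemma sliceE x : 0 < x -> slice x = (\int[mu]_(t in `[c, d]) (normc (g (rpt t x)))%:E)%E.
Proof.
move=> x0; rewrite [RHS]integral_mkcond; apply: eq_integral => t _.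
rewrite /f rayE x0 indicE/= patchE rptE; case: ifP => _; first by rewrite mulr1.
by rewrite mulr0.
Qed.

Let slice_total : (\int[mu]_x slice x = \int[mu]_(t in `[c, d]) ray_int g t)%E.
Proof.
rewrite (@fubini_tonelli _ _ _ _ _ mu mu f mf f0) [RHS]integral_mkcond.
apply: eq_integral => t _; rewrite patchE /f/= indicE; case: ifP => _.
  by under eq_integral do rewrite mulr1.
by under eq_integral do rewrite mulr0; rewrite integral0.
Qed.

Let slice_meas : measurable_fun setT slice.
Proof. exact: (@measurable_fun_fubini_tonelli_F _ _ _ _ _ mu _ mf f0). Qed.

Let slice_ge0 x : (0 <= slice x)%E.
Proof. by apply: integral_ge0 => t _; exact: f0. Qed.

(** If the slice exceeded (k + 1) / e throughout [e, 2e], its integral over that interval of length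
    e would exceed the total mass k. *)
Lemma good_slice : exists2 K, 0 <= K & forall e, 0 < e ->
  exists2 x, e <= x <= 2 * e & (slice x <= (K / e)%:E)%E.
Proof.
have fin := slab_finite hg hN c d.
have I0 : (0 <= \int[mu]_(t in `[c, d]) ray_int g t)%E.
  by apply: integral_ge0 => t _; exact: ray_int_ge0.
have [k k0 kE] : exists2 k : R, 0 <= k & (\int[mu]_(t in `[c, d]) ray_int g t)%E = k%:E.
  exists (fine (\int[mu]_(t in `[c, d]) ray_int g t)%E); first exact: fine_ge0.
  by rewrite fineK// ge0_fin_numE.
have k1 : 0 <= k + 1 by rewrite addr_ge0.
exists (k + 1) => // e e0; have ke : 0 <= (k + 1) / e by rewrite divr_ge0// ltW.
apply: contrapT => H.
have big x : e <= x <= 2 * e -> (((k + 1) / e)%:E <= slice x)%E.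
  by move=> hx; rewrite leNgt; apply/negP => lt; apply: H; exists x => //; exact: ltW.
have : (\int[mu]_(x in `[e, (2 * e)%R]) ((k + 1) / e)%:E <= k%:E)%E.
  rewrite -kE -slice_total.
  apply: (@le_trans _ _ (\int[mu]_(x in `[e, (2 * e)%R]) slice x)%E).
    apply: ge0_le_integral.
    - exact: measurable_itv.
    - by move=> x _; rewrite lee_fin.
    - exact: measurable_cst.
    - exact: measurable_funTS.
    - by move=> x; rewrite /= in_itv/=; exact: big.
  apply: ge0_subset_integral; [exact: measurable_itv|exact: measurableT|exact: slice_meas| |by []].
  by move=> x _; exact: slice_ge0.
rewrite integral_cst//= lebesgue_measure_itv/= lte_fin ltr_pMl// ltr1n -EFinB -EFinM.
rewrite (_ : 2 * e - e = e); last by ring.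
by rewrite divfK ?gt_eqF// lee_fin gerDl leNgt ltr01.
Qed.

End Slab.

End RotateRay.

(** * Independence of the average from the slope of the source half-line *)

Section RotateSlopes.
Variable R : realType.
Local Notation C := (R[i])^o.
Local Notation mu := (@lebesgue_measure R).
Local Notation Rpos := (`]0%R, +oo[%classic : set R).
Implicit Types (z w zeta u v : C) (x y a b e t : R).
Variables (s : R) (m : nat) (g : C -> C).
Hypothesis hg : halfplane_holo g.
Hypothesis hN : (ray_norm s g < +oo)%E.

Variables c d : R.
Hypothesis cd : c <= d.

Let h z zeta : C := g zeta * ker m zeta z.

Let hh z : 0 < Re z -> halfplane_holo (h z).
Proof. by move=> hz; apply: halfplane_holoM; [exact: hg|exact: ker_holo_l hz]. Qed.

(** In fact a vertical segment: at abscissa x, zeta = x (1 + i y) and d zeta = i x dy. *)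
Let arc z x : C := cint mu `[c, d] (fun y => h z (rpt y x) * (x%:C * 'i%C)).

Lemma rotate_finite z a b : 0 < Re z -> 0 < a -> a <= b ->
  cint mu `[a, b] (fun x => rayF g c x * ker m (rpt c x) z) -
  cint mu `[a, b] (fun x => rayF g d x * ker m (rpt d x) z) = arc z a - arc z b.
Proof.
move=> hz a0 ab; pose E := 1 + `|c| + `|d|.
have dh' x y : a <= x <= b -> c <= y <= d -> derivable (h z) (0 + x%:C * slope y) 1.
  by move=> /andP[ax _] _; rewrite add0r; apply: (hh hz); rewrite Re_rpt; exact: lt_le_trans ax.
have eE y : c <= y <= d -> normc (slope y) <= E by exact: slope_bound.
have e'E y : c <= y <= d -> normc ('i%C : C) <= E.
  move=> _; apply: le_trans (normc_le_ReIm _) _; rewrite /= normr0 normr1 add0r /E -addrA lerDl addr_ge0//.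
have ci (y : R) : {for y, continuous (fun=> 'i%C : C)} by apply: cvg_cst.
have := @goursat R 0 (@slope R) (fun=> 'i%C) (@rderiv_slope R) (@continuous_slope R)
  ci (h z) a b c d E ab cd eE e'E dh'.
rewrite /bd.
have sx t : side_x 0 (@slope R) (h z) t a b = cint mu `[a, b] (fun x => rayF g t x * ker m (rpt t x) z).
  by apply: eq_cint => x _; rewrite add0r -/(rpt t x) /h /rayF mulrAC.
have sy x : side_y 0 (@slope R) (fun=> 'i%C) (h z) x c d = arc z x.
  by apply: eq_cint => y _; rewrite add0r.
have alg (u v p q : C) : u + p - v - q = 0 -> u - v = q - p.
  by move=> H; apply/eqP; rewrite -subr_eq0; apply/eqP; rewrite -H; ring.
by rewrite !sx !sy; exact: alg.
Qed.

(** One factor x comes from d zeta and one from the kernel. With a slice of order 1 / x the bound is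
    O(x) as x tends to 0 and O(1 / x) as x tends to infinity. *)
Lemma arc_bound z : 0 < Re z -> exists2 K, 0 <= K & forall x, 0 < x ->
  ((normc (arc z x))%:E <= (K * (x / (x + Re z)) ^+ 2)%:E * slice g c d x)%E.
Proof.
move=> hz; have [K K0 HK] := ker_bound_slab m c d hz; exists K => // x x0.
have xa : 0 < x + Re z by rewrite addr_gt0.
have ch : ccont c d (fun y => h z (rpt y x) * (x%:C * 'i%C)).
  move=> y _; apply: cvgM; last exact: cvg_cst.
  have cp : {for y, continuous (fun y => rpt y x)}.
    by apply: cvgM; [exact: cvg_cst|exact: continuous_slope].
  have xr : 0 < Re (rpt y x) by rewrite Re_rpt.
  exact: continuous_comp cp (halfplane_holo_continuous (hh hz) xr).
have cg : {within `[c, d], continuous (fun y => normc (g (rpt y x)))}.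
  apply: continuous_in_subspaceT => y _.
  have cp : {for y, continuous (fun y => rpt y x)}.
    by apply: cvgM; [exact: cvg_cst|exact: continuous_slope].
  have xr : 0 < Re (rpt y x) by rewrite Re_rpt.
  have cgp := continuous_comp cp (halfplane_holo_continuous hg xr).
  exact: continuous_comp cgp (@continuous_normc R _).
have ig : mu.-integrable `[c, d] (EFin \o (fun y => normc (g (rpt y x)))).
  by apply: continuous_compact_integrable => //; exact: segment_compact.
have mcd : measurable (`[c, d]%classic : set R) by exact: measurable_itv.
set k := K * (x / (x + Re z)) ^+ 2.
have igk : mu.-integrable `[c, d] (EFin \o (fun y => k * normc (g (rpt y x)))).
  by rewrite (_ : _ \o _ = fun y => (k%:E * (EFin \o (fun y => normc (g (rpt y x)))) y)%E)//; exact: integrableZl.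
have b1 : normc (arc z x) <= k * \int[mu]_(y in `[c, d]) normc (g (rpt y x)).
  have ih := ccont_cintegrable ch.
  apply: le_trans (normc_cint_le _ ih) _ => //.
  rewrite -RintegralZl//; apply: le_Rintegral => //; first exact: cintegrable_normc.
  move=> y; rewrite /= in_itv/= => ycd.
  have nx : normc ((x%:C : C) * 'i%C) = x.
    by rewrite normcM normc_real gtr0_norm// (_ : normc 'i%C = 1) ?mulr1//= expr0n expr1n add0r sqrtr1.
  rewrite normcM nx /h normcM.
  rewrite -mulrA mulrC ler_wpM2r ?normc_ge0//.
  apply: le_trans (ler_wpM2r (ltW x0) (HK x y x0 ycd)) _.
  by rewrite /k le_eqVlt; apply/orP; left; apply/eqP; field; rewrite gt_eqF.
rewrite sliceE//.
have fN : (\int[mu]_(t in `[c, d]) (normc (g (rpt t x)))%:E)%E \is a fin_num.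
  by apply: (@integrable_fin_num _ _ _ mu) ig.
by rewrite -(fineK fN) -EFinM lee_fin.
Qed.

(** Cauchy's theorem on the trapezia between abscissae a_n and b_n, taken from [good_slice] in
    [1 / (2 (n + 1)), 1 / (n + 1)] and above n + 1. The two vertical sides vanish in the limit. *)
Lemma ray_op_rotate_le z : 0 < Re z -> (ray_int g c < +oo)%E -> (ray_int g d < +oo)%E ->
  ray_op m c (rayF g c) z = ray_op m d (rayF g d) z.
Proof.
move=> hz gc gd.
have [K1 K10 HK1] := good_slice hg hN c d; have [K K0 HK] := arc_bound hz.
have n0 n : 0 < n.+1%:R :> R by rewrite ltr0n.
have e0 n : 0 < (2 * n.+1%:R)^-1 :> R by rewrite invr_gt0 mulr_gt0.
have /choice[a Ha] : forall n, exists x, (2 * n.+1%:R)^-1 <= x <= n.+1%:R^-1 /\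
    (slice g c d x <= (K1 / (2 * n.+1%:R)^-1)%:E)%E.
  move=> n; have [x hx sx] := HK1 _ (e0 n); exists x; split; last exact: sx.
  by move: hx; rewrite invfM mulrA divff ?mul1r// pnatr_eq0.
have /choice[b Hb] : forall n, exists x, n.+1%:R <= x /\ (slice g c d x <= (K1 / n.+1%:R)%:E)%E.
  by move=> n; have [x /andP[hx _] sx] := HK1 _ (n0 n); exists x.
have a0 n : 0 < a n by have [/andP[hl _] _] := Ha n; exact: lt_le_trans hl.
have ab n : a n <= b n.
  have [/andP[_ hl] _] := Ha n; have [h' _] := Hb n.
  apply: le_trans hl (le_trans _ h'); apply: (@le_trans _ _ 1); last by rewrite ler1n.
  by rewrite invf_le1 ?ler1n.
pose X t x := rayF g t x * ker m (rpt t x) z.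
have iX t : (ray_int g t < +oo)%E -> cintegrable mu Rpos (X t).
  move=> gt; refine (@integrable_G R m t (rayF g t) _ _ z hz).
    by move=> x x0; exact: (@continuous_rayF R g hg t x x0).
  exact: (@rayF_integrable R g hg t gt).
have cX t : (ray_int g t < +oo)%E ->
    (fun n => cint mu `[a n, b n] (X t)) @ \oo --> ray_op m t (rayF g t) z.
  move=> gt; apply: cint_exhaust.
  - exact: iX.
  - by move=> n; exact: measurable_itv.
  - by move=> n x; rewrite /= !in_itv/= andbT => /andP[hl _]; exact: lt_le_trans hl.
  - move=> x x0; near=> n; rewrite /= in_itv/=; apply/andP; split.
      have [/andP[_ hl] _] := Ha n; apply: le_trans hl _.
      rewrite invf_ple ?posrE//; near: n; apply: near_le_natS; by rewrite invr_ge0 ltW.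
    have [hl _] := Hb n; apply: le_trans hl; near: n; apply: near_le_natS; exact: ltW.
set Lc := ray_op _ _ _ _; set Ld := ray_op _ _ _ _.
set r := Re z in hz HK.
(* The first term bounds the segment at a_n, where (a_n / r)^2 meets a slice of order n + 1; the
   second bounds the segment at b_n, where the slice is at most K1 / (n + 1). *)
pose M := 4 * K * K1 / r ^+ 2 + K * K1.
have M0 : 0 <= M by rewrite addr_ge0 ?divr_ge0 ?mulr_ge0 ?exprn_ge0// ltW.
have dM n : normc (cint mu `[a n, b n] (X c) - cint mu `[a n, b n] (X d)) <= M / n.+1%:R.
  rewrite (rotate_finite hz (a0 n) (ab n)); apply: le_trans (normcB _ _) _.
  rewrite mulrDl; apply: lerD.
    have [/andP[h1 h2] h3] := Ha n.
    have k0 : 0 <= K * (a n / (a n + r)) ^+ 2 by rewrite mulr_ge0 ?sqr_ge0.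
    have := le_trans (HK _ (a0 n)) (lee_wpmul2l _ h3); rewrite lee_fin => /(_ k0).
    rewrite -EFinM lee_fin => /le_trans; apply; rewrite invrK.
    have q : (a n / (a n + r)) ^+ 2 <= (n.+1%:R^-1 / r) ^+ 2.
      rewrite lerXn2r ?nnegrE ?divr_ge0 ?invr_ge0 ?addr_ge0 ?(ltW (a0 n)) ?(ltW hz)//.
      apply: ler_pM => //; rewrite ?invr_ge0 ?addr_ge0 ?(ltW (a0 n)) ?(ltW hz)//.
      by rewrite lef_pV2 ?posrE ?addr_gt0// lerDr ltW.
    apply: (@le_trans _ _ (K * (n.+1%:R^-1 / r) ^+ 2 * (K1 * (2 * n.+1%:R)))).
      by rewrite ler_wpM2r ?mulr_ge0// ler_wpM2l.
    rewrite (_ : _ * _ * _ = (2 * K * K1 / r ^+ 2) / n.+1%:R).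
      rewrite ler_wpM2r ?invr_ge0// ler_wpM2r ?invr_ge0 ?sqr_ge0// -!mulrA ler_wpM2r ?mulr_ge0//.
      by rewrite ler_nat.
    move: (n0 n) hz; clearbody r; move: (n.+1%:R : R) => N N0 r0.
    by field; rewrite !gt_eqF.
  have [h2 h3] := Hb n; have b0 : 0 < b n := lt_le_trans (n0 n) h2.
  have k0 : 0 <= K * (b n / (b n + r)) ^+ 2 by rewrite mulr_ge0 ?sqr_ge0.
  have := le_trans (HK _ b0) (lee_wpmul2l _ h3); rewrite lee_fin => /(_ k0).
  rewrite -EFinM lee_fin => /le_trans; apply; rewrite -mulrA ler_wpM2r ?divr_ge0//.
  rewrite ler_piMr// exprn_ile1// ?divr_ge0 ?addr_ge0 ?(ltW b0) ?(ltW hz)//.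
  by rewrite ler_pdivrMr ?addr_gt0// mul1r lerDl ltW.
have HL : (fun n => cint mu `[a n, b n] (X c) - cint mu `[a n, b n] (X d)) @ \oo --> Lc - Ld.
  exact: cvgB (cX c gc) (cX d gd).
apply/eqP; rewrite -subr_eq0 -normc_eq0; apply/eqP/le_anti; rewrite normc_ge0 andbT.
apply/ler_addgt0Pl => e epos; rewrite addr0.
have e2 : 0 < e / 2 by rewrite divr_gt0.
have n1 : \forall n \near \oo, M / (e / 2) <= n.+1%:R by apply: near_le_natS; rewrite divr_ge0// ltW.
have [n [H1 H2]] := filter_ex (filterI n1 ((ccvgP _ _).1 HL _ e2)).
rewrite ler_pdivrMr// mulrC -ler_pdivrMr// in H1.
move: (dM n) H2; set D := _ - _ => D1 D2.
rewrite (_ : Lc - Ld = D - (D - (Lc - Ld))); last by rewrite subKr.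
apply: le_trans (normcB _ _) _; rewrite (splitr e); apply: lerD; last exact: ltW.
exact: le_trans D1 H1.
Unshelve. all: by end_near.
Qed.

End RotateSlopes.

(** * The real kernel *)

Section MellinKernel.
Variable R : realType.
Local Notation C := (R[i])^o.
Local Notation mu := (@lebesgue_measure R).
Local Notation Rpos := (`]0%R, +oo[%classic : set R).
Implicit Types (x a e u v t d k : R) (m n : nat).

(* [u^m (1 + u)^(-2m-2)] for [u >= 0], continued by its value at [0], which vanishes only if [m > 0]. *)
Definition wker m u : R := Num.max u 0 ^+ m * (1 + Num.max u 0)^-1 ^+ (m + m).+2.

Let p0 u : 0 <= Num.max u 0. Proof. by rewrite le_max lexx orbT. Qed.
Let p1 u : 0 < 1 + Num.max u 0. Proof. by rewrite ltr_pwDl. Qed.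

Lemma wker_ge0 m u : 0 <= wker m u.
Proof. by rewrite /wker; apply: mulr_ge0; apply: exprn_ge0; rewrite ?invr_ge0 ?(ltW (p1 u)). Qed.

Lemma wkerE m u : 0 <= u -> wker m u = u ^+ m / (1 + u) ^+ (m + m).+2.
Proof. by move=> u0; rewrite /wker max_l// exprVn. Qed.

Lemma wkerN m u : u <= 0 -> wker m.+1 u = 0.
Proof. by move=> u0; rewrite /wker max_r// expr0n mul0r. Qed.

Lemma continuous_wker m : continuous (wker m).
Proof.
have cm : continuous (fun u : R => Num.max u 0).
  by move=> u; apply: continuous_max; [exact: cvg_id|exact: cvg_cst].
move=> u; apply: cvgM.
  exact: (continuous_comp (cm u) (@exprn_continuous _ m _)).
have c1 : {for u, continuous (fun u : R => (1 + Num.max u 0)^-1)}.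
  apply: cvgV; first by rewrite gt_eqF.
  by apply: cvgD; [exact: cvg_cst|exact: cm].
exact: (continuous_comp c1 (@exprn_continuous _ (m + m).+2 _)).
Qed.

Lemma measurable_wker m : measurable_fun setT (wker m).
Proof. exact: continuous_measurable_fun (@continuous_wker m). Qed.

(** The exponent starts at 1: for exponent 0 the extension equals 1 on the negative half-line and
    its integral diverges. *)
Definition wtotal m : \bar R := (\int[mu]_u (wker m.+1 u)%:E)%E.

Lemma wtotal_scale m a : 0 < a -> (\int[mu]_u (wker m.+1 (u / a) / a)%:E)%E = wtotal m.
Proof.
move=> a0; have b0 : 0 < a^-1 by rewrite invr_gt0.
rewrite /wtotal (integral_scaleT b0 (@continuous_wker m.+1) (wker_ge0 m.+1)).
by apply: eq_integral => u _; rewrite (mulrC u).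
Qed.

Lemma wker_le m u : 0 < u -> wker m u <= (1 + u) ^- 2.
Proof.
move=> u0; rewrite wkerE ?(ltW u0)//; have u1 : 0 < 1 + u by rewrite addr_gt0.
have -> : u ^+ m / (1 + u) ^+ (m + m).+2 = (u / (1 + u)) ^+ m * (1 + u)^-1 ^+ m * (1 + u) ^- 2.
  rewrite -!exprVn exprMn -addn2 !exprD; move: (u ^+ m) ((1 + u)^-1 ^+ m) => p q; ring.
rewrite -[leRHS]mul1r ler_wpM2r ?invr_ge0 ?exprn_ge0 ?(ltW u1)//.
rewrite mulr_ile1 ?exprn_ge0 ?divr_ge0 ?invr_ge0 ?(ltW u1) ?(ltW u0)//.
  by rewrite exprn_ile1 ?divr_ge0 ?(ltW u1) ?(ltW u0)// ler_pdivrMr// mul1r lerDr.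
by rewrite exprn_ile1 ?invr_ge0 ?(ltW u1)// invf_le1// lerDl ltW.
Qed.

Lemma integral_wker_pos (h : R -> R) : (forall u, u <= 0 -> h u = 0) ->
  (\int[mu]_u (h u)%:E = \int[mu]_(u in Rpos) (h u)%:E)%E.
Proof. by move=> h0; apply: integral_ray_patch. Qed.

Lemma wtotal_fin m : (wtotal m < +oo)%E.
Proof.
rewrite /wtotal (integral_wker_pos (@wkerN m)).
apply: (@le_lt_trans _ _ (\int[mu]_(u in Rpos) (1 / (1 + u) ^+ 2)%:E)%E).
  apply: ge0_le_integral.
  - exact: measurable_itv.
  - by move=> u _; rewrite lee_fin wker_ge0.
  - by apply/measurable_EFinP; apply: measurable_funTS; exact: measurable_wker.
  - apply/measurable_EFinP; apply: open_continuous_measurable_fun; first exact: interval_open.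
    move=> u; rewrite inE/= in_itv/= andbT => u0; apply: cvgM; first exact: cvg_cst.
    have u1 : 1 + u != 0 by rewrite gt_eqF// addr_gt0.
    apply: cvgV; first by rewrite expf_neq0.
    have c1 : {for u, continuous (fun u : R => 1 + u)} by apply: cvgD; [exact: cvg_cst|exact: cvg_id].
    exact: continuous_comp c1 (@exprn_continuous _ 2 _).
  - move=> u; rewrite /= in_itv/= andbT => u0; rewrite lee_fin div1r; exact: wker_le.
have -> : (\int[mu]_(u in Rpos) (1 / (1 + u) ^+ 2)%:E)%E = (\int[mu]_(u in Rpos) (1 / (1 + u * 1) ^+ 2)%:E)%E.
  by apply: eq_integral => u _; rewrite mulr1.
by rewrite integral_inv_sqr// ltry.
Qed.

(** The maximum of x a / (x + a)^2 is 1/4, at x = a, and the defect is a square; hence the factors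
    4^m in the estimates below. *)
Lemma four_ratio x a : 0 < x -> 0 < a -> 4 * (x * a / (x + a) ^+ 2) = 1 - ((x - a) / (x + a)) ^+ 2.
Proof. by move=> x0 a0; field; rewrite gt_eqF// addr_gt0. Qed.

Lemma wker_ratio m x a : 0 < x -> 0 < a ->
  wker m (a / x) / x = (x * a / (x + a) ^+ 2) ^+ m * (x / (x + a) ^+ 2).
Proof.
move=> x0 a0; have xa : 0 < x + a by rewrite addr_gt0.
rewrite wkerE ?divr_ge0 ?(ltW a0) ?(ltW x0)//.
have -> : 1 + a / x = (x + a) / x by field; rewrite gt_eqF.
have -> : x * a / (x + a) ^+ 2 = a / x * ((x + a) / x) ^- 2.
  by field; rewrite !gt_eqF.
have -> : x / (x + a) ^+ 2 = ((x + a) / x) ^- 2 / x by field; rewrite !gt_eqF.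
move: (a / x) ((x + a) / x) => v w.
by rewrite -!exprVn exprMn -exprM -addn2 exprD mul2n addnn; ring.
Qed.

(** The kernel wker(a / x) / x has constant mass in a, which gives the contraction. In x it is the
    kernel times a / x that has constant mass, by this reflection. *)
Lemma wker_reflect m x a : 0 < x -> 0 < a -> a / x * (wker m (a / x) / x) = wker m (x / a) / a.
Proof.
move=> x0 a0; rewrite !wker_ratio// (mulrC a x) (addrC a x) mulrCA; congr (_ * _).
by field; rewrite !gt_eqF// addr_gt0.
Qed.

Lemma wker_far m x a k : 0 < x -> 0 < a -> 0 <= k -> k <= `|x - a| / (x + a) ->
  4 ^+ m * (wker m (a / x) / x) <= (1 - k ^+ 2) ^+ m * (x / (x + a) ^+ 2).
Proof.
move=> x0 a0 k0 kx; have xa : 0 < x + a by rewrite addr_gt0.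
rewrite wker_ratio// mulrA -exprMn ler_wpM2r ?divr_ge0 ?exprn_ge0 ?(ltW x0) ?(ltW xa)//.
have h : 4 * (x * a / (x + a) ^+ 2) <= 1 - k ^+ 2.
  rewrite four_ratio// lerD2l lerN2 -(real_normK (num_real (_ / _))) lerXn2r ?nnegrE//.
  by rewrite normrM normfV (gtr0_norm xa).
by apply: lerXn2r => //; rewrite nnegrE ?(le_trans _ h)// mulr_ge0 ?divr_ge0 ?exprn_ge0 ?mulr_ge0 ?(ltW x0) ?(ltW a0) ?(ltW xa).
Qed.

(** Only [1, 1 + k] is kept. There |1 - u| / (1 + u) <= k / 2, so 4 u / (1 + u)^2 >= 1 - k^2 / 4,
    and the spare factor (1 + u)^-2 is at least 1/9. This rate beats the rate 1 - k^2 of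
    [wker_far]. *)
Lemma wtotal_lower m k : 0 < k -> k <= 1 ->
  (((1 - k ^+ 2 / 4) ^+ m.+1 * (k / 9))%:E <= (4 ^+ m.+1)%:E * wtotal m)%E.
Proof.
move=> k0 k1; set M := m.+1.
have q0 : 0 <= 1 - k ^+ 2 / 4.
  by rewrite subr_ge0 ler_pdivrMr// mul1r (le_trans (exprn_ile1 _ (ltW k0) k1))// ler1n.
have W u : 1 <= u <= 1 + k -> (1 - k ^+ 2 / 4) ^+ M / 9 <= 4 ^+ M * wker M u.
  move=> /andP[u1 uk]; have u0 : 0 < u by exact: lt_le_trans u1.
  have := @wker_ratio M 1 u ltr01 u0; rewrite !divr1 mul1r div1r => ->.
  rewrite mulrA -exprMn; apply: ler_pM; rewrite ?exprn_ge0 ?invr_ge0//.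
    have -> : 4 * (u / (1 + u) ^+ 2) = 1 - ((1 - u) / (1 + u)) ^+ 2 by rewrite -four_ratio// mul1r.
    have h : ((1 - u) / (1 + u)) ^+ 2 <= k ^+ 2 / 4.
      rewrite (_ : k ^+ 2 / 4 = (k / 2) ^+ 2); last by field.
      rewrite -(real_normK (num_real (_ / (1 + u)))) lerXn2r ?nnegrE ?divr_ge0 ?(ltW k0)//.
      rewrite normrM normfV distrC ger0_norm ?subr_ge0// (@ger0_norm _ (1 + u)) ?addr_ge0 ?(ltW u0)//.
      apply: ler_pM; rewrite ?subr_ge0 ?invr_ge0 ?addr_ge0 ?(ltW u0)//.
        by rewrite lerBlDl.
      by rewrite lef_pV2 ?posrE ?addr_gt0//; lra.
    rewrite lerXn2r ?nnegrE ?lerD2l ?lerN2//.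
    by apply: le_trans q0 _; rewrite lerD2l lerN2.
  rewrite lef_pV2 ?posrE ?exprn_gt0 ?addr_gt0//.
  rewrite (_ : 9 = 3 ^+ 2 :> R); last by rewrite -natrX.
  by rewrite lerXn2r ?nnegrE ?addr_ge0 ?(ltW u0)//; lra.
have mW : measurable_fun setT (fun u => (wker M u)%:E).
  by apply/measurable_EFinP; exact: measurable_wker.
have W0 u : [set: R] u -> (0 <= (wker M u)%:E)%E by rewrite lee_fin wker_ge0.
have k4 : (0 <= (4 ^+ M)%:E :> \bar R)%E by rewrite lee_fin.
rewrite /wtotal -(ge0_integralZl mu measurableT mW W0 k4).
apply: (@le_trans _ _ (\int[mu]_(u in `[1%R, (1 + k)%R]) ((1 - k ^+ 2 / 4) ^+ M / 9)%:E)%E).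
  rewrite integral_cst//=.
  rewrite lebesgue_measure_itv/= lte_fin ltrDl k0 -EFinB -EFinM lee_fin.
  have -> : 1 + k - 1 = k by rewrite addrAC subrr add0r.
  by rewrite mulrA [leRHS]mulrAC lexx.
have m4 : measurable_fun setT (fun u => ((4 ^+ M)%:E * (wker M u)%:E)%E).
  by apply: emeasurable_funM; [exact: measurable_cst|exact: mW].
have g4 u : (0 <= (4 ^+ M)%:E * (wker M u)%:E)%E by rewrite -EFinM lee_fin mulr_ge0 ?wker_ge0.
apply: (@le_trans _ _ (\int[mu]_(u in `[1%R, (1 + k)%R]) ((4 ^+ M)%:E * (wker M u)%:E)%E)%E).
  apply: ge0_le_integral.
  - exact: measurable_itv.
  - by move=> u _; rewrite lee_fin divr_ge0// exprn_ge0.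
  - exact: measurable_cst.
  - exact: measurable_funTS.
  - by move=> u; rewrite /= in_itv/= => hu; rewrite -EFinM lee_fin; exact: W.
apply: ge0_subset_integral; [exact: measurable_itv|exact: measurableT|exact: m4| |by []].
by move=> u _; exact: g4.
Qed.

Definition wnorm m : R := fine (wtotal m).

Lemma wtotalE m : wtotal m = (wnorm m)%:E.
Proof.
have w0 : (0 <= wtotal m)%E by apply: integral_ge0 => u _; rewrite lee_fin wker_ge0.
by rewrite /wnorm fineK// ge0_fin_numE// wtotal_fin.
Qed.

Lemma wnorm_lower m k : 0 < k -> k <= 1 ->
  (1 - k ^+ 2 / 4) ^+ m.+1 * (k / 9) <= 4 ^+ m.+1 * wnorm m.
Proof. by move=> k0 k1; have := wtotal_lower m k0 k1; rewrite wtotalE -EFinM lee_fin. Qed.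

Lemma wnorm_gt0 m : 0 < wnorm m.
Proof.
have h := wnorm_lower m ltr01 (lexx 1).
have q : 0 < (4 : R) ^+ m.+1 by rewrite exprn_gt0.
rewrite -(pmulr_rgt0 _ q); apply: lt_le_trans h.
by rewrite mulr_gt0 ?divr_gt0 ?exprn_gt0// subr_gt0 expr1n ltr_pdivrMr// mul1r ltr1n.
Qed.

End MellinKernel.

(** * Pointwise convergence by Laplace's method *)

Section MellinPointwise.
Variable R : realType.
Local Notation C := (R[i])^o.
Local Notation mu := (@lebesgue_measure R).
Local Notation Rpos := (`]0%R, +oo[%classic : set R).
Implicit Types (x e u v t d k : R) (m n : nat).

Let mRpos : measurable (Rpos : set (g_sigma_algebraType R.-ocitv.-measurable)).
Proof. exact: measurable_itv. Qed.

Let rpos_int (h : R -> R) (b : R) : measurable_fun Rpos h -> (forall x, 0 < x -> 0 <= h x) ->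
  (\int[mu]_(x in Rpos) (h x)%:E = b%:E)%E ->
  mu.-integrable Rpos (EFin \o h) /\ \int[mu]_(x in Rpos) h x = b.
Proof.
move=> mh h0 hb; split; last by rewrite /Rintegral hb.
apply/integrableP; split; first exact/measurable_EFinP.
rewrite (_ : (\int[mu]_(x in Rpos) `|(EFin \o h) x|)%E = b%:E) ?ltry// -hb.
by apply: eq_integral => x; rewrite inE/= in_itv/= andbT => x0; rewrite ger0_norm// h0.
Qed.

Variables (a : R) (G : R -> C).
Hypothesis a0 : 0 < a.
Hypothesis cG : {for a, continuous G}.
Hypothesis iG : cintegrable mu Rpos G.
Let K m x := wker m.+1 (a / x) / x.
Hypothesis iK : forall m, cintegrable mu Rpos (fun x => (K m x)%:C * G x).

Let wint m : mu.-integrable Rpos (EFin \o (fun x => wker m.+1 (x / a) / a)) /\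
  \int[mu]_(x in Rpos) (wker m.+1 (x / a) / a) = wnorm R m.
Proof.
apply: rpos_int.
- apply: measurable_funTS; apply: measurable_funM; last exact: measurable_cst.
  have md : measurable_fun setT (fun x : R => x / a).
    by apply: measurable_funM; [exact: measurable_id|exact: measurable_cst].
  exact: (measurableT_comp (@measurable_wker R m.+1) md).
- by move=> x _; rewrite divr_ge0 ?wker_ge0 ?(ltW a0).
- rewrite -wtotalE -(wtotal_scale m a0) integral_wker_pos// => u u0.
  by rewrite wkerN ?mul0r// pmulr_lle0 ?invr_gt0.
Qed.

Let tint : mu.-integrable Rpos (EFin \o (fun x => a / (x + a) ^+ 2)) /\
  \int[mu]_(x in Rpos) (a / (x + a) ^+ 2) = 1.
Proof.
apply: rpos_int.
- apply: open_continuous_measurable_fun; first exact: interval_open.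
  move=> u; rewrite inE/= in_itv/= andbT => u0; apply: cvgM; first exact: cvg_cst.
  have u1 : u + a != 0 by rewrite gt_eqF// addr_gt0.
  apply: cvgV; first by rewrite expf_neq0.
  have c1 : {for u, continuous (fun u : R => u + a)} by apply: cvgD; [exact: cvg_id|exact: cvg_cst].
  exact: continuous_comp c1 (@exprn_continuous _ 2 _).
- by move=> x x0; rewrite divr_ge0 ?exprn_ge0 ?addr_ge0 ?(ltW a0) ?(ltW x0).
- have := integral_inv_sqr a0 (@ltr01 R); rewrite invr1 => <-.
  by apply: eq_integral => x _; rewrite mulr1 addrC.
Qed.

Let A := (\int[mu]_(x in Rpos) normc (G x)) / a + normc (G a).

(** [G x] is compared with (a / x) G(a), since a / x times the kernel is what has mass [wnorm] in x.
    Near a, continuity gives the bound; far from a, the kernel is geometrically small. *)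
Let near_far e : 0 < e -> exists k, [/\ 0 < k, k <= 1 & forall m x, 0 < x ->
  K m x * normc (G x - (a / x)%:C * G a) <=
    e * (wker m.+1 (x / a) / a) +
    ((1 - k ^+ 2) / 4) ^+ m.+1 * (normc (G x) / a + normc (G a) * (a / (x + a) ^+ 2))].
Proof.
move=> e0.
(* After the reflection, the integrand near a is the kernel wker(x / a) / a times (x / a) G(x) -
   G(a). *)
have cx : {for a, continuous (fun x => (x / a)%:C * G x : C)}.
  apply: cvgM; last exact: cG.
  by apply: cvg_Complex; [apply: cvgM; [exact: cvg_id|exact: cvg_cst]|exact: cvg_cst].
have [d /= d0 Hd] := (ccvgP _ _).1 cx e e0.
(* If |x - a| >= d then |x - a| / (x + a) >= k: for x <= 2a the denominator is at most 3a, and for x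
   > 2a the quotient exceeds 1/3. *)
pose k := Num.min d a / (3 * a); have ma : 0 < Num.min d a by rewrite lt_min d0.
have a3 : 0 < 3 * a by rewrite mulr_gt0.
exists k; split; [by rewrite divr_gt0| |].
  by rewrite ler_pdivrMr// mul1r ge_min; apply/orP; right; rewrite ler_peMl ?(ltW a0)// ler1n.
move=> m x x0; have xa : 0 < x + a by rewrite addr_gt0.
have K0 : 0 <= K m x by rewrite divr_ge0 ?wker_ge0// ltW.
have W0 : 0 <= wker m.+1 (x / a) / a by rewrite divr_ge0 ?wker_ge0// ltW.
have k1 : k <= 1 by rewrite ler_pdivrMr// mul1r ge_min; apply/orP; right; rewrite ler_peMl ?(ltW a0)// ler1n.
have kk : 0 <= (1 - k ^+ 2) / 4.
  by rewrite divr_ge0// subr_ge0 exprn_ile1// divr_ge0 ?(ltW ma) ?(ltW a3).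
have T0 : 0 <= normc (G x) / a + normc (G a) * (a / (x + a) ^+ 2).
  by rewrite addr_ge0 ?mulr_ge0 ?normc_ge0 ?invr_ge0 ?exprn_ge0 ?(ltW a0) ?(ltW xa).
have [near|far] := ltP `|x - a| d.
  rewrite -[leLHS]addr0; apply: lerD; last by rewrite mulr_ge0 ?exprn_ge0.
  have h : normc ((x / a)%:C * G x - G a) < e.
    have := Hd x; rewrite /ball_/= distrC => /(_ near).
    by rewrite divff ?gt_eqF// mul1r.
  have -> : G x - (a / x)%:C * G a = (a / x)%:C * ((x / a)%:C * G x - G a).
    rewrite mulrBr mulrA -rmorphM/= (_ : a / x * (x / a) = 1) ?mul1r//.
    by field; rewrite !gt_eqF.
  have ax : 0 <= a / x by rewrite divr_ge0 ?(ltW a0) ?(ltW x0).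
  rewrite normcM normc_real ger0_norm// (mulrA (K m x)) (mulrC (K m x) (a / x)) /K (@wker_reflect R m.+1 x a x0 a0) mulrC.
  by rewrite ler_wpM2r// ltW.
rewrite -[leLHS]add0r; apply: lerD; first by rewrite mulr_ge0// ltW.
have kx : k <= `|x - a| / (x + a).
  rewrite ler_pdivrMr// mulrAC ler_pdivlMr//.
  have md : Num.min d a <= d by rewrite ge_min lexx.
  have mda : Num.min d a <= a by rewrite ge_min lexx orbT.
  have [h|h] := leP x (2 * a).
    apply: (@le_trans _ _ (Num.min d a * (3 * a))); first by rewrite ler_wpM2l ?(ltW ma)//; lra.
    by rewrite ler_wpM2r ?(ltW a3)// (le_trans md).
  apply: (@le_trans _ _ (a * (x + a))); first by rewrite ler_wpM2r ?(ltW xa).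
  by rewrite ger0_norm; [nra|lra].
have k0 : 0 <= k by rewrite divr_ge0 ?(ltW ma) ?(ltW a3).
have KB : K m x <= ((1 - k ^+ 2) / 4) ^+ m.+1 * (x / (x + a) ^+ 2).
  have q : 0 < (4 : R) ^+ m.+1 by rewrite exprn_gt0.
  have := wker_far m.+1 x0 a0 k0 kx.
  have E4 : 4 * ((1 - k ^+ 2) / 4) = 1 - k ^+ 2 by rewrite mulrC divfK.
  have EM : 4 ^+ m.+1 * ((1 - k ^+ 2) / 4) ^+ m.+1 = (1 - k ^+ 2) ^+ m.+1.
    by rewrite -[in RHS]E4 [RHS]exprMn.
  by move=> H; rewrite -(ler_pM2l q) [leRHS]mulrA EM.
apply: le_trans (ler_wpM2r (normc_ge0 _) KB) _; rewrite -mulrA ler_wpM2l ?exprn_ge0//.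
have x2 : 0 <= x / (x + a) ^+ 2 by rewrite divr_ge0 ?exprn_ge0 ?(ltW x0) ?(ltW xa).
apply: le_trans (ler_wpM2l x2 (normcB _ _)) _; rewrite mulrDr; apply: lerD.
  rewrite mulrC ler_wpM2l ?normc_ge0// ler_pdivrMr ?exprn_gt0// mulrC ler_pdivlMr//.
  by rewrite sqrrD; nra.
rewrite normcM normc_real ger0_norm ?divr_ge0 ?(ltW a0) ?(ltW x0)//.
by rewrite le_eqVlt; apply/orP; left; apply/eqP; field; rewrite !gt_eqF.
Qed.

Let wcint m : cintegrable mu Rpos (fun x => (wker m.+1 (x / a) / a)%:C) /\
  cint mu Rpos (fun x => (wker m.+1 (x / a) / a)%:C) = (wnorm R m)%:C.
Proof.
have [w1 w2] := wint m; split; last by rewrite /cint/= w2 [X in _ +i* X]/Rintegral integral0.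
by split; [exact: w1|exact: integrable0].
Qed.

Let deviation e : 0 < e -> exists k, [/\ 0 < k, k <= 1 & forall m,
  normc (cint mu Rpos (fun x => (K m x)%:C * G x) - (wnorm R m)%:C * G a) <=
    e * wnorm R m + ((1 - k ^+ 2) / 4) ^+ m.+1 * A].
Proof.
move=> e0; have [k [k0 k1 H]] := near_far e0; exists k; split => // m.
have [w1 w2] := wcint m; have [v1 v2] := wint m; have [t1 t2] := tint.
have iN := cintegrable_normc mRpos iG.
have iw := cintegrableZ (G a) mRpos w1.
rewrite (mulrC (wnorm R m)%:C) -w2 -(cintZ (G a) mRpos w1) -(cintB mRpos (iK m) iw).
have iB : cintegrable mu Rpos (fun x => (K m x)%:C * G x - G a * (wker m.+1 (x / a) / a)%:C).
  rewrite (_ : (fun x => _ - _) = fun x => (K m x)%:C * G x + - 1 * (G a * (wker m.+1 (x / a) / a)%:C)).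
    by apply: cintegrableD => //; exact: cintegrableZ.
  by apply/funext => x; rewrite mulN1r.
apply: le_trans (normc_cint_le mRpos iB) _.
set B := (_ / 4) ^+ _ in H *.
pose h x := e * (wker m.+1 (x / a) / a) + B * (normc (G x) / a + normc (G a) * (a / (x + a) ^+ 2)).
have i1 : mu.-integrable Rpos (EFin \o (fun x => e * (wker m.+1 (x / a) / a))).
  exact: (integrableZl mRpos e v1).
have i2 : mu.-integrable Rpos (EFin \o (fun x => normc (G a) * (a / (x + a) ^+ 2))).
  exact: (integrableZl mRpos (normc (G a)) t1).
have i3 : mu.-integrable Rpos (EFin \o (fun x => normc (G x) / a)).
  exact: (integrableZr mRpos a^-1 iN).
have i4 := integrableD mRpos i3 i2.
have i5 : mu.-integrable Rpos (EFin \o (fun x => B * (normc (G x) / a + normc (G a) * (a / (x + a) ^+ 2)))).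
  exact: (integrableZl mRpos B i4).
apply: (@le_trans _ _ (\int[mu]_(x in Rpos) h x)).
  apply: le_Rintegral => //; [exact: cintegrable_normc|exact: (integrableD mRpos i1 i5)|].
  move=> x; rewrite /= in_itv/= andbT => x0; rewrite /h.
  suff -> : (K m x)%:C * G x - G a * (wker m.+1 (x / a) / a)%:C =
      (K m x)%:C * (G x - (a / x)%:C * G a).
    by rewrite normcM normc_real ger0_norm ?divr_ge0 ?wker_ge0 ?(ltW x0)//; exact: H.
  rewrite mulrBr mulrA -rmorphM/= (mulrC (K m x)) /K (wker_reflect m.+1 x0 a0).
  by rewrite (mulrC (G a)).
rewrite /h RintegralD// RintegralZl// v2 RintegralZl// RintegralD// RintegralZr// RintegralZl// t2 mulr1.
exact: lexx.
Qed.

(** Dividing [deviation] by [wnorm] leaves e plus a far part. The lower bound [wnorm_lower] with the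
    same k makes that part decay geometrically. *)
Lemma mellin_pointwise :
  (fun m => ((wnorm R m)^-1)%:C * cint mu Rpos (fun x => (wker m.+1 (a / x) / x)%:C * G x)) @ \oo --> G a.
Proof.
apply/ccvgP => e e0; have e2 : 0 < e / 2 by rewrite divr_gt0.
have [k [k0 k1 H]] := deviation e2.
have A0 : 0 <= A.
  by rewrite addr_ge0 ?divr_ge0 ?normc_ge0 ?(ltW a0)// Rintegral_ge0// => x _; exact: normc_ge0.
have kk : k ^+ 2 <= 1 by rewrite exprn_ile1// ltW.
have k2 : 0 < k ^+ 2 by rewrite exprn_gt0.
(* [p] is the far rate and [q] the rate of the lower bound of the mass; their quotient [r] is less
   than 1. *)
pose p := 1 - k ^+ 2; pose q := 1 - k ^+ 2 / 4; pose r := p / q.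
have p0 : 0 <= p by rewrite subr_ge0.
have q0 : 0 < q by rewrite /q; lra.
have r0 : 0 <= r by rewrite divr_ge0// ltW.
have r1 : r < 1 by rewrite ltr_pdivrMr// mul1r /p /q; lra.
have near0 : \forall m \near \oo, 9 / k * A * r ^+ m < e / 2.
  have := @cvg_geometric R (9 / k * A) r; rewrite ger0_norm// => /(_ r1) /cvgr0Pnorm_lt /(_ _ e2).
  by apply: filterS => m; rewrite /geometric/=; exact: le_lt_trans (ler_norm _).
near=> m; set c := cint _ _ _.
have I0 := wnorm_gt0 R m; set I := wnorm R m in I0 *.
have -> : (I^-1)%:C * c - G a = (I^-1)%:C * (c - I%:C * G a).
  by rewrite mulrBr mulrA -rmorphM/= mulVf ?gt_eqF// mul1r.
rewrite normcM normc_real ger0_norm ?invr_ge0 ?(ltW I0)// mulrC ltr_pdivrMr//.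
apply: le_lt_trans (H m) _; rewrite [in ltRHS](splitr e) [ltRHS]mulrDl ltrD2l.
have hm : 9 / k * A * r ^+ m < e / 2 by near: m.
have lo := wnorm_lower m k0 k1; rewrite -/I -/q in lo.
have q4 : 0 < (4 : R) ^+ m.+1 by rewrite exprn_gt0.
have -> : ((1 - k ^+ 2) / 4) ^+ m.+1 = r ^+ m.+1 * (q ^+ m.+1 / 4 ^+ m.+1).
  by rewrite -!exprVn -!exprMn mulrA divfK ?gt_eqF.
have qI : q ^+ m.+1 / 4 ^+ m.+1 <= I * (9 / k).
  rewrite ler_pdivrMr//; move: lo; rewrite -ler_pdivlMr ?divr_gt0// invf_div => /le_trans; apply.
  by rewrite le_eqVlt; apply/orP; left; apply/eqP; ring.
have rr : r ^+ m.+1 <= r ^+ m by rewrite exprS ler_piMl ?exprn_ge0// ltW.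
have k9 : 0 <= 9 / k * A by rewrite mulr_ge0// divr_ge0// ltW.
apply: (@le_lt_trans _ _ (I * (9 / k * A * r ^+ m))); last by rewrite mulrC ltr_pM2r.
apply: (@le_trans _ _ (r ^+ m * (I * (9 / k)) * A)).
  rewrite ler_wpM2r//; apply: ler_pM => //; first exact: exprn_ge0.
  by rewrite divr_ge0 ?exprn_ge0 ?(ltW q0)// ltW.
by rewrite le_eqVlt; apply/orP; left; apply/eqP; ring.
Unshelve. all: by end_near.
Qed.

End MellinPointwise.

(** * Convergence of the averages *)

Section RayMean.
Variable R : realType.
Local Notation C := (R[i])^o.
Local Notation mu := (@lebesgue_measure R).
Local Notation Rpos := (`]0%R, +oo[%classic : set R).
Implicit Types (z w u v : C) (x y a b t : R) (m n : nat).

Let mRpos : measurable (Rpos : set (g_sigma_algebraType R.-ocitv.-measurable)).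
Proof. exact: measurable_itv. Qed.

(** By homogeneity of degree -1 the kernel contributes slope^-1, which cancels the slope in d
    zeta. *)
Lemma ker_ray (h : C -> C) m t x a : 0 < x -> 0 < a ->
  rayF h t x * ker m (rpt t x) (rpt t a) = (wker m (a / x) / x)%:C * h (rpt t x).
Proof.
move=> x0 a0; have xa : 0 < x + a by rewrite addr_gt0.
have e0 : slope t != 0 by rewrite -normc_eq0 gt_eqF// slope_gt0.
rewrite /rayF -mulrA mulrC; congr (_ * _); rewrite wker_ratio// /ker /rpt -mulrDl -rmorphD/=.
have c0 : (x + a)%:C != 0 :> C by rewrite -normc_eq0 normc_real gt_eqF// normr_gt0 gt_eqF.
rewrite rmorphM rmorphXn !rmorphM !fmorphV rmorphXn/=.
move: (slope t) e0 (x%:C : C) (a%:C : C) ((x + a)%:C : C) c0 => e e0 p q r r0.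
have -> : (r * e)^-1 ^+ (m + m).+2 = (r^-1 ^+ 2) ^+ m * r^-1 ^+ 2 * (e^-1 ^+ m * e^-1 ^+ m * e^-1 ^+ 2).
  by rewrite invfM exprMn -exprM mul2n -addnn -addn2 !exprD.
rewrite -exprVn !exprMn !exprS !expr0 !mulr1.
have em : e ^+ m * e^-1 ^+ m = 1 by rewrite -exprMn divff// expr1n.
transitivity ((e ^+ m * e^-1 ^+ m) * (e ^+ m * e^-1 ^+ m) * (e * e^-1) * (e * e^-1) *
  (p ^+ m * q ^+ m * (r^-1 ^+ m * r^-1 ^+ m) * (p * (r^-1 * r^-1)))); last first.
  by rewrite em divff// !mul1r.
move: (e ^+ m) (e^-1 ^+ m) (p ^+ m) (q ^+ m) (r^-1 ^+ m) (r^-1) (e^-1) => *; ring.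
Qed.

Variables (s : R) (g : C -> C).
Hypothesis hs : -1 < s.
Hypothesis hg : halfplane_holo g.
Hypothesis hN : (ray_norm s g < +oo)%E.
Let mg : hmeas g. Proof. exact: halfplane_holo_hmeas hg. Qed.

Variable t0 : R.
Hypothesis g0 : (ray_int g t0 < +oo)%E.

(** The shift matches [wnorm m], which is the mass of [wker m.+1]. *)
Let op m : C -> C := ray_op m.+1 t0 (rayF g t0).

Definition ray_mean m z : C := ((wnorm R m)^-1)%:C * op m z.

Lemma approximable_ray_mean m : approximable s (ray_mean m).
Proof.
apply: approximableZ; apply: approximable_ray_op.
- exact: hs.
- by move=> x x0; exact: (@continuous_rayF R g hg t0 x x0).
- exact: (@rayF_integrable R g hg t0 g0).
Qed.

Section Slope.
Variable t : R.
Hypothesis gt : (ray_int g t < +oo)%E.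

Lemma ray_op_slope m z : 0 < Re z -> ray_op m t0 (rayF g t0) z = ray_op m t (rayF g t) z.
Proof.
move=> hz; have [le|lt] := leP t0 t; first exact: (ray_op_rotate_le m hg hN le hz g0 gt).
by apply/esym; exact: (ray_op_rotate_le m hg hN (ltW lt) hz gt g0).
Qed.

Let G x := g (rpt t x).
Let K m a x := (wker m.+1 (a / x) / x)%:C * G x.

Let opE m a : 0 < a -> op m (rpt t a) = cint mu Rpos (K m a).
Proof.
move=> a0; rewrite /op ray_op_slope ?Re_rpt//; apply: eq_cint => x.
rewrite inE/= in_itv/= andbT => x0; exact: ker_ray.
Qed.

Let eqK m a : 0 < a -> {in Rpos, (fun x => rayF g t x * ker m.+1 (rpt t x) (rpt t a)) =1 K m a}.
Proof. by move=> a0 x; rewrite inE/= in_itv/= andbT => x0; exact: ker_ray. Qed.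

Let iK m a : 0 < a -> cintegrable mu Rpos (K m a).
Proof.
move=> a0; have hz : 0 < Re (rpt t a) by rewrite Re_rpt.
have cF x : 0 < x -> {for x, continuous (rayF g t)}.
  by move=> x0; exact: (@continuous_rayF R g hg t x x0).
have [i1 i2] := @integrable_G R m.+1 t (rayF g t) cF (@rayF_integrable R g hg t gt) _ hz.
split; [move: i1|move: i2]; apply: eq_integrable; (try exact: mRpos) => x xR /=; congr (_ _)%:E;
  exact: eqK.
Qed.

Let iG : cintegrable mu Rpos G.
Proof.
have e0 : slope t != 0 by rewrite -normc_eq0 gt_eqF// slope_gt0.
rewrite (_ : G = fun x => (slope t)^-1 * rayF g t x).
  by apply: cintegrableZ; [exact: mRpos|exact: rayF_integrable].
by apply/funext => x; rewrite /rayF mulrCA mulVf// mulr1.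
Qed.

Lemma ray_mean_cvg a : 0 < a -> (fun m => ray_mean m (rpt t a)) @ \oo --> g (rpt t a).
Proof.
move=> a0; rewrite (_ : (fun m => _) = fun m => ((wnorm R m)^-1)%:C * cint mu Rpos (K m a)).
  by apply: (mellin_pointwise a0 (@continuous_ray R g hg t a a0) iG (fun m => iK m a0)).
by apply/funext => m; rewrite /ray_mean opE.
Qed.

(** Pull the modulus inside the integral and exchange by Tonelli; for each source x the kernel has
    mass [wnorm m] in a, by [wtotal_scale]. *)
Lemma ray_op_contract m : (ray_int (op m) t <= (wnorm R m)%:E * ray_int g t)%E.
Proof.
(* The inverse is written as [powR] with exponent -1, which is jointly measurable; [ray] vanishes
   for a nonpositive second coordinate. *)
pose f (p : R * R) : \bar R := (wker m.+1 (p.1 * p.2 `^ (-1)) * p.2 `^ (-1) * ray g (p.2, t))%:E.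
have pE x : 0 < x -> x `^ (-1) = x^-1 by move=> x0; rewrite powR_inv1// ltW.
have f0 p : (0 <= f p)%E by rewrite lee_fin mulr_ge0 ?ray_ge0// mulr_ge0 ?wker_ge0// powR_ge0.
have mf : measurable_fun setT f.
  apply/measurable_EFinP.
  have mp : measurable_fun setT (fun p : R * R => p.2 `^ (-1)).
    apply: (measurableT_comp (f := fun u : R => u `^ (-1))); last exact: measurable_snd.
    exact: measurable_powR.
  apply: measurable_funM.
    apply: measurable_funM; last exact: mp.
    apply: (measurableT_comp (@measurable_wker R m.+1)).
    by apply: measurable_funM; [exact: measurable_fst|exact: mp].
  have mr : measurable_fun setT (fun x => ray g (x, t)).
    by apply/measurable_EFinP; exact: measurable_ray_slice.
  exact: (measurableT_comp mr (measurable_snd (T1 := R))).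
have mop : hmeas (op m).
  apply: (@hmeas_ray_op R s) => //; last exact: rayF_integrable.
  by move=> x x0; exact: (@continuous_rayF R g hg t0 x x0).
have le1 a : ((ray (op m) (a, t))%:E <= \int[mu]_x f (a, x))%E.
  rewrite rayE; case: ifPn => [a0|_]; last by apply: integral_ge0 => x _; exact: f0.
  rewrite -rptE opE//.
  have iN := cintegrable_normc mRpos (iK m a0).
  have fN : (\int[mu]_(x in Rpos) (normc (K m a x))%:E)%E \is a fin_num.
    exact: (@integrable_fin_num _ _ _ mu _ mRpos _ iN).
  apply: (@le_trans _ _ (\int[mu]_(x in Rpos) (normc (K m a x))%:E)%E).
    by rewrite -(fineK fN) lee_fin; exact: normc_cint_le (iK m a0).
  rewrite le_eqVlt; apply/orP; left; apply/eqP/esym; rewrite /f/=; apply: integral_ray_patch.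
    move=> x x0; rewrite pE// rayE x0 -rptE /K normcM normc_real ger0_norm//.
    by rewrite divr_ge0 ?wker_ge0// ltW.
  by move=> x x0; rewrite rayE ltNge x0 mulr0.
rewrite /ray_int.
apply: (@le_trans _ _ (\int[mu]_a \int[mu]_x f (a, x))%E).
  apply: ge0_le_integral => //.
  - by move=> a _; rewrite lee_fin ray_ge0.
  - exact: measurable_ray_slice.
  - exact: (@measurable_fun_fubini_tonelli_F _ _ _ _ _ mu _ mf f0).
rewrite (@fubini_tonelli _ _ _ _ _ mu mu f mf f0).
rewrite -ge0_integralZl//; [|exact: measurable_ray_slice|by move=> x _; rewrite lee_fin ray_ge0|].
  rewrite le_eqVlt; apply/orP; left; apply/eqP; apply: eq_integral => x _.
  have [x0|x0] := ltP 0 x; last first.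
    rewrite rayE ltNge x0/= mule0 (_ : (fun a => _) = cst 0%E) ?integral0//.
    by apply/funext => a; rewrite /f/= rayE ltNge x0 mulr0.
  rewrite -wtotalE -(wtotal_scale m x0) -ge0_integralZr//.
  - by apply: eq_integral => a _; rewrite /f/= pE.
  - apply/measurable_EFinP; apply: measurable_funM; last exact: measurable_cst.
    apply: (measurableT_comp (@measurable_wker R m.+1)).
    by apply: measurable_funM; [exact: measurable_id|exact: measurable_cst].
  - by move=> a _; rewrite lee_fin divr_ge0 ?wker_ge0// ltW.
  - by rewrite lee_fin ray_ge0.
by rewrite lee_fin ltW// wnorm_gt0.
Qed.

Lemma ray_mean_contract m : (ray_int (ray_mean m) t <= ray_int g t)%E.
Proof.
have I0 := wnorm_gt0 R m.
have mop : hmeas (op m).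
  apply: (@hmeas_ray_op R s) => //; last exact: rayF_integrable.
  by move=> x x0; exact: (@continuous_rayF R g hg t0 x x0).
rewrite /ray_mean ray_intZ// normc_real ger0_norm ?invr_ge0 ?(ltW I0)//.
have k0 : (0 <= ((wnorm R m)^-1)%:E)%E by rewrite lee_fin invr_ge0 ltW.
apply: le_trans (lee_wpmul2l k0 (ray_op_contract m)) _.
by rewrite muleA -EFinM mulVf ?mul1e// gt_eqF.
Qed.

End Slope.

End RayMean.

(** * Convergence of the averages in L^1 of almost every half-line *)

Section MeanApproximation.
Variable R : realType.
Local Notation C := (R[i])^o.
Local Notation mu := (@lebesgue_measure R).
Implicit Types (z w u v : C) (x y a b t : R) (m n : nat).
Variables (s : R) (g : C -> C).
Hypothesis hs : -1 < s.
Hypothesis hg : halfplane_holo g.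
Hypothesis hN : (ray_norm s g < +oo)%E.
Let mg : hmeas g. Proof. exact: halfplane_holo_hmeas hg. Qed.

Lemma slope_weight_gt0 t : 0 < slope_weight s t.
Proof. by apply: powR_gt0; rewrite ltr_wpDr// sqr_ge0. Qed.

Lemma weighted_integrable : mu.-integrable setT (fun t => ((slope_weight s t)%:E * ray_int g t)%E).
Proof.
apply/integrableP; split; first exact: measurable_weighted mg.
rewrite (_ : (\int[mu]_t `|(slope_weight s t)%:E * ray_int g t|)%E = ray_norm s g)//.
by apply: eq_integral => t _; rewrite gee0_abs// weighted_ge0.
Qed.

Lemma good_slope : \forall t \ae mu, (ray_int g t < +oo)%E.
Proof.
have := integrable_ae measurableT weighted_integrable.
apply: filterS => t /(_ Logic.I); have w0 := slope_weight_gt0 t.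
move=> fin; rewrite ltey; apply/eqP => I; move: fin.
by rewrite I gt0_muley ?lte_fin.
Qed.

(** The bad slopes form a null set, which cannot contain [0, 1]. *)
Lemma exists_good_slope : exists t, (ray_int g t < +oo)%E.
Proof.
have [N [mN N0 NH]] := good_slope; apply: contrapT => no.
have : (mu (`[0%R, 1%R]%classic : set R) <= mu N)%E.
  apply: le_measure; rewrite ?inE//.
  by move=> t _; apply: NH => /= ht; apply: no; exists t.
by rewrite N0 lebesgue_measure_itv/= lte_fin ltr01 sube0 lee_fin ler10.
Qed.

Variable t0 : R.
Hypothesis g0 : (ray_int g t0 < +oo)%E.
Let H m := ray_mean g t0 m.
Let mH m : hmeas (H m). Proof. exact: (approximable_ray_mean hs hg g0 m).1. Qed.

Let mgH m : hmeas (fun z => g z - H m z). Proof. by apply: hmeasB; [exact: mg|exact: mH]. Qed.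

Section Slope.
Variable t : R.
Hypothesis gt : (ray_int g t < +oo)%E.

Lemma ray_int_deviation m : (ray_int (fun z => g z - H m z)%R t <= 2%:E * ray_int g t)%E.
Proof.
have mNH : hmeas (fun z => - 1 * H m z) by apply: hmeasZ; exact: mH.
rewrite (_ : (fun z => _) = (fun z => g z + - 1 * H m z)); last by apply/funext => z; rewrite mulN1r.
apply: le_trans (ray_intD t mg mNH) _; rewrite ray_intZ; last exact: mH.
rewrite normcN (normc_real (1 : R)) normr1 mul1e (_ : 2 = 1 + 1 :> R)// EFinD.
rewrite ge0_muleDl ?lee_fin// mul1e leeD2l//.
exact: (ray_mean_contract hs hg hN g0 gt m).
Qed.

(** No integrable majorant of the averages is at hand. The functions |g| + |H_m| - |g - H_m| however
    lie between 0 and 2 |g| and tend to 2 |g|, and the contraction converts the convergence of their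
    integrals into that of |g - H_m|. *)
Lemma ray_int_deviation_cvg : (fun m => ray_int (fun z => g z - H m z)%R t) @ \oo --> 0%E.
Proof.
pose r a := ray g (a, t); pose h m a := ray (H m) (a, t).
pose d m a := ray (fun z => g z - H m z) (a, t).
have r0 a : 0 <= r a by exact: ray_ge0.
have mr : measurable_fun setT r by apply/measurable_EFinP; exact: measurable_ray_slice mg.
have mh m : measurable_fun setT (h m) by apply/measurable_EFinP; exact: measurable_ray_slice (mH m).
have md m : measurable_fun setT (d m) by apply/measurable_EFinP; exact: measurable_ray_slice (mgH m).
pose u m a := r a + h m a - d m a.
have mu_ m : measurable_fun setT (u m).
  by apply: measurable_funB; [apply: measurable_funD; [exact: mr|exact: mh]|exact: md].
have u0 m a : 0 <= u m a.
  rewrite /u /r /h /d !rayE; case: ifP => _; last by rewrite addr0 subr0.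
  by rewrite subr_ge0 normcB.
have u2 m a : u m a <= 2 * r a.
  rewrite /u /r /h /d !rayE; case: ifP => _; last by rewrite addr0 subr0 mulr0.
  set z := _ +i* _; rewrite mulr2n mulrDl mul1r -addrA lerD2l lerBlDr.
  by rewrite -[in leLHS](subKr (g z) (H m z)) normcB.
pose J : \bar R := (\int[mu]_a (2 * r a)%:E)%E.
have JE : J = (2%:E * ray_int g t)%E.
  rewrite /J /ray_int -ge0_integralZl//; first exact: measurable_ray_slice mg.
  by move=> a _; rewrite lee_fin ray_ge0.
have J0 : (0 <= J)%E by apply: integral_ge0 => a _; rewrite lee_fin mulr_ge0.
have Jfin : J \is a fin_num.
  by rewrite ge0_fin_numE// JE lte_mul_pinfty// lee_fin.
have m2 : measurable_fun setT (fun a => (2 * r a)%:E).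
  by apply/measurable_EFinP; apply: measurable_funM; [exact: measurable_cst|exact: mr].
have iJ : mu.-integrable setT (fun a => (2 * r a)%:E).
  apply/integrableP; split => //.
  rewrite (_ : (\int[mu]_a `|(2 * r a)%:E|)%E = J) ?ltey_eq ?Jfin//.
  by apply: eq_integral => a _; rewrite gee0_abs// lee_fin mulr_ge0.
have cu a : (fun m => (u m a)%:E) @ \oo --> (2 * r a)%:E.
  apply: cvg_EFin; first by near=> m.
  rewrite /comp/= /u /r /h /d; have [a0|a0] := ltP 0 a; last first.
    rewrite (_ : (fun m => _) = cst 0); last first.
      by apply/funext => m; rewrite !rayE ltNge a0/= addr0 subr0.
    by rewrite rayE ltNge a0/= mulr0; exact: cvg_cst.
  have cH := ray_mean_cvg hg hN g0 gt a0; rewrite rptE in cH.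
  rewrite (_ : (fun m => _) = (fun m => normc (g (a +i* (a * t))) + normc (H m (a +i* (a * t))) -
      normc (g (a +i* (a * t)) - H m (a +i* (a * t))))); last first.
    by apply/funext => m; rewrite !rayE a0.
  rewrite rayE a0; set z := a +i* (a * t) in cH *.
  have c1 : (fun m => normc (H m z)) @ \oo --> normc (g z).
    exact: (cvg_comp _ _ cH (@continuous_normc R (g z))).
  have c2 : (fun m => normc (g z - H m z)) @ \oo --> 0.
    apply/cvgr0Pnorm_lt => e e0; have [N _ HN] := (ccvgP _ _).1 cH e e0.
    by exists N => // m /HN; rewrite /= ger0_norm ?normc_ge0// normc_distC.
  rewrite (_ : 2 * normc (g z) = normc (g z) + normc (g z) - 0); last by rewrite subr0 mulr2n mulrDl mul1r.
  by apply: cvgB c2; apply: cvgD c1; exact: cvg_cst.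
have cu' : \forall a \ae mu, [set: R] a -> (fun m => (u m a)%:E) @ \oo --> (2 * r a)%:E.
  by apply: aeW => a _; exact: cu.
have bu : \forall a \ae mu, forall m, [set: R] a -> (`|(u m a)%:E| <= (2 * r a)%:E)%E.
  by apply: aeW => a m _; rewrite gee0_abs lee_fin; [exact: u2|exact: u0].
have mE m : measurable_fun setT (fun a => (u m a)%:E) by exact/measurable_EFinP.
have [_ _ cJ] := @dominated_convergence _ _ _ mu setT measurableT (fun m a => (u m a)%:E) _ _ mE m2 cu' iJ bu.
(* The two integrals add up to the norms of g and H_m on the half-line, at most twice that of g by
   [ray_mean_contract]. *)
have sum m : (\int[mu]_a (u m a)%:E + ray_int (fun z => g z - H m z)%R t <= J)%E.
  have pu a : [set: R] a -> (0 <= (u m a)%:E)%E by rewrite lee_fin.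
  have pd k a : [set: R] a -> (0 <= (ray k (a, t))%:E)%E by rewrite lee_fin ray_ge0.
  rewrite /ray_int -(ge0_integralD mu measurableT pu (mE m) (pd _) (measurable_ray_slice t (mgH m))).
  rewrite (_ : (\int[mu]_a _)%E = (ray_int g t + ray_int (H m) t)%E).
    rewrite JE (_ : 2 = 1 + 1 :> R)// EFinD ge0_muleDl ?lee_fin// mul1e leeD2l//.
    exact: (ray_mean_contract hs hg hN g0 gt m).
  rewrite /ray_int -(ge0_integralD mu measurableT (pd _) (measurable_ray_slice t mg)
    (pd _) (measurable_ray_slice t (mH m))).
  by apply: eq_integral => a _; rewrite -!EFinD /u subrK.
have ufin m : (\int[mu]_a (u m a)%:E)%E \is a fin_num.
  rewrite ge0_fin_numE; last by apply: integral_ge0 => a _; rewrite lee_fin.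
  apply: le_lt_trans (le_trans _ (sum m)) _; first by rewrite leeDl ?ray_int_ge0.
  by rewrite ltey_eq Jfin.
apply: (@squeeze_cvge _ _ _ _ (cst 0%E) _ (fun m => J - \int[mu]_a (u m a)%:E)%E).
- near=> m; rewrite ray_int_ge0/= leeBrDr//; rewrite addeC; exact: sum.
- exact: cvg_cst.
- rewrite -(subee Jfin); apply: cvgeB; [by rewrite fin_num_adde_defr|exact: cvg_cst|exact: cJ].
Unshelve. all: by end_near.
Qed.

End Slope.

End MeanApproximation.

Section HolomorphicApproximation.
Variable R : realType.
Local Notation C := (R[i])^o.
Local Notation mu := (@lebesgue_measure R).
Implicit Types (z w u v : C) (x y a b t : R) (m n : nat).
Variables (s : R) (g : C -> C).
Hypothesis hs : -1 < s.
Hypothesis hg : halfplane_holo g.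
Hypothesis hN : (ray_norm s g < +oo)%E.

Lemma approximable_holo : approximable s g.
Proof.
have mg : hmeas g by exact: halfplane_holo_hmeas hg.
have [t0 g0] := exists_good_slope hg hN.
have aH m := approximable_ray_mean hs hg g0 m.
apply: (approximable_closed mg) => eps e0.
have mgH m : hmeas (fun z => g z - ray_mean g t0 m z) by apply: hmeasB; [exact: mg|exact: (aH m).1].
pose f m t := ((slope_weight s t)%:E * ray_int (fun z => g z - ray_mean g t0 m z)%R t)%E.
have mf m : measurable_fun setT (f m) by exact: measurable_weighted (mgH m).
have m0 : measurable_fun setT (fun _ : R => 0%E : \bar R) by exact: measurable_cst.
(* Twice the weighted norm of g dominates the deviation on almost every slope, again by the
   contraction. *)
pose h t : \bar R := (2%:E * ((slope_weight s t)%:E * ray_int g t))%E.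
have ih : mu.-integrable setT h by exact: (integrableZl measurableT 2 (weighted_integrable hg hN)).
have cf : \forall t \ae mu, [set: R] t -> (fun m => f m t) @ \oo --> (0%E : \bar R).
  have := good_slope hg hN; apply: (@filterS _ _ (ae_filter_ringOfSetsType mu)) => t gt _; rewrite -(mule0 (slope_weight s t)%:E).
  by apply: cvgeZl => //; exact: (ray_int_deviation_cvg hs hg hN g0 gt).
have bf : \forall t \ae mu, forall m, [set: R] t -> (`|f m t| <= h t)%E.
  have := good_slope hg hN; apply: (@filterS _ _ (ae_filter_ringOfSetsType mu)) => t gt m _.
  rewrite gee0_abs; last exact: weighted_ge0.
  rewrite /h muleCA; apply: lee_wpmul2l; first by rewrite lee_fin slope_weight_ge0.
  exact: (ray_int_deviation hs hg hN g0 gt m).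
have [_ _] := @dominated_convergence _ _ _ mu setT measurableT f _ _ mf m0 cf ih bf.
rewrite integral0 => /fine_cvgP[fin /cvgr0Pnorm_lt /(_ _ e0)] lt.
have [m [h1 h2]] := filter_ex (filterI fin lt).
exists (ray_mean g t0 m); first exact: aH.
have fm : (\int[mu]_t f m t)%E \is a fin_num := h1.
change (\int[mu]_t f m t < eps%:E)%E.
rewrite -(fineK fm) lte_fin; exact: le_lt_trans (ler_norm _) h2.
Qed.

End HolomorphicApproximation.

(** * The value at infinity *)

Section SectorLimit.
Variable R : realType.
Local Notation C := (R[i])^o.
Implicit Types (z w u v : C) (x y a b e : R) (f r : C -> C).
Local Notation F := (@sector_infty R (pi / 4)).

Let cos_ge0 : 0 <= cos (pi / 4 : R).
Proof. by apply: cos_ge0_pihalf; have := @pi_gt0 R; lra. Qed.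

Let cos_lt1 : cos (pi / 4 : R) < 1.
Proof.
have p0 := @pi_gt0 R.
have h0 : (0 : R) \in `[0, pi] by rewrite in_itv/=; apply/andP; split; lra.
have h1 : (pi / 4 : R) \in `[0, pi] by rewrite in_itv/=; apply/andP; split; lra.
by rewrite -[ltRHS]cos0 ltr_cos// divr_gt0.
Qed.

(** Large positive reals lie in the sector because cos(pi / 4) < 1; properness makes the limit at
    infinity unique. *)
Global Instance sector_infty_proper : ProperFilter F.
Proof.
split.
  move=> [M HM]; pose x := `|M| + 1.
  have x0 : 0 < x by rewrite ltr_wpDl.
  apply: (HM (x%:C)); rewrite normc_real ger0_norm ?(ltW x0)//.
    by rewrite ltr_pwDr// ler_norm.
  by rewrite /= gtr_pMr.
split.
- by exists 0.
- move=> P Q [M HM] [N HN]; exists (Num.max M N) => z.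
  by rewrite gt_max => /andP[h1 h2] h; split; [exact: HM|exact: HN].
- by move=> P Q PQ [M HM]; exists M => z h1 h2; apply: PQ; exact: HM.
Qed.

Lemma sector_Re z : normc z * cos (pi / 4) < Re z -> 0 < Re z.
Proof. by apply: le_lt_trans; rewrite mulr_ge0 ?normc_ge0. Qed.

Lemma Rtilde_decay n (a lam : nat -> C) : (forall k, (k < n)%N -> 0 < Re (lam k)) ->
  exists2 B, 0 <= B & forall z, 0 < Re z ->
    normc (\sum_(k < n) a k / (lam k + z)) <= B / (1 + normc z) /\
    normc (\sum_(k < n) - a k / (lam k + z) ^+ 2) <= B * normc (decay2 z).
Proof.
elim: n => [|n ih] hl.
  by exists 0 => // z _; rewrite !big_ord0 ComplexField.Normc.normc0 !mul0r.
have [B B0 HB] := ih (fun k kn => hl k (ltnW kn)).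
have [A A0 HA] := inv_decay (hl n (ltnSn n)).
pose n_ := normc (a n); have nn : 0 <= n_ := normc_ge0 _.
exists (B + (n_ * A + n_ * A ^+ 2)).
  by rewrite !addr_ge0 ?mulr_ge0 ?exprn_ge0 ?(ltW A0).
move=> z hz; have [h1 h2] := HB z hz; have h3 := HA z hz.
have p0 : 0 < 1 + normc z by rewrite ltr_pwDl// normc_ge0.
rewrite !big_ord_recr/=; split.
  apply: le_trans (normcD _ _) _; rewrite mulrDl; apply: lerD; first exact: h1.
  rewrite normcM -/n_; apply: (@le_trans _ _ (n_ * (A / (1 + normc z)))); first exact: ler_wpM2l.
  by rewrite mulrA ler_wpM2r ?invr_ge0 ?(ltW p0)// lerDl mulr_ge0 ?exprn_ge0 ?(ltW A0).
apply: le_trans (normcD _ _) _; rewrite mulrDl; apply: lerD; first exact: h2.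
have h4 := decay2_bound 0 (normc_ge0 _) h3.
rewrite normcM normcN -/n_ -exprVn normcX.
apply: le_trans (ler_wpM2l nn h4) _.
by rewrite mulrA ler_wpM2r ?normc_ge0// lerDr mulr_ge0 ?(ltW A0).
Qed.

Lemma Rtilde_cvg r : Rtilde r -> exists a0 : C, r @ F --> a0.
Proof.
move=> [n [a0 [a [lam [hl ->]]]]]; exists a0; apply/ccvgP => e e0.
have [B B0 HB] := Rtilde_decay a hl; exists (B / e) => z h1 /sector_Re hz.
have [h2 _] := HB z hz; rewrite addrAC subrr add0r; apply: le_lt_trans h2 _.
rewrite ltr_pdivrMr ?ltr_pwDl ?normc_ge0// mulrC -ltr_pdivrMr//.
by apply: lt_trans h1 _; rewrite ltrDr.
Qed.

Lemma f_infty_cvg f (l : C) : f @ F --> l -> f_infty f = l.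
Proof. by move=> fl; exact: (cvg_lim (@norm_hausdorff _ _) fl). Qed.

(** [lim] of a divergent function is the default point of [C], which is 0. *)
Lemma f_infty_dvg f : (forall l : C, ~ (f @ F --> l)) -> f_infty f = 0.
Proof. by move=> fl; rewrite /f_infty dvgP// => /cvg_ex[l /fl]. Qed.

(* If [f] has no limit in the sector then [f_infty] is the junk value [0] for [f - r] as well. *)
Lemma f_infty_shift f r : Rtilde r -> exists c : C, f_infty (fun z => f z - (r z + c)) = 0.
Proof.
move=> /Rtilde_cvg[a0 ra].
have [[l fl]|nol] := pselect (exists l : C, f @ F --> l).
  exists (l - a0); apply: f_infty_cvg; apply/ccvgP => e e0; have e2 : 0 < e / 2 by rewrite divr_gt0.
  have [M1 h1] := (ccvgP _ _).1 fl _ e2; have [M2 h2] := (ccvgP _ _).1 ra _ e2.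
  exists (Num.max M1 M2) => z; rewrite gt_max => /andP[m1 m2] hz.
  rewrite (_ : f z - (r z + (l - a0)) - 0 = (f z - l) - (r z - a0)); last by ring.
  by apply: le_lt_trans (normcB _ _) _; rewrite (splitr e); exact: ltrD (h1 z m1 hz) (h2 z m2 hz).
exists 0; apply: f_infty_dvg => l Hl; apply: nol; exists (l + a0).
apply/ccvgP => e e0; have e2 : 0 < e / 2 by rewrite divr_gt0.
have [M1 h1] := (ccvgP _ _).1 Hl _ e2; have [M2 h2] := (ccvgP _ _).1 ra _ e2.
exists (Num.max M1 M2) => z; rewrite gt_max => /andP[m1 m2] hz.
rewrite (_ : f z - (l + a0) = (f z - (r z + 0) - l) + (r z - a0)); last by ring.
by apply: le_lt_trans (normcD _ _) _; rewrite (splitr e); exact: ltrD (h1 z m1 hz) (h2 z m2 hz).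
Qed.

Lemma Rtilde_Ds s r : -1 < s -> Rtilde r -> Ds s r.
Proof.
move=> hs hr; have hh := Rtilde_holo hr; split; first exact: hh.
have hd := halfplane_holo_derive hh.
rewrite Ds0norm_ray; last exact: halfplane_holo_continuous hd.
have [n [a0 [a [lam [hl rE]]]]] := hr; have [B B0 HB] := Rtilde_decay a hl.
apply: (@le_lt_trans _ _ (ray_norm s (fun z => B%:C * decay2 z))).
  apply: ray_norm_le; [exact: Rtilde_hmeas|by apply: hmeasZ; exact: hmeas_decay2|].
  move=> z hz; rewrite normcM normc_real ger0_norm//.
  have -> : 'D_1 r z = \sum_(k < n) - a k / (lam k + z) ^+ 2.
    by rewrite rE; exact: cderiv_val (Rtilde_is_derive a0 a hl hz).
  exact: (HB z hz).2.
rewrite ray_normZ; last exact: hmeas_decay2.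
by rewrite lte_mul_pinfty// ?lee_fin ?normc_ge0// ray_norm_decay2.
Qed.

Lemma Rtilde_dense s f eps : -1 < s -> Ds s f -> 0 < eps ->
  exists r, Rtilde r /\ (Dsnorm s (fun z => (f z - r z)%R) < eps%:E)%E.
Proof.
move=> hs [hf fin] e0; have hf' : halfplane_holo f by exact: hf.
have hd := halfplane_holo_derive hf'.
rewrite Ds0norm_ray in fin; last exact: halfplane_holo_continuous hd.
have [_ /(_ _ e0)[r0 hr0 Hr0]] := approximable_holo hs hd fin.
have [c fc] := f_infty_shift f hr0.
(* The constant [c] annihilates the value at infinity and leaves the derivative, hence the seminorm,
   unchanged. *)
exists (fun z => r0 z + c); split; first exact: RtildeD hr0 (Rtilde_cst c).
have hdiff z : 0 < Re z -> is_derive z 1 (fun z => f z - (r0 z + c)) ('D_1 f z - 'D_1 r0 z).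
  move=> hz; have /derivableP d1 := hf' z hz; have /derivableP d2 := Rtilde_holo hr0 hz.
  move: ('D_1 f z) ('D_1 r0 z) d1 d2 => u v d1 d2.
  by rewrite -(addr0 v); exact: (cderivB d1 (cderivD d2 (cderiv_cst z c))).
have hh : halfplane_holo (fun z => f z - (r0 z + c)) by move=> z /hdiff h; exact: ex_derive.
rewrite /Dsnorm fc ComplexField.Normc.normc0 add0e Ds0norm_ray; last first.
  exact: halfplane_holo_continuous (halfplane_holo_derive hh).
apply: le_lt_trans Hr0; rewrite le_eqVlt; apply/orP; left; apply/eqP.
by apply: ray_norm_ext => z hz; exact: cderiv_val (hdiff z hz).
Qed.

End SectorLimit.

Theorem theorem5p1 (R : realType) (s : R) (hs : -1 < s) :
  (forall r : R[i] -> R[i], Rtilde r -> Ds s r) /\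
  (forall f : R[i] -> R[i], Ds s f ->
     forall eps : R, 0 < eps ->
       exists r : R[i] -> R[i], Rtilde r /\
         (Dsnorm s (fun z => (f z - r z)%R) < eps%:E)%E).
Proof.
split=> [r hr|f hf eps e0]; first exact: Rtilde_Ds.
exact: Rtilde_dense hs hf e0.
Qed.
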